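(* Let $\bar x\in\Gamma$ be a stationary point of (P), let MSCQ hold at $\bar x$ with modulus $\sigma>0$, and suppose $\nabla g(\bar x)u=0$ for all $u\in K_\Gamma(\bar x,-\nabla f(\bar x))$. Assume there is $\kappa>0$ such that: (a) for every $u\in K_\Gamma(\bar x,-\nabla f(\bar x))\cap\mathcal S$ and every $\lambda\in\Lambda(\bar x,-\nabla f(\bar x);u)$: $\langle(\nabla^2 f(\bar x)+\nabla^2\langle\lambda,g\rangle(\bar x))u,u\rangle>\frac1\kappa$; (b) for every $(u,\lambda,v,w)\in\mathcal Z$: $$\langle(\nabla^2 f(\bar x)+\nabla^2\langle\lambda,g\rangle(\bar x))u,u\rangle+\frac{\rho(u,\lambda,v)}{\nabla g_0(\bar x)w+\frac12\nabla^2 g_0(\bar x)(v,v)}>\frac1\kappa\quad\text{whenever }\nabla g(\bar x)w+\tfrac12\nabla^2 g(\bar x)(v,v)\ne0,$$ and $\langle(\nabla^2 f(\bar x)+\nabla^2\langle\lambda,g\rangle(\bar x))u,u\rangle>\frac1\kappa$ whenever $\rho(u,\lambda,v)=0$. Then $\bar x$ is a tilt-stable local minimizer of (P) with modulus $\kappa$, and $\mathrm{tilt}(f+\delta_\Gamma,\bar x)\le 1/\min\{\chi_1,\chi_2,\chi_3\}$, where $\chi_1:=\inf\{\langle(\nabla^2 f(\bar x)+\nabla^2\langle\lambda,g\rangle(\bar x))u,u\rangle: u\in K_\Gamma(\bar x,-\nabla f(\bar x))\cap\mathcal S,\ \lambda\in\Lambda(\bar x,-\nabla f(\bar x);u)\}$,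 $\chi_2:=\inf\{\langle(\nabla^2 f(\bar x)+\nabla^2\langle\lambda,g\rangle(\bar x))u,u\rangle:\exists v,w\text{ with }(u,\lambda,v,w)\in\mathcal Z,\ \rho(u,\lambda,v)=0\}$, $\chi_3:=\inf\{\langle(\nabla^2 f(\bar x)+\nabla^2\langle\lambda,g\rangle(\bar x))u,u\rangle+\frac{\rho(u,\lambda,v)}{\nabla g_0(\bar x)w+\frac12\nabla^2 g_0(\bar x)(v,v)}:(u,\lambda,v,w)\in\mathcal Z,\ \nabla g(\bar x)w+\frac12\nabla^2 g(\bar x)(v,v)\ne0\}$.
   Context: Setting. Let $n,m\ge1$ and let $\mathcal Q:=\{(q_0,q_r)\in\mathbb R\times\mathbb R^m:\|q_r\|\le q_0\}$ be the second-order cone. For $q=(q_0,q_r)\in\mathbb R^{1+m}$ write $\hat q:=(-q_0,q_r)$, and let $\mathcal Q^*:=\{\hat q: q\in\mathcal Q\}=\{(q_0,q_r):\|q_r\|\le-q_0\}$. The normal cone to $\mathcal Q$ at $q\in\mathcal Q$ is $N_{\mathcal Q}(q)=\mathcal Q^*$ if $q=0$, $N_{\mathcal Q}(q)=\{0\}$ if $q\in\operatorname{int}\mathcal Q$, and $N_{\mathcal Q}(q)=\{\alpha\hat q:\alpha\ge0\}$ if $q\in\operatorname{bd}\mathcal Q\setminus\{0\}$. Problem (P) is: minimize $f(x)$ subject to $x\in\Gamma:=\{x\in\mathbb R^n: g(x)\in\mathcal Q\}$, where $f:\mathbb R^n\to\mathbb R$ and $g=(g_0,g_r):\mathbb R^n\to\mathbb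 R\times\mathbb R^m$ are $C^2$-smooth around a point $\bar x\in\Gamma$ with $g(\bar x)=0$. $\nabla g(x)$ is the Jacobian, $\nabla g(x)^*$ its transpose, $\nabla^2 g(x)(u,v)\in\mathbb R^{1+m}$ is the vector with components $u^T\nabla^2 g_i(x)v$, and $\nabla^2\langle\lambda,g\rangle(x)=\sum_i\lambda_i\nabla^2 g_i(x)$. $\mathcal S$ is the unit sphere. Infima over empty sets are $+\infty$. MSCQ. The metric subregularity constraint qualification (MSCQ) holds at $\bar x$ with modulus $\sigma>0$ if there is a neighborhood $U$ of $\bar x$ with $\operatorname{dist}(x;\Gamma)\le\sigma\operatorname{dist}(g(x);\mathcal Q)$ for all $x\in U$. Multipliers and cones. $T_\Gamma(x)$ is the Bouligand tangent cone $\{v:\exists t_k\downarrow0,\ v_k\to v,\ x+t_kv_k\in\Gamma\}$. For $x\in\Gamma$, $x^*\in\mathbb R^n$: $\Lambda(x,x^* ):=\{\lambda\in N_{\mathcal Q}(g(x)):\nabla g(x)^*\lambda=x^*\}$; $\Lambda^0(x,x^* ):=\{0\}$ if $x^*=0$ and $\Lambda^0(x,x^* ):=\Lambda(x,x^* )$ otherwise; the critical cone is $K_\Gamma(x,x^* ):=\{u\in T_\Gamma(x):\langle x^*,u\rangle=0\}$. The curvature mapping is $\mathcal H(x,\lambda):=\frac{-\lambda_0}{g_0(x)}\big(\nabla g_r(x)^*\nabla g_r(x)-\nabla g_0(x)^*\nabla g_0(x)\big)$ if $g(x)\in\operatorname{bd}\mathcal Q\setminus\{0\}$ and $\mathcal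 H(x,\lambda):=0$ otherwise. The directional multiplier set is $\Lambda(x,x^*;u):=\operatorname{argmax}_{\lambda\in\Lambda(x,x^* )}\langle(\nabla^2\langle\lambda,g\rangle(x)+\mathcal H(x,\lambda))u,u\rangle$. The set $\mathcal Z$ and the function $\rho$. $\mathcal Z:=\{(u,\lambda,v,w)\in\mathcal S\times\Lambda^0(\bar x,-\nabla f(\bar x))\times\mathcal S\times\mathbb R^n:\ \langle\lambda,\nabla g(\bar x)u\rangle=0,\ \lambda_0(\|\nabla g_r(\bar x)u\|^2-(\nabla g_0(\bar x)u)^2)=0,\ \nabla g(\bar x)v=0,\ \lambda\in N_{\mathcal Q}(\nabla g(\bar x)w+\tfrac12\nabla^2 g(\bar x)(v,v))\}$ (the last condition includes $\nabla g(\bar x)w+\tfrac12\nabla^2 g(\bar x)(v,v)\in\mathcal Q$). For $(u,\lambda,v)\in\mathbb R^n\times\mathcal Q^*\times\mathbb R^n$, $$\rho(u,\lambda,v):=\inf_{z\in\mathbb R^n}\Big\{-\lambda_0\Big(\|\nabla g_r(\bar x)z+\nabla^2 g_r(\bar x)(v,u)\|^2-\big(\nabla g_0(\bar x)z+\nabla^2 g_0(\bar x)(v,u)\big)^2\Big)\;\Big|\;\langle\lambda,\nabla g(\bar x)z+\nabla^2 g(\bar x)(v,u)\rangle=0\Big\},$$ with $\rho(u,\lambda,v):=+\infty$ if the constraint set is empty. Stationarity and tilt stability. $\bar x$ is a stationary point of (P) if $-\nabla f(\bar x)\in N_\Gamma(\bar x)$, where $N_\Gamma$ is the limiting (Mordukhovich)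 normal cone. Let $\varphi:=f+\delta_\Gamma$ ($\delta_\Gamma$ the indicator function of $\Gamma$). $\bar x$ is a tilt-stable local minimizer of (P) with modulus $\kappa>0$ if there is $\gamma>0$ such that $M_\gamma(v^* ):=\operatorname{argmin}\{\varphi(x)-\langle v^*,x\rangle:\|x-\bar x\|\le\gamma\}$ is single-valued and Lipschitz continuous with constant $\kappa$ on a neighborhood of $0$, with $M_\gamma(0)=\{\bar x\}$. The exact bound of tilt stability is $\mathrm{tilt}(\varphi,\bar x):=\inf_{\gamma>0}\operatorname{lip}M_\gamma(0)$, where $\operatorname{lip}M_\gamma(0)$ is the infimum of the Lipschitz constants of $M_\gamma$ on neighborhoods of $0$. *)

(* Defs.v *)
From Stdlib Require Import Reals ClassicalEpsilon.
From Stdlib Require Vectors.Fin.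
Open Scope R_scope.

Definition Vec (n : nat) := Fin.t n -> R.
Definition Mat (n : nat) := Fin.t n -> Fin.t n -> R.

Fixpoint sumF (n : nat) : (Fin.t n -> R) -> R :=
  match n with
  | O => fun _ => 0
  | S k => fun f => f (@Fin.F1 k) + sumF k (fun i => f (Fin.FS i))
  end.

Definition vzero {n} : Vec n := fun _ => 0.
Definition vadd {n} (x y : Vec n) : Vec n := fun i => x i + y i.
Definition vsub {n} (x y : Vec n) : Vec n := fun i => x i - y i.
Definition vscal {n} (a : R) (x : Vec n) : Vec n := fun i => a * x i.
Definition vopp {n} (x : Vec n) : Vec n := fun i => - x i.
Definition dot {n} (x y : Vec n) : R := sumF n (fun i => x i * y i).
Definition vnorm {n} (x : Vec n) : R := sqrt (dot x x).
Definition sphere {n} (u : Vec n) : Prop := vnorm u = 1.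

Definition mzero {n} : Mat n := fun _ _ => 0.
Definition madd {n} (A B : Mat n) : Mat n := fun i j => A i j + B i j.
Definition mscal {n} (a : R) (A : Mat n) : Mat n := fun i j => a * A i j.
Definition msum {n} (m : nat) (F : Fin.t m -> Mat n) : Mat n :=
  fun i j => sumF m (fun k => F k i j).
Definition mv {n} (A : Mat n) (v : Vec n) : Vec n := fun i => dot (A i) v.
Definition quad {n} (A : Mat n) (u v : Vec n) : R := dot u (mv A v).

Definition Y (m : nat) := (R * Vec m)%type.
Definition yzero {m} : Y m := (0, vzero).
Definition yadd {m} (a b : Y m) : Y m := (fst a + fst b, vadd (snd a) (snd b)).
Definition yscal {m} (c : R) (a : Y m) : Y m := (c * fst a, vscal c (snd a)).
Definition ysub {m} (a b : Y m) : Y m := (fst a - fst b, vsub (snd a) (snd b)).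
Definition ydot {m} (a b : Y m) : R := fst a * fst b + dot (snd a) (snd b).
Definition ynorm {m} (a : Y m) : R := sqrt (ydot a a).

Definition inQ {m} (q : Y m) : Prop := vnorm (snd q) <= fst q.
Definition inQstar {m} (q : Y m) : Prop := vnorm (snd q) <= - fst q.
Definition inQint {m} (q : Y m) : Prop := vnorm (snd q) < fst q.
Definition inQbdnz {m} (q : Y m) : Prop := vnorm (snd q) = fst q /\ q <> yzero.
Definition hat {m} (q : Y m) : Y m := (- fst q, snd q).
(* lam \in N_Q(q); empty when q \notin Q *)
Definition NQ {m} (q lam : Y m) : Prop :=
  (q = yzero /\ inQstar lam)
  \/ (inQint q /\ lam = yzero)
  \/ (inQbdnz q /\ exists a, 0 <= a /\ lam = yscal a (hat q)).

Inductive ER := ERfin (r : R) | ERpinf | ERminf.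

Definition ER_le (a b : ER) : Prop :=
  match a, b with
  | ERminf, _ => True
  | _, ERpinf => True
  | ERfin x, ERfin y => x <= y
  | _, _ => False
  end.
Definition ER_lt (a b : ER) : Prop := ER_le a b /\ a <> b.

Definition is_ER_inf (S : ER -> Prop) (a : ER) : Prop :=
  (forall x, S x -> ER_le a x) /\
  (forall b, (forall x, S x -> ER_le b x) -> ER_le b a).
(* infimum in [-oo,+oo] (inf of the empty set is +oo) *)
Definition ER_inf (S : ER -> Prop) : ER := epsilon (inhabits ERpinf) (is_ER_inf S).
Definition ER_min (a b : ER) : ER := ER_inf (fun x => x = a \/ x = b).
Definition ER_addr (r : R) (e : ER) : ER :=
  match e with ERfin x => ERfin (r + x) | ERpinf => ERpinf | ERminf => ERminf end.
(* division by a real d (only used with d > 0) *)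
Definition ER_divr (e : ER) (d : R) : ER :=
  match e with ERfin x => ERfin (x / d) | ERpinf => ERpinf | ERminf => ERminf end.
(* 1/e (only used with e > 0), with 1/(+oo) = 0 *)
Definition ER_inv (e : ER) : ER :=
  match e with ERfin x => ERfin (/ x) | ERpinf => ERfin 0 | ERminf => ERfin 0 end.

(* real infimum (used for distances to nonempty sets) *)
Definition is_glb (S : R -> Prop) (a : R) : Prop :=
  (forall x, S x -> a <= x) /\ (forall b, (forall x, S x -> b <= x) -> b <= a).
Definition Rglb (S : R -> Prop) : R := epsilon (inhabits 0) (is_glb S).
Definition distV {n} (x : Vec n) (C : Vec n -> Prop) : R :=
  Rglb (fun d => exists y, C y /\ d = vnorm (vsub x y)).
Definition distY {m} (q : Y m) (C : Y m -> Prop) : R :=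
  Rglb (fun d => exists p, C p /\ d = ynorm (ysub q p)).

Definition has_grad {n} (h : Vec n -> R) (x d : Vec n) : Prop :=
  forall eps, 0 < eps -> exists del, 0 < del /\ forall y, vnorm (vsub y x) < del ->
    Rabs (h y - h x - dot d (vsub y x)) <= eps * vnorm (vsub y x).
Definition has_jac {n} (F : Vec n -> Vec n) (x : Vec n) (A : Mat n) : Prop :=
  forall eps, 0 < eps -> exists del, 0 < del /\ forall y, vnorm (vsub y x) < del ->
    vnorm (vsub (vsub (F y) (F x)) (mv A (vsub y x))) <= eps * vnorm (vsub y x).
Definition mat_cont_at {n} (H : Vec n -> Mat n) (x : Vec n) : Prop :=
  forall i j eps, 0 < eps -> exists del, 0 < del /\ forall y, vnorm (vsub y x) < del ->
    Rabs (H y i j - H x i j) < eps.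
Definition C2_around {n} (h : Vec n -> R) (Dh : Vec n -> Vec n) (D2h : Vec n -> Mat n)
  (xb : Vec n) : Prop :=
  exists r, 0 < r /\ forall x, vnorm (vsub x xb) < r ->
    has_grad h x (Dh x) /\ has_jac Dh x (D2h x) /\ mat_cont_at D2h x.

Definition vconv {n} (s : nat -> Vec n) (v : Vec n) : Prop :=
  forall eps, 0 < eps -> exists N, forall k, (N <= k)%nat -> vnorm (vsub (s k) v) < eps.
Definition tangent {n} (C : Vec n -> Prop) (x v : Vec n) : Prop :=
  exists (t : nat -> R) (vs : nat -> Vec n),
    (forall k, 0 < t k) /\ Un_cv t 0 /\ vconv vs v /\
    (forall k, C (vadd x (vscal (t k) (vs k)))).
Definition frechet_normal {n} (C : Vec n -> Prop) (x xs : Vec n) : Prop :=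
  C x /\ forall eps, 0 < eps -> exists del, 0 < del /\ forall y, C y ->
    vnorm (vsub y x) < del -> dot xs (vsub y x) <= eps * vnorm (vsub y x).
Definition lim_normal {n} (C : Vec n -> Prop) (x xs : Vec n) : Prop :=
  C x /\ exists (xk xsk : nat -> Vec n),
    (forall k, frechet_normal C (xk k) (xsk k)) /\ vconv xk x /\ vconv xsk xs.

Record Prob (n m : nat) := mkProb {
  pf : Vec n -> R; pDf : Vec n -> Vec n; pD2f : Vec n -> Mat n;
  pg0 : Vec n -> R; pDg0 : Vec n -> Vec n; pD2g0 : Vec n -> Mat n;
  pgr : Vec n -> Vec m; pDgr : Fin.t m -> Vec n -> Vec n; pD2gr : Fin.t m -> Vec n -> Mat n
}.
Arguments pf {n m}. Arguments pDf {n m}. Arguments pD2f {n m}.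
Arguments pg0 {n m}. Arguments pDg0 {n m}. Arguments pD2g0 {n m}.
Arguments pgr {n m}. Arguments pDgr {n m}. Arguments pD2gr {n m}.

Section Problem.
Context {n m : nat} (P : Prob n m).

Definition g (x : Vec n) : Y m := (pg0 P x, pgr P x).
Definition Gamma (x : Vec n) : Prop := inQ (g x).
Definition Jg (x u : Vec n) : Y m := (dot (pDg0 P x) u, fun k => dot (pDgr P k x) u).
Definition JgT (x : Vec n) (lam : Y m) : Vec n :=
  vadd (vscal (fst lam) (pDg0 P x)) (fun i => sumF m (fun k => snd lam k * pDgr P k x i)).
Definition Hg (x u v : Vec n) : Y m :=
  (quad (pD2g0 P x) u v, fun k => quad (pD2gr P k x) u v).
Definition HLag (x : Vec n) (lam : Y m) : Mat n :=
  madd (mscal (fst lam) (pD2g0 P x)) (msum m (fun k => mscal (snd lam k) (pD2gr P k x))).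
Definition Curv (x : Vec n) (lam : Y m) : Mat n :=
  if excluded_middle_informative (inQbdnz (g x))
  then mscal (- fst lam / pg0 P x)
         (fun i j => sumF m (fun k => pDgr P k x i * pDgr P k x j) - pDg0 P x i * pDg0 P x j)
  else mzero.

Definition Lambda (x xs : Vec n) (lam : Y m) : Prop := NQ (g x) lam /\ JgT x lam = xs.
Definition Lambda0 (x xs : Vec n) (lam : Y m) : Prop :=
  (xs = vzero /\ lam = yzero) \/ (xs <> vzero /\ Lambda x xs lam).
Definition crit (x xs u : Vec n) : Prop := tangent Gamma x u /\ dot xs u = 0.
Definition dirmult (x xs u : Vec n) (lam : Y m) : Prop :=
  Lambda x xs lam /\ forall mu, Lambda x xs mu ->
    quad (madd (HLag x mu) (Curv x mu)) u u <= quad (madd (HLag x lam) (Curv x lam)) u u.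

Definition stationary (xb : Vec n) : Prop := lim_normal Gamma xb (vopp (pDf P xb)).
Definition MSCQ (xb : Vec n) (sigma : R) : Prop :=
  exists r, 0 < r /\ forall x, vnorm (vsub x xb) < r ->
    distV x Gamma <= sigma * distY (g x) inQ.

Definition Aval (xb : Vec n) (lam : Y m) (u : Vec n) : R :=
  quad (madd (pD2f P xb) (HLag xb lam)) u u.
Definition qZ (xb v w : Vec n) : Y m := yadd (Jg xb w) (yscal (1/2) (Hg xb v v)).

Definition Zset (xb u : Vec n) (lam : Y m) (v w : Vec n) : Prop :=
  sphere u /\ Lambda0 xb (vopp (pDf P xb)) lam /\ sphere v /\
  ydot lam (Jg xb u) = 0 /\
  fst lam * ((vnorm (snd (Jg xb u)))^2 - (fst (Jg xb u))^2) = 0 /\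
  Jg xb v = yzero /\
  NQ (qZ xb v w) lam.

Definition rho (xb u : Vec n) (lam : Y m) (v : Vec n) : ER :=
  ER_inf (fun e => exists z,
    ydot lam (yadd (Jg xb z) (Hg xb v u)) = 0 /\
    e = ERfin (- fst lam * ((vnorm (snd (yadd (Jg xb z) (Hg xb v u))))^2
                            - (fst (yadd (Jg xb z) (Hg xb v u)))^2))).

Definition chi1 (xb : Vec n) : ER :=
  ER_inf (fun e => exists u lam, crit xb (vopp (pDf P xb)) u /\ sphere u /\
    dirmult xb (vopp (pDf P xb)) u lam /\ e = ERfin (Aval xb lam u)).
Definition chi2 (xb : Vec n) : ER :=
  ER_inf (fun e => exists u lam, (exists v w, Zset xb u lam v w /\ rho xb u lam v = ERfin 0)
    /\ e = ERfin (Aval xb lam u)).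
Definition chi3 (xb : Vec n) : ER :=
  ER_inf (fun e => exists u lam v w, Zset xb u lam v w /\ qZ xb v w <> yzero /\
    e = ER_addr (Aval xb lam u) (ER_divr (rho xb u lam v) (fst (qZ xb v w)))).

Definition Mgam (xb : Vec n) (gam : R) (vs x : Vec n) : Prop :=
  vnorm (vsub x xb) <= gam /\ Gamma x /\
  forall y, vnorm (vsub y xb) <= gam -> Gamma y ->
    pf P x - dot vs x <= pf P y - dot vs y.
Definition lip_on (xb : Vec n) (gam r l : R) : Prop :=
  (forall vs, vnorm vs < r -> exists! x, Mgam xb gam vs x) /\
  (forall v1 v2 x1 x2, vnorm v1 < r -> vnorm v2 < r ->
     Mgam xb gam v1 x1 -> Mgam xb gam v2 x2 -> vnorm (vsub x1 x2) <= l * vnorm (vsub v1 v2)).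
Definition tilt_stable (xb : Vec n) (kappa : R) : Prop :=
  exists gam, 0 < gam /\ (exists r, 0 < r /\ lip_on xb gam r kappa) /\
    (forall x, Mgam xb gam vzero x <-> x = xb).
Definition lipM (xb : Vec n) (gam : R) : ER :=
  ER_inf (fun e => exists l r, 0 <= l /\ 0 < r /\ lip_on xb gam r l /\ e = ERfin l).
Definition tilt (xb : Vec n) : ER :=
  ER_inf (fun e => exists gam, 0 < gam /\ e = lipM xb gam).

End Problem.

(* Main.v *)
Require Import Defs.
From Stdlib Require Import Reals Lra Lia ClassicalEpsilon FunctionalExtensionality.
From mathcomp Require filter.
Set Bullet Behavior "Strict Subproofs".
Open Scope R_scope.

(** A multiplier of bounded size exists for every normal to [Gamma] near [xb] (exact penalization
    under subregularity), so [f + delta_Gamma] is prox-regular: adding [C |x - xb|^2] makes its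
    argmin map [T] single-valued and Lipschitz. If [T] is calm with constant
    [1 / (2 C + 1 / kappa)] at each point, it is Lipschitz with that constant on a ball; being the
    gradient of a conjugate, it then yields the growth
    [f z >= f x + <v, z - x> + |z - x|^2 / (2 kappa)], uniformly over the graph of the
    subdifferential, and this is tilt stability.

    Calmness is an infinitesimal strong monotonicity of the KKT system. If it fails at [x_k -> xb]
    along [x_k' -> x_k], one takes limits along a nonprincipal ultrafilter. When [x_k <> xb], with
    [t = |x_k - xb|] and [s = |x_k' - x_k|], the quotients [g x_k / t^2] and
    [(g x_k' - g x_k) / (s t)] converge: a blow-up would give a critical direction [d] with
    [Jg d <> 0]. Their limits and the mean of the two limit multipliers form an element of
    [Zset] violating (b); the cone enters only through [NQ_curvature]. When [x_k = xb], the
    quotient [g x_k' / s^2] converges and shows that the limit multiplier is a directional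
    multiplier violating (a). *)

(** * Limits along a nonprincipal ultrafilter *)

(** The main obstacle is uniformity. The radius in [pointwise_strong_monotone] depends on the point
    and may vanish as the point tends to [xb], so no common neighbourhood is at hand.
    [segment_lipschitz] removes this: a calmness constant valid at every point of a segment is a
    Lipschitz constant along it, whatever the radii. The mean multiplier comes from a
    symmetrization. Pairing one multiplier with the expansion of [g] at [x_k] and the other with the
    expansion at [x_k'] gives two halves of the second derivative. By complementarity the remainder
    consists of two nonnegative cross terms, [D1] and [D2] after division by [s^2]. Off [xb] their
    limits dominate the quotient of [rho] in (b); at [xb] the first of them converts the mean into
    the directional multiplier of (a). An ultrafilter makes all bounded sequences converge at once,
    so no subsequence is extracted. *)

Lemma nonprincipal_ultrafilter : exists U : (nat -> Prop) -> Prop,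
  (forall P Q : nat -> Prop, U P -> U (fun k => P k -> Q k) -> U Q) /\
  (forall P, U P \/ U (fun k => ~ P k)) /\
  (forall P, U P -> exists k, P k) /\
  (forall N, U (fun k => (N <= k)%nat)).
Proof.
  (* The filter of cofinal tails: an ultrafilter above it contains every tail and is therefore
     nonprincipal. *)
  pose (F := fun A : nat -> Prop => exists N, forall k, (N <= k)%nat -> A k).
  assert (HF : @filter.ProperFilter nat F).
  { constructor.
    - intros [N HN]. exact (HN N (le_n N)).
    - constructor.
      + exists 0%nat. intros k _. exact I.
      + intros A B [N HN] [M HM]. exists (Nat.max N M). intros k Hk.
        split; [apply HN | apply HM]; lia.
      + intros A B HAB [N HN]. exists N. intros k Hk. apply HAB, HN, Hk. }
  destruct (@filter.ultraFilterLemma nat F HF) as [G [GU HFG]].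
  exists G.
  pose proof (@filter.ultra_proper _ _ GU) as GP.
  pose proof (@filter.filter_filter _ _ GP) as GF.
  assert (Hmp : forall P Q : nat -> Prop, G P -> G (fun k => P k -> Q k) -> G Q).
  { intros P Q HP HPQ.
    apply (@filter.filterS _ _ GF (fun k => P k /\ (P k -> Q k))).
    - intros k [h1 h2]. exact (h2 h1).
    - exact (@filter.filterI _ _ GF _ _ HP HPQ). }
  split; [exact Hmp |]. split; [| split].
  - intros P. destruct (classic (G P)) as [h | h]; [left; exact h | right].
    destruct (classic (exists B, G B /\ forall k, B k -> ~ P k)) as [[B [HB HBP]] | hB].
    + apply (@filter.filterS _ _ GF B); [exact HBP | exact HB].
    + exfalso. apply h.
      (* Maximality is applied to the filter generated by [G] and [P]. It is proper because no
         member of [G] avoids [P], so it coincides with [G], and it contains [P]. *)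
      pose (H := fun A : nat -> Prop => exists B, G B /\ forall k, B k -> P k -> A k).
      assert (HH : @filter.ProperFilter nat H).
      { constructor.
        - intros [B [HB HBP]]. apply hB. exists B. split; [exact HB |].
          intros k hk hp. exact (HBP k hk hp).
        - constructor.
          + exists (fun _ => True). split; [apply (@filter.filterT _ _ GF) | intros; exact I].
          + intros A A' [B [HB HA]] [B' [HB' HA']]. exists (fun k => B k /\ B' k).
            split; [exact (@filter.filterI _ _ GF _ _ HB HB') |].
            intros k [h1 h2] hp. split; [apply HA | apply HA']; assumption.
          + intros A A' hA [B [HB HBA]]. exists B. split; [exact HB |].
            intros k hk hp. apply hA, HBA; assumption. }
      rewrite <- (@filter.max_filter _ _ GU H HH).
      * exists (fun _ => True). split; [apply (@filter.filterT _ _ GF) | auto].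
      * intros A HA. exists A. auto.
  - intros P HP. destruct (classic (exists k, P k)) as [h | h]; [exact h |].
    exfalso. apply (@filter.filter_not_empty _ _ GP).
    apply (@filter.filterS _ _ GF P); [| exact HP].
    intros k hk. apply h. exists k. exact hk.
  - intros N. apply HFG. exists N. auto.
Qed.

(** One ultrafilter is fixed for the whole proof; [ev P] reads: [P] holds for almost all indices. It
    decides every predicate ([ev_em]), which is what replaces passing to subsequences. *)
Definition ev : (nat -> Prop) -> Prop :=
  proj1_sig (constructive_indefinite_description _ nonprincipal_ultrafilter).

Lemma ev_spec :
  (forall P Q : nat -> Prop, ev P -> ev (fun k => P k -> Q k) -> ev Q) /\
  (forall P, ev P \/ ev (fun k => ~ P k)) /\
  (forall P, ev P -> exists k, P k) /\
  (forall N, ev (fun k => (N <= k)%nat)).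
Proof. exact (proj2_sig (constructive_indefinite_description _ nonprincipal_ultrafilter)). Qed.

Lemma ev_all (P : nat -> Prop) : (forall k, P k) -> ev P.
Proof.
  intros H. destruct ev_spec as [_ [Hn [He _]]].
  destruct (Hn P) as [h | h]; [exact h |]. destruct (He _ h) as [k hk]. destruct (hk (H k)).
Qed.

Lemma ev_mp (P Q : nat -> Prop) : ev P -> ev (fun k => P k -> Q k) -> ev Q.
Proof. apply (proj1 ev_spec). Qed.

Lemma ev_em (P : nat -> Prop) : ev P \/ ev (fun k => ~ P k).
Proof. apply (proj1 (proj2 ev_spec)). Qed.

Lemma ev_ex (P : nat -> Prop) : ev P -> exists k, P k.
Proof. apply (proj1 (proj2 (proj2 ev_spec))). Qed.

Lemma ev_ge (N : nat) : ev (fun k => (N <= k)%nat).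
Proof. apply (proj2 (proj2 (proj2 ev_spec))). Qed.

Lemma ev_imp (P Q : nat -> Prop) : (forall k, P k -> Q k) -> ev P -> ev Q.
Proof. intros h hp. apply (ev_mp P); [exact hp | apply ev_all, h]. Qed.

Lemma ev_const (A : Prop) : ev (fun _ => A) -> A.
Proof. intros h. destruct (ev_ex _ h) as [_ ha]. exact ha. Qed.

Definition ul (s : nat -> R) (l : R) : Prop :=
  forall eps, 0 < eps -> ev (fun k => Rabs (s k - l) < eps).

Lemma ul_const (c : R) : ul (fun _ => c) c.
Proof. intros e he. apply ev_all. intros k. rewrite Rminus_diag, Rabs_R0. exact he. Qed.

Lemma ul_ext (s t : nat -> R) (l : R) : ev (fun k => s k = t k) -> ul s l -> ul t l.
Proof.
  intros h hs e he. apply (ev_mp _ _ h). refine (ev_imp _ _ _ (hs e he)).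
  intros k hk <-. exact hk.
Qed.

Lemma ul_ext_all (s t : nat -> R) (l : R) : (forall k, s k = t k) -> ul s l -> ul t l.
Proof. intros h. apply ul_ext, ev_all, h. Qed.

Lemma ul_plus (s t : nat -> R) (a b : R) :
  ul s a -> ul t b -> ul (fun k => s k + t k) (a + b).
Proof.
  intros hs ht e he. assert (he2 : 0 < e / 2) by lra.
  apply (ev_mp _ _ (hs _ he2)). refine (ev_imp _ _ _ (ht _ he2)). intros k h2 h1.
  unfold Rabs in *; repeat destruct Rcase_abs; lra.
Qed.

Lemma ul_bound (s : nat -> R) (a : R) : ul s a -> ev (fun k => Rabs (s k) <= Rabs a + 1).
Proof.
  intros hs. refine (ev_imp _ _ _ (hs 1 Rlt_0_1)). intros k hk.
  unfold Rabs in *; repeat destruct Rcase_abs; lra.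
Qed.

Lemma ul_squeeze (s t : nat -> R) (l : R) :
  ev (fun k => Rabs (s k - l) <= t k) -> ul t 0 -> ul s l.
Proof.
  intros h ht e he. apply (ev_mp _ _ h). refine (ev_imp _ _ _ (ht e he)).
  intros k h1 h2. unfold Rabs in *; repeat destruct Rcase_abs; lra.
Qed.

Lemma ul_0_bounded (s t : nat -> R) (M : R) :
  ul s 0 -> ev (fun k => Rabs (t k) <= M) -> ul (fun k => s k * t k) 0.
Proof.
  intros hs ht e he.
  assert (hM : 0 < Rabs M + 1) by (pose proof (Rabs_pos M); lra).
  assert (he' : 0 < e / (Rabs M + 1)) by (apply Rdiv_lt_0_compat; lra).
  apply (ev_mp _ _ ht). refine (ev_imp _ _ _ (hs _ he')).
  intros k h1 h2. rewrite Rminus_0_r in *. rewrite Rabs_mult.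
  apply Rle_lt_trans with (Rabs (s k) * (Rabs M + 1)).
  - apply Rmult_le_compat_l; [apply Rabs_pos |].
    pose proof (Rle_abs M). lra.
  - apply Rmult_lt_compat_r with (r := Rabs M + 1) in h1; [| exact hM].
    replace (e / (Rabs M + 1) * (Rabs M + 1)) with e in h1 by (field; lra). exact h1.
Qed.

Lemma ul_opp (s : nat -> R) (a : R) : ul s a -> ul (fun k => - s k) (- a).
Proof.
  intros hs e he. refine (ev_imp _ _ _ (hs e he)). intros k hk.
  replace (- s k - - a) with (- (s k - a)) by ring. rewrite Rabs_Ropp. exact hk.
Qed.

Lemma ul_minus (s t : nat -> R) (a b : R) :
  ul s a -> ul t b -> ul (fun k => s k - t k) (a - b).
Proof. intros hs ht. apply (ul_plus _ _ _ _ hs (ul_opp _ _ ht)). Qed.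

Lemma ul_sub0 (s : nat -> R) (a : R) : ul s a <-> ul (fun k => s k - a) 0.
Proof.
  split; intros h e he; refine (ev_imp _ _ _ (h e he)); intros k; rewrite Rminus_0_r; auto.
Qed.

Lemma ul_mult (s t : nat -> R) (a b : R) :
  ul s a -> ul t b -> ul (fun k => s k * t k) (a * b).
Proof.
  intros hs ht. apply (proj2 (ul_sub0 _ _)).
  apply ul_ext_all with (fun k => (s k - a) * t k + (t k - b) * a); [intros k; ring |].
  replace 0 with (0 + 0) by ring. apply ul_plus.
  - apply ul_0_bounded with (Rabs b + 1); [exact (proj1 (ul_sub0 _ _) hs) | apply ul_bound, ht].
  - apply ul_0_bounded with (Rabs a); [exact (proj1 (ul_sub0 _ _) ht) | apply ev_all; intros; lra].
Qed.

Lemma ul_scal (c : R) (s : nat -> R) (a : R) : ul s a -> ul (fun k => c * s k) (c * a).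
Proof. apply ul_mult, ul_const. Qed.

Lemma ul_comp (f : R -> R) (s : nat -> R) (l : R) :
  continuity_pt f l -> ul s l -> ul (fun k => f (s k)) (f l).
Proof.
  intros hf hs e he. destruct (hf e he) as [d [hd H]].
  refine (ev_imp _ _ _ (hs d hd)). intros k hk.
  destruct (Req_dec (s k) l) as [-> | hne].
  - rewrite Rminus_diag, Rabs_R0. exact he.
  - apply (H (s k)). split; [split; [exact I | auto] | exact hk].
Qed.

Lemma ul_sqrt (s : nat -> R) (l : R) : 0 <= l -> ul s l -> ul (fun k => sqrt (s k)) (sqrt l).
Proof. intros hl. apply (ul_comp sqrt), continuity_pt_sqrt, hl. Qed.

Lemma ul_le (s t : nat -> R) (a b : R) :
  ul s a -> ul t b -> ev (fun k => s k <= t k) -> a <= b.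
Proof.
  intros hs ht h. apply Rnot_lt_le. intros hlt.
  assert (he : 0 < (a - b) / 2) by lra.
  apply (ev_const False). apply (ev_mp _ _ h), (ev_mp _ _ (hs _ he)).
  refine (ev_imp _ _ _ (ht _ he)). intros k h1 h2 h3.
  unfold Rabs in *; repeat destruct Rcase_abs; lra.
Qed.

Lemma ul_le_c (s : nat -> R) (a b : R) : ul s a -> ev (fun k => s k <= b) -> a <= b.
Proof. intros hs. apply (ul_le _ _ _ _ hs (ul_const b)). Qed.

Lemma ul_ge_c (s : nat -> R) (a b : R) : ul s a -> ev (fun k => b <= s k) -> b <= a.
Proof. intros hs. apply (ul_le _ _ _ _ (ul_const b) hs). Qed.

Lemma ul_unique (s : nat -> R) (a b : R) : ul s a -> ul s b -> a = b.
Proof.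
  intros ha hb. apply Rle_antisym; [apply (ul_le s s) | apply (ul_le s s)]; auto;
  apply ev_all; intros; lra.
Qed.

(** The limit is the supremum of the levels that the sequence exceeds almost everywhere; the
    ultrafilter decides on which side of each level the sequence lies. *)
Lemma ul_exists (s : nat -> R) (M : R) : ev (fun k => Rabs (s k) <= M) -> exists l, ul s l.
Proof.
  intros hM.
  destruct (completeness (fun a => ev (fun k => a <= s k))) as [l [Hub Hlub]].
  - exists M. intros a ha. apply (ev_const (a <= M)). apply (ev_mp _ _ hM).
    refine (ev_imp _ _ _ ha). intros k h1 h2. pose proof (Rle_abs (s k)). lra.
  - exists (- M). refine (ev_imp _ _ _ hM). intros k hk.
    pose proof (Rle_abs (- s k)). rewrite Rabs_Ropp in *. lra.
  - exists l. intros e he.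
    assert (h1 : ev (fun k => s k < l + e)).
    { destruct (ev_em (fun k => l + e <= s k)) as [h | h].
      - specialize (Hub _ h). lra.
      - refine (ev_imp _ _ _ h). intros k; lra. }
    assert (h2 : ev (fun k => l - e < s k)).
    { destruct (ev_em (fun k => l - e < s k)) as [h | h]; [exact h | exfalso].
      assert (Hc : l <= l - e); [| lra].
      apply Hlub. intros a ha. apply (ev_const (a <= l - e)). apply (ev_mp _ _ h).
      refine (ev_imp _ _ _ ha). intros k; lra. }
    apply (ev_mp _ _ h1). refine (ev_imp _ _ _ h2). intros k a b.
    unfold Rabs; destruct Rcase_abs; lra.
Qed.

(** Failing to be bounded along an ultrafilter already means exceeding every bound almost
    everywhere. The blow-up arguments rest on this dichotomy. *)
Lemma ul_bounded_or_inv (s : nat -> R) :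
  (exists l, ul s l) \/ (ev (fun k => s k <> 0) /\ ul (fun k => / s k) 0).
Proof.
  destruct (classic (exists M, ev (fun k => Rabs (s k) <= M))) as [[M h] | h].
  - left. exact (ul_exists _ _ h).
  - right.
    assert (hb : forall M, ev (fun k => M < Rabs (s k))).
    { intros M. destruct (ev_em (fun k => Rabs (s k) <= M)) as [h' | h'].
      - destruct h. exists M. exact h'.
      - refine (ev_imp _ _ _ h'). intros k; lra. }
    split.
    + refine (ev_imp _ _ _ (hb 0)). intros k hk h0. rewrite h0, Rabs_R0 in hk. lra.
    + intros e he. refine (ev_imp _ _ _ (hb (/ e))). intros k hk.
      rewrite Rminus_0_r, Rabs_inv.
      pose proof (Rinv_0_lt_compat e he). rewrite <- (Rinv_inv e).
      apply Rinv_lt_contravar; [| exact hk]. apply Rmult_lt_0_compat; lra.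
Qed.

Lemma ul_invn : ul (fun k => / (INR k + 1)) 0.
Proof.
  intros e he. destruct (archimed_cor1 e he) as [N [hN hN0]].
  refine (ev_imp _ _ _ (ev_ge N)). intros k hk.
  assert (hk1 : INR N <= INR k) by (apply le_INR, hk).
  assert (0 < INR N) by (apply lt_0_INR, hN0).
  rewrite Rminus_0_r, Rabs_right.
  - apply Rlt_trans with (/ INR N); [apply Rinv_lt_contravar; nra | exact hN].
  - left. apply Rinv_0_lt_compat. lra.
Qed.

(** * Euclidean algebra *)

Lemma sumF_ext n (a b : Fin.t n -> R) : (forall i, a i = b i) -> sumF n a = sumF n b.
Proof.
  induction n as [| n IH]; intros h; simpl; [reflexivity |].
  rewrite h, (IH _ (fun i => b (Fin.FS i))); auto.
Qed.

Lemma sumF_add n (a b : Fin.t n -> R) : sumF n (fun i => a i + b i) = sumF n a + sumF n b.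
Proof. induction n as [| n IH]; simpl; [ring |]. rewrite IH. ring. Qed.

Lemma sumF_scal n c (a : Fin.t n -> R) : sumF n (fun i => c * a i) = c * sumF n a.
Proof. induction n as [| n IH]; simpl; [ring |]. rewrite IH. ring. Qed.

Lemma sumF_zero n : sumF n (fun _ => 0) = 0.
Proof. induction n as [| n IH]; simpl; [ring |]. rewrite IH. ring. Qed.

Lemma sumF_exchange n p (a : Fin.t n -> Fin.t p -> R) :
  sumF n (fun i => sumF p (fun j => a i j)) = sumF p (fun j => sumF n (fun i => a i j)).
Proof.
  induction n as [| n IH]; simpl.
  - rewrite sumF_zero. reflexivity.
  - rewrite IH, <- sumF_add. reflexivity.
Qed.

Lemma sumF_le n (a b : Fin.t n -> R) : (forall i, a i <= b i) -> sumF n a <= sumF n b.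
Proof.
  induction n as [| n IH]; intros h; simpl; [lra |].
  apply Rplus_le_compat; [apply h | apply IH; auto].
Qed.

Lemma sumF_nonneg n (a : Fin.t n -> R) : (forall i, 0 <= a i) -> 0 <= sumF n a.
Proof. intros h. rewrite <- (sumF_zero n). apply sumF_le, h. Qed.

Lemma sumF_ge_term n (a : Fin.t n -> R) i : (forall i, 0 <= a i) -> a i <= sumF n a.
Proof.
  induction i as [n | n i IH]; intros h; simpl.
  - pose proof (sumF_nonneg n (fun i => a (Fin.FS i)) (fun i => h _)). lra.
  - pose proof (IH (fun i => a (Fin.FS i)) (fun i => h _)). pose proof (h Fin.F1). lra.
Qed.

Lemma dot_comm n (x y : Vec n) : dot x y = dot y x.
Proof. apply sumF_ext. intros; ring. Qed.

Lemma dot_add_l n (x y z : Vec n) : dot (vadd x y) z = dot x z + dot y z.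
Proof. unfold dot. rewrite <- sumF_add. apply sumF_ext. intros; unfold vadd; ring. Qed.

Lemma dot_scal_l n c (x z : Vec n) : dot (vscal c x) z = c * dot x z.
Proof. unfold dot. rewrite <- sumF_scal. apply sumF_ext. intros; unfold vscal; ring. Qed.

Lemma dot_opp_l n (x z : Vec n) : dot (vopp x) z = - dot x z.
Proof.
  replace (- dot x z) with ((-1) * dot x z) by ring. rewrite <- dot_scal_l.
  apply sumF_ext. intros; unfold vscal, vopp; ring.
Qed.

Lemma dot_sub_l n (x y z : Vec n) : dot (vsub x y) z = dot x z - dot y z.
Proof.
  unfold Rminus. rewrite <- dot_opp_l, <- dot_add_l. apply sumF_ext.
  intros; unfold vadd, vopp, vsub; ring.
Qed.

Lemma dot_zero_l n (z : Vec n) : dot vzero z = 0.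
Proof. unfold dot. rewrite <- (sumF_zero n). apply sumF_ext. intros; unfold vzero; ring. Qed.

Lemma dot_add_r n (x y z : Vec n) : dot z (vadd x y) = dot z x + dot z y.
Proof. rewrite !(dot_comm n z). apply dot_add_l. Qed.

Lemma dot_scal_r n c (x z : Vec n) : dot z (vscal c x) = c * dot z x.
Proof. rewrite !(dot_comm n z). apply dot_scal_l. Qed.

Lemma dot_opp_r n (x z : Vec n) : dot z (vopp x) = - dot z x.
Proof. rewrite !(dot_comm n z). apply dot_opp_l. Qed.

Lemma dot_sub_r n (x y z : Vec n) : dot z (vsub x y) = dot z x - dot z y.
Proof. rewrite !(dot_comm n z). apply dot_sub_l. Qed.

Lemma dot_zero_r n (z : Vec n) : dot z vzero = 0.
Proof. rewrite dot_comm. apply dot_zero_l. Qed.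

Ltac dots := repeat rewrite ?dot_add_l, ?dot_sub_l, ?dot_scal_l, ?dot_opp_l, ?dot_zero_l,
  ?dot_add_r, ?dot_sub_r, ?dot_scal_r, ?dot_opp_r, ?dot_zero_r.

Ltac vext := apply functional_extensionality; intros ?;
  unfold vadd, vsub, vscal, vopp, vzero.

Lemma dot_nonneg n (x : Vec n) : 0 <= dot x x.
Proof. apply sumF_nonneg. intros; nra. Qed.

Lemma dot_self_0 n (x : Vec n) : dot x x = 0 -> x = vzero.
Proof.
  intros h. apply functional_extensionality. intros i.
  pose proof (sumF_ge_term n (fun i => x i * x i) i (fun i => ltac:(nra))) as hi.
  unfold dot in h. rewrite h in hi. simpl in hi. unfold vzero. nra.
Qed.

Lemma vnorm_nonneg n (x : Vec n) : 0 <= vnorm x.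
Proof. apply sqrt_pos. Qed.

Lemma vnorm_sq n (x : Vec n) : vnorm x * vnorm x = dot x x.
Proof. apply sqrt_sqrt, dot_nonneg. Qed.

Lemma vnorm_0 n (x : Vec n) : vnorm x = 0 -> x = vzero.
Proof. intros h. apply dot_self_0. rewrite <- vnorm_sq, h. ring. Qed.

Lemma vnorm_vzero n : vnorm (@vzero n) = 0.
Proof. unfold vnorm. rewrite dot_zero_l. apply sqrt_0. Qed.

Lemma dot_sq_le n (x y : Vec n) : dot x y * dot x y <= dot x x * dot y y.
Proof.
  pose proof (dot_nonneg n (vsub (vscal (dot y y) x) (vscal (dot x y) y))) as h.
  revert h. dots. rewrite (dot_comm n y x). intros h.
  destruct (Req_dec (dot y y) 0) as [h0 | h0].
  - apply dot_self_0 in h0. subst y. rewrite !dot_zero_r. lra.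
  - pose proof (dot_nonneg n y). assert (hp : 0 < dot y y) by lra.
    apply Rmult_le_reg_l with (dot y y); [exact hp |]. nra.
Qed.

Lemma Rsqr_le_le a b : 0 <= b -> a * a <= b * b -> a <= b.
Proof. intros hb h. apply Rnot_lt_le. intros hlt. nra. Qed.

Lemma dot_le n (x y : Vec n) : dot x y <= vnorm x * vnorm y.
Proof.
  pose proof (vnorm_nonneg n x). pose proof (vnorm_nonneg n y).
  apply Rsqr_le_le; [nra |].
  replace (vnorm x * vnorm y * (vnorm x * vnorm y))
    with ((vnorm x * vnorm x) * (vnorm y * vnorm y)) by ring.
  rewrite !vnorm_sq. apply dot_sq_le.
Qed.

Lemma vnorm_opp n (x : Vec n) : vnorm (vopp x) = vnorm x.
Proof. unfold vnorm. f_equal. dots. ring. Qed.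

Lemma dot_abs_le n (x y : Vec n) : Rabs (dot x y) <= vnorm x * vnorm y.
Proof.
  pose proof (dot_le n x y). pose proof (dot_le n (vopp x) y) as h.
  rewrite vnorm_opp, dot_opp_l in h. unfold Rabs; destruct Rcase_abs; lra.
Qed.

Lemma vnorm_triang n (x y : Vec n) : vnorm (vadd x y) <= vnorm x + vnorm y.
Proof.
  pose proof (vnorm_nonneg n x). pose proof (vnorm_nonneg n y).
  apply Rsqr_le_le; [lra |]. rewrite vnorm_sq. dots.
  pose proof (dot_le n x y). rewrite (dot_comm n y x), <- !vnorm_sq. lra.
Qed.

Lemma vnorm_scal n c (x : Vec n) : vnorm (vscal c x) = Rabs c * vnorm x.
Proof.
  unfold vnorm. dots. rewrite <- Rmult_assoc, sqrt_mult_alt by nra.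
  f_equal. apply sqrt_Rsqr_abs.
Qed.

Lemma vnorm_sub_sym n (x y : Vec n) : vnorm (vsub x y) = vnorm (vsub y x).
Proof. rewrite <- vnorm_opp. f_equal. vext. ring. Qed.

Lemma vnorm_sub_triang n (x y z : Vec n) :
  vnorm (vsub x z) <= vnorm (vsub x y) + vnorm (vsub y z).
Proof.
  replace (vsub x z) with (vadd (vsub x y) (vsub y z)) by (vext; ring). apply vnorm_triang.
Qed.

Lemma vnorm_le_add n (x y : Vec n) : vnorm x <= vnorm y + vnorm (vsub x y).
Proof.
  replace x with (vadd y (vsub x y)) at 1 by (vext; ring). apply vnorm_triang.
Qed.

Lemma vnorm_sub_0 n (x y : Vec n) : vnorm (vsub x y) = 0 -> x = y.
Proof.
  intros h. apply vnorm_0 in h. apply functional_extensionality. intros i.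
  pose proof (f_equal (fun w => w i) h) as hi. unfold vsub, vzero in hi. lra.
Qed.

Lemma vsub_self n (x : Vec n) : vsub x x = vzero.
Proof. vext. ring. Qed.

Lemma vnorm_sub_self n (x : Vec n) : vnorm (vsub x x) = 0.
Proof. rewrite vsub_self. apply vnorm_vzero. Qed.

Lemma vnorm_comp n (x : Vec n) i : Rabs (x i) <= vnorm x.
Proof.
  pose proof (sumF_ge_term n (fun i => x i * x i) i (fun i => ltac:(nra))) as hi.
  pose proof (vnorm_nonneg n x). pose proof (Rabs_pos (x i)).
  apply Rsqr_le_le; [assumption |]. rewrite vnorm_sq.
  replace (Rabs (x i) * Rabs (x i)) with (x i * x i); [exact hi |].
  unfold Rabs; destruct Rcase_abs; ring.
Qed.

Lemma dot_eq_0_all n (x : Vec n) : (forall d, dot x d = 0) -> x = vzero.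
Proof. intros h. apply dot_self_0, h. Qed.

Lemma mv_add n (A : Mat n) x y : mv A (vadd x y) = vadd (mv A x) (mv A y).
Proof. apply functional_extensionality. intros i. unfold mv. apply dot_add_r. Qed.

Lemma quad_madd n (A B : Mat n) u v : quad (madd A B) u v = quad A u v + quad B u v.
Proof.
  unfold quad. rewrite <- dot_add_r. apply sumF_ext. intros i. f_equal.
  unfold mv, vadd. rewrite <- dot_add_l. reflexivity.
Qed.

Lemma quad_mscal n c (A : Mat n) u v : quad (mscal c A) u v = c * quad A u v.
Proof.
  unfold quad. rewrite <- dot_scal_r. apply sumF_ext. intros i. f_equal.
  unfold mv, vscal. rewrite <- dot_scal_l. reflexivity.
Qed.

Lemma quad_mzero n u v : quad (@mzero n) u v = 0.
Proof.
  unfold quad. rewrite <- (dot_zero_r n u). apply sumF_ext. intros i. f_equal.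
  apply dot_zero_l.
Qed.

Lemma quad_msum n p (F : Fin.t p -> Mat n) u v :
  quad (msum p F) u v = sumF p (fun k => quad (F k) u v).
Proof.
  unfold quad, dot at 1. rewrite (sumF_ext n _ (fun i => sumF p (fun k => u i * mv (F k) v i))).
  - apply sumF_exchange.
  - intros i. rewrite sumF_scal. f_equal. unfold mv, msum, dot.
    rewrite (sumF_ext n _ (fun j => sumF p (fun k => F k i j * v j))).
    + apply sumF_exchange.
    + intros j. rewrite Rmult_comm, <- sumF_scal. apply sumF_ext. intros; ring.
Qed.

(** * Vector limits *)

Definition vul {n} (s : nat -> Vec n) (v : Vec n) : Prop := forall i, ul (fun k => s k i) (v i).

Lemma ul_sumF n (a : nat -> Fin.t n -> R) (b : Fin.t n -> R) :
  (forall i, ul (fun k => a k i) (b i)) -> ul (fun k => sumF n (a k)) (sumF n b).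
Proof.
  induction n as [| n IH]; intros h; simpl; [apply ul_const |].
  apply ul_plus; [apply (h Fin.F1) | apply (IH (fun k i => a k (Fin.FS i))); intros i; apply h].
Qed.

Lemma ul_dot n (a b : nat -> Vec n) (x y : Vec n) :
  vul a x -> vul b y -> ul (fun k => dot (a k) (b k)) (dot x y).
Proof. intros ha hb. apply ul_sumF. intros i. apply ul_mult; [apply ha | apply hb]. Qed.

Lemma vul_const n (x : Vec n) : vul (fun _ => x) x.
Proof. intros i. apply ul_const. Qed.

Lemma vul_add n (a b : nat -> Vec n) x y :
  vul a x -> vul b y -> vul (fun k => vadd (a k) (b k)) (vadd x y).
Proof. intros ha hb i. apply ul_plus; [apply ha | apply hb]. Qed.

Lemma vul_sub n (a b : nat -> Vec n) x y :
  vul a x -> vul b y -> vul (fun k => vsub (a k) (b k)) (vsub x y).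
Proof. intros ha hb i. apply ul_minus; [apply ha | apply hb]. Qed.

Lemma vul_scal n (c : nat -> R) (a : nat -> Vec n) l x :
  ul c l -> vul a x -> vul (fun k => vscal (c k) (a k)) (vscal l x).
Proof. intros hc ha i. apply ul_mult; [exact hc | apply ha]. Qed.

Lemma ul_vnorm n (a : nat -> Vec n) x : vul a x -> ul (fun k => vnorm (a k)) (vnorm x).
Proof. intros ha. apply ul_sqrt; [apply dot_nonneg | apply ul_dot; exact ha]. Qed.

Lemma vul_norm0 n (a : nat -> Vec n) x : ul (fun k => vnorm (vsub (a k) x)) 0 -> vul a x.
Proof.
  intros h i. apply ul_squeeze with (fun k => vnorm (vsub (a k) x)); [| exact h].
  apply ev_all. intros k. apply (vnorm_comp n (vsub (a k) x) i).
Qed.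

Lemma vul_norm_iff n (a : nat -> Vec n) x : vul a x <-> ul (fun k => vnorm (vsub (a k) x)) 0.
Proof.
  split; [| apply vul_norm0]. intros h.
  rewrite <- (vnorm_sub_self n x). apply ul_vnorm, vul_sub; [exact h | apply vul_const].
Qed.

Lemma vul_exists n (a : nat -> Vec n) M : ev (fun k => vnorm (a k) <= M) -> exists x, vul a x.
Proof.
  intros h.
  assert (H : forall i, exists l, ul (fun k => a k i) l).
  { intros i. apply ul_exists with M. refine (ev_imp _ _ _ h). intros k hk.
    pose proof (vnorm_comp n (a k) i). lra. }
  exists (fun i => proj1_sig (constructive_indefinite_description _ (H i))).
  intros i. apply (proj2_sig (constructive_indefinite_description _ (H i))).
Qed.

Lemma vul_ext n (a b : nat -> Vec n) x : ev (fun k => a k = b k) -> vul a x -> vul b x.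
Proof.
  intros h ha i. refine (ul_ext _ _ _ _ (ha i)). refine (ev_imp _ _ _ h). intros k ->; reflexivity.
Qed.

Lemma vul_unique n (a : nat -> Vec n) x y : vul a x -> vul a y -> x = y.
Proof.
  intros h1 h2. apply functional_extensionality. intros i. exact (ul_unique _ _ _ (h1 i) (h2 i)).
Qed.

Lemma vconv_vul n (a : nat -> Vec n) x : vconv a x -> vul a x.
Proof.
  intros h. apply vul_norm0. intros e he. destruct (h e he) as [N hN].
  refine (ev_imp _ _ _ (ev_ge N)). intros k hk. rewrite Rminus_0_r, Rabs_right.
  - apply hN, hk.
  - apply Rle_ge, vnorm_nonneg.
Qed.

(* If the first coefficients blow up, dividing by them puts the first column in the
   closed span of the others, which removes it. *)
Lemma range_closed n : forall (I : Type) (a : I -> Fin.t n -> R) (z : nat -> Vec n) (p : I -> R),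
  (forall i, ul (fun k => dot (a i) (z k)) (p i)) -> exists w : Vec n, forall i, dot (a i) w = p i.
Proof.
  induction n as [| n IH]; intros I a z p h.
  - exists (fun _ => 0). intros i. apply (ul_unique _ _ _ (ul_const _)). exact (h i).
  - pose (c := fun k => z k Fin.F1). pose (zr := fun k (j : Fin.t n) => z k (Fin.FS j)).
    pose (ar := fun i (j : Fin.t n) => a i (Fin.FS j)).
    assert (hs : forall i k, dot (a i) (z k) = a i Fin.F1 * c k + dot (ar i) (zr k))
      by reflexivity.
    assert (hcons : forall (b : R) (w : Vec n), exists W : Vec (S n),
      forall i, dot (a i) W = a i Fin.F1 * b + dot (ar i) w).
    { intros b w. exists (fun j => Fin.caseS' j (fun _ => R) b w). reflexivity. }
    destruct (ul_bounded_or_inv c) as [[l hl] | [hne hinv]].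
    + destruct (IH I ar zr (fun i => p i - a i Fin.F1 * l)) as [w hw].
      * intros i. apply ul_ext_all with (fun k => dot (a i) (z k) - a i Fin.F1 * c k).
        -- intros k. rewrite hs. ring.
        -- apply ul_minus; [apply h | apply ul_scal, hl].
      * destruct (hcons l w) as [W hW]. exists W. intros i. rewrite hW, hw. ring.
    + destruct (IH I ar (fun k => vscal (/ c k) (zr k)) (fun i => - a i Fin.F1)) as [b hb].
      * intros i. apply ul_ext with (fun k => / c k * dot (a i) (z k) - a i Fin.F1).
        -- refine (ev_imp _ _ _ hne). intros k hk. rewrite hs, dot_scal_r. field. exact hk.
        -- replace (- a i Fin.F1) with (0 * p i - a i Fin.F1) by ring.
           apply ul_minus; [apply ul_mult; [exact hinv | apply h] | apply ul_const].
      (* As [b] expresses minus the first column through the others, subtracting [c k * b] from the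
         tail absorbs the first coordinate exactly. *)
      * destruct (IH I ar (fun k => vsub (zr k) (vscal (c k) b)) p) as [w hw].
        -- intros i. refine (ul_ext_all _ _ _ _ (h i)). intros k. rewrite hs. dots.
           rewrite hb. ring.
        -- destruct (hcons 0 w) as [W hW]. exists W. intros i. rewrite hW, hw. ring.
Qed.

(** * Second-order expansions *)

(** Witnesses are chosen along the ultrafilter; at indices without a witness the value is
    arbitrary. *)
Lemma ev_choice (A : Type) (a0 : A) (P : nat -> A -> Prop) :
  ev (fun k => exists a, P k a) -> exists f : nat -> A, ev (fun k => P k (f k)).
Proof.
  intros h. exists (fun k => epsilon (inhabits a0) (P k)).
  refine (ev_imp _ _ _ h). intros k hk. apply (epsilon_spec (inhabits a0) (P k) hk).
Qed.

Lemma vul_ball n (x : nat -> Vec n) xb r :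
  vul x xb -> 0 < r -> ev (fun k => vnorm (vsub (x k) xb) < r).
Proof.
  intros h hr. apply vul_norm_iff in h. refine (ev_imp _ _ _ (h r hr)). intros k hk.
  rewrite Rminus_0_r in hk. pose proof (Rle_abs (vnorm (vsub (x k) xb))). lra.
Qed.

Lemma vul_line n (x w : nat -> Vec n) (s : nat -> R) xb wb :
  vul x xb -> vul w wb -> ul s 0 -> vul (fun k => vadd (x k) (vscal (s k) (w k))) xb.
Proof.
  intros hx hw hs. assert (E : vadd xb (vscal 0 wb) = xb) by (vext; ring).
  rewrite <- E. apply vul_add, vul_scal; assumption.
Qed.

Lemma derivable_line n (h : Vec n -> R) (x d D : Vec n) s :
  has_grad h (vadd x (vscal s d)) D ->
  derivable_pt_lim (fun s => h (vadd x (vscal s d))) s (dot D d).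
Proof.
  intros hg e he.
  pose proof (vnorm_nonneg n d) as hd.
  assert (he' : 0 < e / 2 / (vnorm d + 1)) by (repeat apply Rdiv_lt_0_compat; lra).
  destruct (hg _ he') as [del [hdel H]].
  assert (hdel' : 0 < del / (vnorm d + 1)) by (apply Rdiv_lt_0_compat; lra).
  exists (mkposreal _ hdel'). simpl. intros t ht htd.
  assert (Hn : vsub (vadd x (vscal (s + t) d)) (vadd x (vscal s d)) = vscal t d) by (vext; ring).
  specialize (H (vadd x (vscal (s + t) d))). rewrite Hn, vnorm_scal, dot_scal_r in H.
  pose proof (Rabs_pos_lt t ht) as hta.
  assert (hlt : Rabs t * (vnorm d + 1) < del).
  { apply Rmult_lt_compat_r with (r := vnorm d + 1) in htd; [| lra].
    replace (del / (vnorm d + 1) * (vnorm d + 1)) with del in htd by (field; lra). exact htd. }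
  specialize (H ltac:(nra)).
  match goal with |- Rabs (?a / t - ?b) < e => replace (a / t - b) with ((a - t * b) / t) by (field; exact ht) end.
  unfold Rdiv at 1. rewrite Rabs_mult, Rabs_inv.
  apply Rmult_lt_reg_r with (Rabs t); [exact hta |].
  rewrite Rmult_assoc, Rinv_l, Rmult_1_r by lra.
  eapply Rle_lt_trans; [exact H |].
  replace (e / 2 / (vnorm d + 1) * (Rabs t * vnorm d))
    with (e * Rabs t * (1 / 2 * (vnorm d / (vnorm d + 1)))) by (field; lra).
  assert (vnorm d / (vnorm d + 1) <= 1).
  { apply Rmult_le_reg_r with (vnorm d + 1); [lra |]. unfold Rdiv.
    rewrite Rmult_assoc, Rinv_l by lra. lra. }
  assert (0 < e * Rabs t) by nra. nra.
Qed.

Lemma has_jac_grad n (F : Vec n -> Vec n) x A i :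
  has_jac F x A -> has_grad (fun y => F y i) x (A i).
Proof.
  intros h e he. destruct (h e he) as [d [hd H]]. exists d. split; [exact hd |].
  intros y hy. eapply Rle_trans; [| apply (H y hy)].
  apply (vnorm_comp n (vsub (vsub (F y) (F x)) (mv A (vsub y x))) i).
Qed.

Lemma has_grad_ul n (h : Vec n -> R) x D (z : nat -> Vec n) :
  has_grad h x D -> vul z x -> ul (fun k => h (z k)) (h x).
Proof.
  intros hg hz. apply ul_sub0.
  destruct (hg 1 Rlt_0_1) as [d [hd H]].
  apply ul_squeeze with (fun k => (1 + vnorm D) * vnorm (vsub (z k) x)).
  - refine (ev_imp _ _ _ (vul_ball _ _ _ _ hz hd)). intros k hk. specialize (H _ hk).
    pose proof (dot_abs_le n D (vsub (z k) x)). rewrite Rminus_0_r.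
    revert H H0. unfold Rabs; repeat destruct Rcase_abs; lra.
  - replace 0 with ((1 + vnorm D) * 0) by ring. apply ul_scal, vul_norm_iff, hz.
Qed.

Lemma segment_dist n (x d : Vec n) xb c s :
  0 <= c <= s ->
  vnorm (vsub (vadd x (vscal c d)) xb) <= vnorm (vsub x xb) + vnorm (vscal s d).
Proof.
  intros hc. replace (vsub (vadd x (vscal c d)) xb) with (vadd (vsub x xb) (vscal c d)) by (vext; ring).
  eapply Rle_trans; [apply vnorm_triang |]. rewrite !vnorm_scal, !Rabs_right by lra.
  pose proof (vnorm_nonneg n d). nra.
Qed.

Lemma derivable_quadratic a b c :
  derivable_pt_lim (fun t => t * a + b * (t * t)) c (a + 2 * b * c).
Proof.
  intros e he. pose proof (Rabs_pos b).
  assert (hd : 0 < e / (Rabs b + 1)) by (apply Rdiv_lt_0_compat; lra).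
  exists (mkposreal _ hd). simpl. intros t ht htd.
  replace (((c + t) * a + b * ((c + t) * (c + t)) - (c * a + b * (c * c))) / t - (a + 2 * b * c))
    with (b * t) by (field; exact ht).
  rewrite Rabs_mult. apply Rmult_lt_compat_r with (r := Rabs b + 1) in htd; [| lra].
  replace (e / (Rabs b + 1) * (Rabs b + 1)) with e in htd by (field; lra).
  pose proof (Rabs_pos t). nra.
Qed.

Section Expansion.
Context {n : nat} (h : Vec n -> R) (Dh : Vec n -> Vec n) (D2h : Vec n -> Mat n) (xb : Vec n).
Hypothesis hC : C2_around h Dh D2h xb.

Lemma C2_grad_ul (x : nat -> Vec n) : vul x xb -> vul (fun k => Dh (x k)) (Dh xb).
Proof.
  intros hx i. destruct hC as [r [hr H]].
  apply (has_grad_ul n (fun y => Dh y i) xb (D2h xb i)); [| exact hx].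
  apply has_jac_grad, H. rewrite vnorm_sub_self. exact hr.
Qed.

Context (x w : nat -> Vec n) (s : nat -> R) (wb : Vec n).
Hypothesis hx : vul x xb.
Hypothesis hw : vul w wb.

(** The base points move, so differentiability of [Dh] at [xb] alone does not suffice: the mean
    value theorem is used in each coordinate, and continuity of [D2h] at [xb] takes care of the
    intermediate points. *)
Lemma C2_grad_expansion (hs : ul s 0) (hs0 : ev (fun k => 0 < s k)) :
  vul (fun k => vscal (/ s k) (vsub (Dh (vadd (x k) (vscal (s k) (w k)))) (Dh (x k))))
    (mv (D2h xb) wb).
Proof.
  intros i. destruct hC as [r [hr H]].
  assert (hball : ev (fun k => vnorm (vsub (x k) xb) + vnorm (vscal (s k) (w k)) < r)).
  { assert (hu : ul (fun k => vnorm (vsub (x k) xb) + vnorm (vscal (s k) (w k))) (0 + vnorm (vscal 0 wb))).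
    { apply ul_plus; [apply vul_norm_iff, hx | apply ul_vnorm, vul_scal; assumption]. }
    rewrite vnorm_scal, Rabs_R0, Rmult_0_l, Rplus_0_r in hu.
    refine (ev_imp _ _ _ (hu r hr)). intros k. rewrite Rminus_0_r.
    pose proof (Rle_abs (vnorm (vsub (x k) xb) + vnorm (vscal (s k) (w k)))). lra. }
  destruct (ev_choice R 0 (fun k c => 0 < c < s k /\
    Dh (vadd (x k) (vscal (s k) (w k))) i - Dh (x k) i
      = dot (D2h (vadd (x k) (vscal c (w k))) i) (w k) * s k)) as [c hc].
  { apply (ev_mp _ _ hball). refine (ev_imp _ _ _ hs0). intros k hk hb.
    destruct (MVT_cor2 (fun t => Dh (vadd (x k) (vscal t (w k))) i)
      (fun t => dot (D2h (vadd (x k) (vscal t (w k))) i) (w k)) 0 (s k) hk) as [c [h1 h2]].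
    - intros c hc. apply (derivable_line n (fun y => Dh y i)), has_jac_grad, H.
      eapply Rle_lt_trans; [apply segment_dist, hc | exact hb].
    - exists c. split; [exact h2 |]. rewrite Rminus_0_r in h1. rewrite <- h1.
      replace (vadd (x k) (vscal 0 (w k))) with (x k) by (vext; ring). reflexivity. }
  apply ul_ext with (fun k => dot (D2h (vadd (x k) (vscal (c k) (w k))) i) (w k)).
  { apply (ev_mp _ _ hs0). refine (ev_imp _ _ _ hc). intros k [_ hk] hp.
    unfold vscal at 2, vsub. rewrite hk. field. lra. }
  assert (hxi : vul (fun k => vadd (x k) (vscal (c k) (w k))) xb).
  { apply (vul_line n _ _ _ xb wb); auto.
    apply ul_squeeze with s; [| exact hs]. refine (ev_imp _ _ _ hc).
    intros k [hk _]. rewrite Rminus_0_r, Rabs_right; lra. }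
  apply ul_dot; [| exact hw]. intros j e he.
  destruct (proj2 (proj2 (H xb ltac:(rewrite vnorm_sub_self; exact hr))) i j e he) as [d [hd Hd]].
  refine (ev_imp _ _ _ (vul_ball _ _ _ _ hxi hd)). intros k hk. apply Hd, hk.
Qed.
End Expansion.

(** After subtraction of the quadratic model, the mean value theorem leaves a gradient difference
    over a shorter step [c k < s k]. [C2_grad_expansion] is applied with that step, and the factor
    [c k / s k] is at most 1. *)
Lemma C2_expansion {n} (h : Vec n -> R) Dh D2h xb (x w : nat -> Vec n) (s : nat -> R) (wb : Vec n) :
  C2_around h Dh D2h xb -> vul x xb -> vul w wb -> ul s 0 -> ev (fun k => 0 < s k) ->
  ul (fun k => (h (vadd (x k) (vscal (s k) (w k))) - h (x k) - s k * dot (Dh (x k)) (w k)) / (s k * s k))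
    (/ 2 * quad (D2h xb) wb wb).
Proof.
  intros hC hx hw hs hs0. destruct (hC) as [r [hr H]].
  set (K := quad (D2h xb) wb wb).
  assert (hball : ev (fun k => vnorm (vsub (x k) xb) + vnorm (vscal (s k) (w k)) < r)).
  { assert (hu : ul (fun k => vnorm (vsub (x k) xb) + vnorm (vscal (s k) (w k))) (0 + vnorm (vscal 0 wb))).
    { apply ul_plus; [apply vul_norm_iff, hx | apply ul_vnorm, vul_scal; assumption]. }
    rewrite vnorm_scal, Rabs_R0, Rmult_0_l, Rplus_0_r in hu.
    refine (ev_imp _ _ _ (hu r hr)). intros k. rewrite Rminus_0_r.
    pose proof (Rle_abs (vnorm (vsub (x k) xb) + vnorm (vscal (s k) (w k)))). lra. }
  destruct (ev_choice R 0 (fun k c => 0 < c < s k /\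
    h (vadd (x k) (vscal (s k) (w k))) - h (x k) - s k * dot (Dh (x k)) (w k) - / 2 * K * (s k * s k)
      = (dot (vsub (Dh (vadd (x k) (vscal c (w k)))) (Dh (x k))) (w k) - c * K) * s k)) as [c hc].
  { apply (ev_mp _ _ hball). refine (ev_imp _ _ _ hs0). intros k hk hb.
    destruct (MVT_cor2
      (fun t => h (vadd (x k) (vscal t (w k))) - (t * dot (Dh (x k)) (w k) + / 2 * K * (t * t)))
      (fun t => dot (Dh (vadd (x k) (vscal t (w k)))) (w k) -
                (dot (Dh (x k)) (w k) + K * t)) 0 (s k) hk) as [c [h1 h2]].
    - intros c hc. apply (derivable_pt_lim_minus (fun t => h (vadd (x k) (vscal t (w k))))).
      + apply (derivable_line n h), H.
        eapply Rle_lt_trans; [apply segment_dist, hc | exact hb].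
      + replace (K * c) with (2 * (/ 2 * K) * c) by field. apply derivable_quadratic.
    - exists c. split; [exact h2 |]. cbv beta in h1.
      replace (vadd (x k) (vscal 0 (w k))) with (x k) in h1 by (vext; ring).
      rewrite dot_sub_l. rewrite Rminus_0_r in h1.
      replace (dot (Dh (vadd (x k) (vscal c (w k)))) (w k) - dot (Dh (x k)) (w k) - c * K)
        with (dot (Dh (vadd (x k) (vscal c (w k)))) (w k) - (dot (Dh (x k)) (w k) + K * c)) by ring.
      rewrite <- h1. ring. }
  assert (hc0 : ul c 0).
  { apply ul_squeeze with s; [| exact hs]. refine (ev_imp _ _ _ hc).
    intros k [hk _]. rewrite Rminus_0_r, Rabs_right; lra. }
  assert (hcp : ev (fun k => 0 < c k)) by (refine (ev_imp _ _ _ hc); intros k [hk _]; lra).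
  pose proof (C2_grad_expansion h Dh D2h xb hC x w c wb hx hw hc0 hcp) as hg.
  pose proof (ul_dot n _ _ _ _ hg hw) as hgd.
  rewrite dot_comm in hgd. fold (quad (D2h xb) wb wb) in hgd. fold K in hgd.
  apply ul_sub0.
  apply ul_ext with (fun k => (dot (vscal (/ c k) (vsub (Dh (vadd (x k) (vscal (c k) (w k)))) (Dh (x k)))) (w k) - K)
                               * (c k / s k)).
  - apply (ev_mp _ _ hs0). refine (ev_imp _ _ _ hc). intros k [hk he] hp.
    replace ((h (vadd (x k) (vscal (s k) (w k))) - h (x k) - s k * dot (Dh (x k)) (w k)) / (s k * s k) - / 2 * K)
      with ((h (vadd (x k) (vscal (s k) (w k))) - h (x k) - s k * dot (Dh (x k)) (w k) - / 2 * K * (s k * s k)) / (s k * s k))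
      by (field; lra).
    rewrite he, dot_scal_l. field. split; lra.
  - apply ul_0_bounded with 1; [apply (proj1 (ul_sub0 _ _)), hgd |].
    apply (ev_mp _ _ hs0). refine (ev_imp _ _ _ hc). intros k [hk _] hp.
    assert (0 < c k / s k) by (apply Rdiv_lt_0_compat; lra).
    rewrite Rabs_right by lra. apply Rmult_le_reg_r with (s k); [exact hp |].
    unfold Rdiv. rewrite Rmult_assoc, Rinv_l by lra. lra.
Qed.

(** [D2h] is given only as the Jacobian of [Dh]. Symmetry follows by expanding the value at
    [xb + s (a + b)] once directly and once through [xb + s a]: the two second-order limits must
    agree. *)
Lemma hessian_sym {n} (h : Vec n -> R) Dh D2h xb (a b : Vec n) :
  C2_around h Dh D2h xb -> quad (D2h xb) a b = quad (D2h xb) b a.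
Proof.
  intros hC.
  pose (s := fun k => / (INR k + 1)).
  assert (hs0 : ev (fun k => 0 < s k)).
  { apply ev_all. intros k. apply Rinv_0_lt_compat. pose proof (pos_INR k). lra. }
  assert (hs : ul s 0) by apply ul_invn.
  assert (hxa : vul (fun k => vadd xb (vscal (s k) a)) xb).
  { apply (vul_line n (fun _ => xb) (fun _ => a) s xb a); auto using vul_const. }
  pose proof (C2_expansion h Dh D2h xb _ _ s b hC hxa (vul_const n b) hs hs0) as e1.
  pose proof (ul_dot n _ _ _ _ (C2_grad_expansion h Dh D2h xb hC _ _ s a (vul_const n xb) (vul_const n a) hs hs0)
    (vul_const n b)) as e2.
  pose proof (C2_expansion h Dh D2h xb _ _ s a hC (vul_const n xb) (vul_const n a) hs hs0) as e3.
  pose proof (C2_expansion h Dh D2h xb _ _ s (vadd a b) hC (vul_const n xb) (vul_const n (vadd a b)) hs hs0) as e4.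
  pose proof (ul_plus _ _ _ _ (ul_plus _ _ _ _ e1 e2) e3) as e5.
  assert (E := fun hh => ul_unique _ _ _ (ul_ext _ _ _ hh e5) e4).
  specialize (E ltac:(refine (ev_imp _ _ _ hs0); intros k hk;
    replace (vadd xb (vscal (s k) (vadd a b))) with (vadd (vadd xb (vscal (s k) a)) (vscal (s k) b)) by (vext; ring);
    dots; field; lra)).
  revert E. unfold quad. rewrite mv_add. dots. rewrite (dot_comm n (mv (D2h xb) a) b). lra.
Qed.

(** * The second-order cone *)

Ltac ydots := unfold ydot, yadd, ysub, yscal, yzero; simpl; dots.

Lemma Y_ext m (a b : Y m) : fst a = fst b -> snd a = snd b -> a = b.
Proof. destruct a, b; simpl; intros -> ->; reflexivity. Qed.

Lemma ydot_nonneg m (a : Y m) : 0 <= ydot a a.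
Proof. unfold ydot. pose proof (dot_nonneg m (snd a)). nra. Qed.

Lemma ydot_self_0 m (a : Y m) : ydot a a = 0 -> a = yzero.
Proof.
  unfold ydot. pose proof (dot_nonneg m (snd a)). intros h.
  apply Y_ext; simpl; [nra | apply dot_self_0; nra].
Qed.

Lemma ynorm_nonneg m (a : Y m) : 0 <= ynorm a.
Proof. apply sqrt_pos. Qed.

Lemma ynorm_sq m (a : Y m) : ynorm a * ynorm a = ydot a a.
Proof. apply sqrt_sqrt, ydot_nonneg. Qed.

Lemma ynorm_0 m (a : Y m) : ynorm a = 0 -> a = yzero.
Proof. intros h. apply ydot_self_0. rewrite <- ynorm_sq, h. ring. Qed.

Lemma ynorm_fst m (a : Y m) : Rabs (fst a) <= ynorm a.
Proof.
  apply Rsqr_le_le; [apply ynorm_nonneg |]. rewrite ynorm_sq. unfold ydot.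
  pose proof (dot_nonneg m (snd a)). unfold Rabs; destruct Rcase_abs; lra.
Qed.

Lemma ynorm_snd m (a : Y m) : vnorm (snd a) <= ynorm a.
Proof.
  apply Rsqr_le_le; [apply ynorm_nonneg |]. rewrite ynorm_sq, vnorm_sq. unfold ydot. nra.
Qed.

Definition yul {m} (s : nat -> Y m) (a : Y m) : Prop :=
  ul (fun k => fst (s k)) (fst a) /\ vul (fun k => snd (s k)) (snd a).

Lemma ul_ydot m (a b : nat -> Y m) x y :
  yul a x -> yul b y -> ul (fun k => ydot (a k) (b k)) (ydot x y).
Proof.
  intros [h1 h2] [h3 h4]. apply ul_plus; [apply ul_mult | apply ul_dot]; assumption.
Qed.

Lemma ul_ynorm m (a : nat -> Y m) x : yul a x -> ul (fun k => ynorm (a k)) (ynorm x).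
Proof. intros h. apply ul_sqrt; [apply ydot_nonneg | apply ul_ydot; exact h]. Qed.

Lemma yul_const m (a : Y m) : yul (fun _ => a) a.
Proof. split; [apply ul_const | apply vul_const]. Qed.

Lemma yul_add m (a b : nat -> Y m) x y :
  yul a x -> yul b y -> yul (fun k => yadd (a k) (b k)) (yadd x y).
Proof. intros [h1 h2] [h3 h4]. split; [apply ul_plus | apply vul_add]; assumption. Qed.

Lemma yul_sub m (a b : nat -> Y m) x y :
  yul a x -> yul b y -> yul (fun k => ysub (a k) (b k)) (ysub x y).
Proof. intros [h1 h2] [h3 h4]. split; [apply ul_minus | apply vul_sub]; assumption. Qed.

Lemma yul_scal m (c : nat -> R) (a : nat -> Y m) l x :
  ul c l -> yul a x -> yul (fun k => yscal (c k) (a k)) (yscal l x).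
Proof. intros hc [h1 h2]. split; [apply ul_mult | apply vul_scal]; assumption. Qed.

Lemma yul_ext m (a b : nat -> Y m) x : ev (fun k => a k = b k) -> yul a x -> yul b x.
Proof.
  intros h [h1 h2]. split; [refine (ul_ext _ _ _ _ h1) | refine (vul_ext _ _ _ _ _ h2)];
  refine (ev_imp _ _ _ h); intros k ->; reflexivity.
Qed.

Lemma yul_unique m (a : nat -> Y m) x y : yul a x -> yul a y -> x = y.
Proof.
  intros [h1 h2] [h3 h4]. apply Y_ext;
  [exact (ul_unique _ _ _ h1 h3) | exact (vul_unique _ _ _ _ h2 h4)].
Qed.

Lemma yul_exists m (a : nat -> Y m) M : ev (fun k => ynorm (a k) <= M) -> exists x, yul a x.
Proof.
  intros h.
  destruct (ul_exists (fun k => fst (a k)) M) as [c hc].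
  { refine (ev_imp _ _ _ h). intros k hk. pose proof (ynorm_fst m (a k)). lra. }
  destruct (vul_exists m (fun k => snd (a k)) M) as [v hv].
  { refine (ev_imp _ _ _ h). intros k hk. pose proof (ynorm_snd m (a k)). lra. }
  exists (c, v). split; assumption.
Qed.

(** In the unbounded case the sequence is divided by its norm; the limit then has norm one, hence is
    nonzero. *)
Lemma yul_bounded_or_normalized m (q : nat -> Y m) :
  (exists p, yul q p) \/
  (exists (c : nat -> R) p, ul c 0 /\ ev (fun k => 0 < c k) /\
     yul (fun k => yscal (c k) (q k)) p /\ p <> yzero).
Proof.
  destruct (ul_bounded_or_inv (fun k => ynorm (q k))) as [[l hl] | [hne hinv]].
  - left. apply yul_exists with (Rabs l + 1). refine (ev_imp _ _ _ (ul_bound _ _ hl)).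
    intros k hk. pose proof (Rle_abs (ynorm (q k))). lra.
  - right. exists (fun k => / ynorm (q k)).
    assert (hn : ev (fun k => ydot (yscal (/ ynorm (q k)) (q k)) (yscal (/ ynorm (q k)) (q k)) = 1)).
    { refine (ev_imp _ _ _ hne). intros k hk.
      replace (ydot (yscal (/ ynorm (q k)) (q k)) (yscal (/ ynorm (q k)) (q k)))
        with (/ ynorm (q k) * / ynorm (q k) * ydot (q k) (q k)) by (ydots; ring).
      rewrite <- ynorm_sq. field. exact hk. }
    destruct (yul_exists m (fun k => yscal (/ ynorm (q k)) (q k)) 1) as [p hp].
    { refine (ev_imp _ _ _ hn). intros k hk. unfold ynorm at 1. rewrite hk, sqrt_1. lra. }
    exists p. split; [exact hinv | split; [| split; [exact hp |]]].
    + refine (ev_imp _ _ _ hne). intros k hk. apply Rinv_0_lt_compat.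
      pose proof (ynorm_nonneg m (q k)). lra.
    + intros h0. pose proof (ul_unique _ _ _ (ul_ext _ _ _ hn (ul_ydot m _ _ _ _ hp hp)) (ul_const 1)) as h1.
      rewrite h0 in h1. unfold ydot in h1. simpl in h1. rewrite dot_zero_l in h1. lra.
Qed.

(** The Lorentz form. It vanishes on the boundary of the cone, and [rho] minimizes
    [- fst lam * lor]. *)
Definition lor {m} (a : Y m) : R := dot (snd a) (snd a) - fst a * fst a.

Lemma lor_vnorm m (a : Y m) : (vnorm (snd a))^2 - (fst a)^2 = lor a.
Proof. unfold lor. rewrite <- vnorm_sq. ring. Qed.

Lemma lor_yscal m c (a : Y m) : lor (yscal c a) = c * c * lor a.
Proof. unfold lor. ydots. ring. Qed.

Lemma ul_lor m (a : nat -> Y m) x : yul a x -> ul (fun k => lor (a k)) (lor x).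
Proof. intros [h1 h2]. apply ul_minus; [apply ul_dot | apply ul_mult]; assumption. Qed.

Lemma inQ_iff m (q : Y m) : inQ q <-> 0 <= fst q /\ lor q <= 0.
Proof.
  unfold inQ, lor. pose proof (vnorm_nonneg m (snd q)). rewrite <- vnorm_sq. split.
  - intros h. split; nra.
  - intros [h1 h2]. apply Rsqr_le_le; nra.
Qed.

Lemma inQ_0 m : inQ (@yzero m).
Proof. unfold inQ. simpl. rewrite vnorm_vzero. lra. Qed.

Lemma inQ_scal m c (q : Y m) : 0 <= c -> inQ q -> inQ (yscal c q).
Proof.
  intros hc h. apply inQ_iff in h. apply inQ_iff. rewrite lor_yscal. simpl. split; nra.
Qed.

Lemma inQ_closed m (q : nat -> Y m) p : yul q p -> ev (fun k => inQ (q k)) -> inQ p.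
Proof.
  intros [h1 h2] h. exact (ul_le _ _ _ _ (ul_vnorm m _ _ h2) h1 h).
Qed.

Lemma inQstar_closed m (q : nat -> Y m) p : yul q p -> ev (fun k => inQstar (q k)) -> inQstar p.
Proof.
  intros [h1 h2] h. exact (ul_le _ _ _ _ (ul_vnorm m _ _ h2) (ul_opp _ _ h1) h).
Qed.

Lemma polar_le m (l q : Y m) : inQstar l -> inQ q -> ydot l q <= 0.
Proof.
  unfold inQstar, inQ, ydot. intros hl hq. pose proof (dot_le m (snd l) (snd q)).
  pose proof (vnorm_nonneg m (snd l)). pose proof (vnorm_nonneg m (snd q)). nra.
Qed.

(** The three cases collapse to complementarity between the cone and its polar, a form that passes
    to limits and to rescaled points. On the boundary, the equality case of Cauchy-Schwarz recovers
    the ray through [hat q]. *)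
Lemma NQ_iff m (q l : Y m) : NQ q l <-> inQ q /\ inQstar l /\ ydot l q = 0.
Proof.
  split.
  - intros [[-> h] | [[h ->] | [[h h0] [a [ha ->]]]]].
    + split; [apply inQ_0 | split; [exact h | ydots; ring]].
    + split; [unfold inQ, inQint in *; lra | split; [| ydots; ring]].
      unfold inQstar; simpl. rewrite vnorm_vzero. lra.
    + split; [unfold inQ; lra | split].
      * unfold inQstar; simpl. rewrite vnorm_scal, h, Rabs_right by lra. lra.
      * ydots. rewrite <- vnorm_sq, h. ring.
  - intros [hq [hl h]].
    destruct (classic (q = yzero)) as [h0 | h0]; [left; split; assumption | right].
    assert (hq0 : 0 < fst q).
    { pose proof (vnorm_nonneg m (snd q)). destruct (Req_dec (fst q) 0) as [h1 | h1].
      - destruct h0. apply Y_ext; simpl; [exact h1 |]. apply vnorm_0. unfold inQ in hq. lra.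
      - unfold inQ in hq. lra. }
    unfold inQ, inQstar in *. unfold ydot in h.
    pose proof (dot_le m (snd l) (snd q)) as hcs.
    pose proof (vnorm_nonneg m (snd l)). pose proof (vnorm_nonneg m (snd q)).
    destruct (Rle_lt_or_eq_dec _ _ hq) as [hlt | heq].
    + left. split; [exact hlt |].
      assert (hl0 : fst l = 0) by nra.
      apply Y_ext; simpl; [exact hl0 |]. apply vnorm_0. lra.
    + right. split; [split; [exact heq | exact h0] |].
      exists (- fst l / fst q). split.
      { apply Rmult_le_reg_r with (fst q); [exact hq0 |]. unfold Rdiv.
        rewrite Rmult_assoc, Rinv_l by lra. lra. }
      apply Y_ext; simpl; [field; lra |].
      assert (hln : vnorm (snd l) = - fst l) by (rewrite heq in hcs; nra).
      assert (E : vsub (snd l) (vscal (- fst l / fst q) (snd q)) = vzero).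
      { apply dot_self_0. dots. rewrite (dot_comm m (snd q)), <- !vnorm_sq, hln, heq.
        replace (dot (snd l) (snd q)) with (- (fst l * fst q)) by lra. field. lra. }
      apply functional_extensionality. intros i.
      pose proof (f_equal (fun w => w i) E) as Ei. unfold vsub, vzero in Ei. lra.
Qed.

Lemma moreau m (q : Y m) : exists p l, inQ p /\ inQstar l /\ ydot l p = 0 /\ q = yadd p l.
Proof.
  pose proof (vnorm_nonneg m (snd q)) as hr.
  destruct (Rle_dec (vnorm (snd q)) (fst q)) as [h | h].
  { exists q, yzero. split; [exact h |]. split; [| split].
    - unfold inQstar; simpl. rewrite vnorm_vzero. lra.
    - ydots; ring.
    - apply Y_ext; simpl; [ring | vext; ring]. }
  destruct (Rle_dec (vnorm (snd q)) (- fst q)) as [h' | h'].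
  { exists yzero, q. split; [apply inQ_0 |]. split; [exact h' | split].
    - ydots; ring.
    - apply Y_ext; simpl; [ring | vext; ring]. }
  set (r := vnorm (snd q)) in *.
  assert (hr0 : 0 < r) by lra.
  (* Here [- r < fst q < r]. The spectral values [fst q + r] and [fst q - r] of [q] have opposite
     signs, and the positive and negative spectral parts are the two components. *)
  exists ((fst q + r) / 2, vscal ((fst q + r) / 2 / r) (snd q)),
         ((fst q - r) / 2, vscal ((r - fst q) / 2 / r) (snd q)).
  unfold inQ, inQstar, ydot. simpl. rewrite !vnorm_scal. dots. rewrite <- vnorm_sq. fold r.
  rewrite !Rabs_right; try (apply Rle_ge; repeat apply Rmult_le_pos; try (left; apply Rinv_0_lt_compat); lra).
  split; [apply Req_le; field; lra |]. split; [apply Req_le; field; lra |].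
  split; [field; lra |]. apply Y_ext; simpl; [field |].
  apply functional_extensionality. intros i. unfold vadd, vscal. field. lra.
Qed.

(** On the boundary [l] is a multiple of [hat q] and [lor q = 0], so expanding [lor (q' - q)] leaves
    the pairing of [l] with [q'] plus a multiple of [lor q' <= 0]. This is the curvature of the
    cone, of order [1 / fst q]; the product form stays valid at the apex. *)
Lemma NQ_curvature m (q l q' : Y m) : NQ q l -> inQ q' ->
  - fst l * lor (ysub q' q) / 2 <= - ydot l q' * fst q.
Proof.
  intros h hq'. apply inQ_iff in hq'. destruct hq' as [h0 h1].
  destruct h as [[-> h] | [[h ->] | [[h hne] [a [ha ->]]]]].
  - unfold inQstar in h. pose proof (vnorm_nonneg m (snd l)).
    replace (lor (ysub q' yzero)) with (lor q') by (unfold lor; ydots; ring).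
    simpl. nra.
  - ydots. lra.
  - assert (hq : dot (snd q) (snd q) = fst q * fst q) by (rewrite <- vnorm_sq, h; ring).
    assert (h2 : 0 <= fst q) by (rewrite <- h; apply vnorm_nonneg).
    unfold lor in *. ydots. rewrite (dot_comm m (snd q') (snd q)), hq.
    assert (0 <= a * fst q) by nra.
    nra.
Qed.

(** Cauchy-Schwarz on the orthogonal complement of [l]: [(l0 p0)^2 = <lr, pr>^2 <= l0^2 |pr|^2].
    Consequently the objective of [rho] is nonnegative on its constraint set. *)
Lemma lor_psd m (l p : Y m) : inQstar l -> ydot l p = 0 -> 0 <= - fst l * lor p.
Proof.
  unfold inQstar, ydot, lor. intros hl h.
  pose proof (vnorm_nonneg m (snd l)) as hn.
  pose proof (dot_sq_le m (snd l) (snd p)) as hcs. rewrite <- (vnorm_sq m (snd l)) in hcs.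
  replace (dot (snd l) (snd p)) with (- (fst l * fst p)) in hcs by lra.
  pose proof (dot_nonneg m (snd p)) as hp.
  destruct (Req_dec (fst l) 0) as [-> | h0]; [lra |].
  assert (hll : vnorm (snd l) * vnorm (snd l) <= fst l * fst l) by nra.
  assert (0 < fst l * fst l) by nra.
  assert (fst p * fst p <= dot (snd p) (snd p)).
  { apply Rmult_le_reg_l with (fst l * fst l); [assumption |]. nra. }
  nra.
Qed.

Lemma lor_npos_cases m (p : Y m) : lor p <= 0 -> inQ p \/ inQ (yscal (-1) p).
Proof.
  intros h. destruct (Rle_dec 0 (fst p)) as [h0 | h0]; [left | right]; apply inQ_iff.
  - split; assumption.
  - rewrite lor_yscal. simpl. split; lra.
Qed.

(** * The constraint map *)

Section Constraint.
Context {n m : nat} (P : Prob n m).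

Lemma dot_JgT x lam d : dot (JgT P x lam) d = ydot lam (Jg P x d).
Proof.
  unfold JgT, Jg, ydot. simpl. rewrite dot_add_l, dot_scal_l. f_equal.
  unfold dot. rewrite (sumF_ext n _ (fun i => sumF m (fun k => snd lam k * pDgr P k x i * d i))).
  - rewrite sumF_exchange. apply sumF_ext. intros k. rewrite <- sumF_scal.
    apply sumF_ext. intros; ring.
  - intros i. rewrite Rmult_comm, <- sumF_scal. apply sumF_ext. intros; ring.
Qed.

Lemma quad_HLag x lam u v : quad (HLag P x lam) u v = ydot lam (Hg P x u v).
Proof.
  unfold HLag, Hg, ydot. simpl. rewrite quad_madd, quad_mscal, quad_msum. f_equal.
  apply sumF_ext. intros k. apply quad_mscal.
Qed.

Lemma Aval_eq xb lam u : Aval P xb lam u = quad (pD2f P xb) u u + ydot lam (Hg P xb u u).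
Proof. unfold Aval. rewrite quad_madd, quad_HLag. reflexivity. Qed.

Lemma JgT_add x l1 l2 : JgT P x (yadd l1 l2) = vadd (JgT P x l1) (JgT P x l2).
Proof.
  apply functional_extensionality. intros i. unfold JgT, vadd, vscal. simpl. unfold vadd.
  rewrite (sumF_ext m _ (fun k => snd l1 k * pDgr P k x i + snd l2 k * pDgr P k x i)) by (intros; ring).
  rewrite sumF_add. ring.
Qed.

Lemma JgT_scal x c l : JgT P x (yscal c l) = vscal c (JgT P x l).
Proof.
  apply functional_extensionality. intros i. unfold JgT, vadd, vscal. simpl.
  rewrite (sumF_ext m _ (fun k => c * (snd l k * pDgr P k x i))) by (intros; unfold vscal; ring).
  rewrite sumF_scal. ring.
Qed.

Lemma Jg_scal x c d : Jg P x (vscal c d) = yscal c (Jg P x d).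
Proof.
  apply Y_ext; simpl; [apply dot_scal_r |]. apply functional_extensionality. intros k.
  unfold vscal at 2. apply dot_scal_r.
Qed.

Lemma Jg_range_closed xb (z : nat -> Vec n) p :
  yul (fun k => Jg P xb (z k)) p -> exists w, Jg P xb w = p.
Proof.
  intros [h1 h2].
  destruct (range_closed n (option (Fin.t m))
    (fun o => match o with None => pDg0 P xb | Some k => pDgr P k xb end) z
    (fun o => match o with None => fst p | Some k => snd p k end)) as [w hw].
  - intros [k |]; [apply (h2 k) | exact h1].
  - exists w. apply Y_ext; simpl; [apply (hw None) |].
    apply functional_extensionality. intros k. apply (hw (Some k)).
Qed.
End Constraint.

(** * Minimization and multipliers *)

Lemma fun_choice (A B : Type) (P : A -> B -> Prop) :
  (forall a, exists b, P a b) -> exists f : A -> B, forall a, P a (f a).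
Proof.
  intros h. exists (fun a => proj1_sig (constructive_indefinite_description _ (h a))).
  intros a. apply (proj2_sig (constructive_indefinite_description _ (h a))).
Qed.

Lemma is_glb_exists (S : R -> Prop) (a b : R) :
  S a -> (forall x, S x -> b <= x) -> exists g, is_glb S g.
Proof.
  intros ha hb.
  destruct (completeness (fun x => S (- x))) as [l [h1 h2]].
  - exists (- b). intros x hx. specialize (hb _ hx). lra.
  - exists (- a). rewrite Ropp_involutive. exact ha.
  - exists (- l). split.
    + intros x hx. assert (- x <= l); [| lra]. apply h1. rewrite Ropp_involutive. exact hx.
    + intros c hc. assert (l <= - c); [| lra]. apply h2. intros x hx. specialize (hc _ hx). lra.
Qed.

Lemma Rglb_spec (S : R -> Prop) (a b : R) :
  S a -> (forall x, S x -> b <= x) -> is_glb S (Rglb S).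
Proof. intros ha hb. apply (epsilon_spec (inhabits 0) (is_glb S)). exact (is_glb_exists S a b ha hb). Qed.

Lemma distY_le m (q p : Y m) C : C p -> distY q C <= ynorm (ysub q p).
Proof.
  intros hp. unfold distY.
  apply (Rglb_spec (fun d => exists p, C p /\ d = ynorm (ysub q p)) (ynorm (ysub q p)) 0).
  - exists p. auto.
  - intros d [y [_ ->]]. apply ynorm_nonneg.
  - exists p. auto.
Qed.

Lemma distV_approx n (x y : Vec n) C eta : C y -> 0 < eta ->
  exists z, C z /\ vnorm (vsub x z) <= distV x C + eta.
Proof.
  intros hy he.
  destruct (Rglb_spec (fun d => exists y, C y /\ d = vnorm (vsub x y)) (vnorm (vsub x y)) 0) as [_ h].
  - exists y. auto.
  - intros d [z [_ ->]]. apply vnorm_nonneg.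
  - destruct (classic (exists z, C z /\ vnorm (vsub x z) <= distV x C + eta)) as [H | H]; [exact H |].
    exfalso. unfold distV in *. specialize (h (Rglb (fun d => exists y, C y /\ d = vnorm (vsub x y)) + eta)).
    assert (Rglb (fun d => exists y, C y /\ d = vnorm (vsub x y)) + eta <=
            Rglb (fun d => exists y, C y /\ d = vnorm (vsub x y))); [| lra].
    apply h. intros d [z [hz ->]]. apply Rnot_lt_le. intros hlt. apply H. exists z. split; [exact hz | lra].
Qed.

(** Closedness and lower semicontinuity are required along [ev]-limits. In this form they can be
    checked for the penalty function without proving that the projection is continuous. *)
Lemma min_exists n (S : Vec n -> Prop) (F : Vec n -> R) (x0 : Vec n) M :
  S x0 -> (forall z, S z -> vnorm z <= M) ->
  (forall z zb, (forall k, S (z k)) -> vul z zb ->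
     S zb /\ forall c, ev (fun k => F (z k) <= c) -> F zb <= c) ->
  exists x, S x /\ forall y, S y -> F x <= F y.
Proof.
  intros h0 hM hcl.
  assert (hb : exists b, forall z, S z -> b <= F z).
  { destruct (classic (exists b, forall z, S z -> b <= F z)) as [h | h]; [exact h | exfalso].
    assert (H : forall k, exists z, S z /\ F z <= - INR k).
    { intros k. destruct (classic (exists z, S z /\ F z <= - INR k)) as [h' | h']; [exact h' |].
      destruct h. exists (- INR k). intros z hz. apply Rnot_lt_le. intros hlt.
      apply h'. exists z. split; [exact hz | lra]. }
    apply fun_choice in H. destruct H as [z hz].
    destruct (vul_exists n z M) as [zb hzb]; [apply ev_all; intros k; apply hM, hz |].
    destruct (hcl z zb (fun k => proj1 (hz k)) hzb) as [_ hc].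
    destruct (INR_archimed 1 (1 - F zb) Rlt_0_1) as [N hN].
    assert (F zb <= F zb - 1); [| lra].
    apply hc. refine (ev_imp _ _ _ (ev_ge N)). intros k hk. apply le_INR in hk.
    pose proof (proj2 (hz k)). lra. }
  destruct hb as [b hb].
  destruct (is_glb_exists (fun v => exists z, S z /\ v = F z) (F x0) b) as [g [hg1 hg2]].
  { exists x0. auto. }
  { intros v [z [hz ->]]. auto. }
  assert (H : forall k, exists z, S z /\ F z <= g + / (INR k + 1)).
  { intros k. destruct (classic (exists z, S z /\ F z <= g + / (INR k + 1))) as [h | h]; [exact h | exfalso].
    assert (0 < / (INR k + 1)) by (apply Rinv_0_lt_compat; pose proof (pos_INR k); lra).
    assert (g + / (INR k + 1) <= g); [| lra].
    apply hg2. intros v [z [hz ->]]. apply Rnot_lt_le. intros hlt. apply h.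
    exists z. split; [exact hz | lra]. }
  apply fun_choice in H. destruct H as [z hz].
  destruct (vul_exists n z M) as [zb hzb]; [apply ev_all; intros k; apply hM, hz |].
  destruct (hcl z zb (fun k => proj1 (hz k)) hzb) as [hS hc].
  exists zb. split; [exact hS |]. intros y hy.
  assert (g <= F y) by (apply hg1; exists y; auto).
  assert (F zb <= g); [| lra].
  apply le_epsilon. intros e he. apply hc.
  refine (ev_imp _ _ _ (ul_invn e he)). intros k hk. rewrite Rminus_0_r in hk.
  pose proof (Rle_abs (/ (INR k + 1))). pose proof (proj2 (hz k)). lra.
Qed.

Lemma derivative_at_min (phi : R -> R) l :
  derivable_pt_lim phi 0 l -> (exists d, 0 < d /\ forall s, Rabs s < d -> phi 0 <= phi s) -> l = 0.
Proof.
  intros hl [d [hd H]].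
  destruct (Req_dec l 0) as [h | h]; [exact h | exfalso].
  destruct (hl (Rabs l) (Rabs_pos_lt _ h)) as [[e he] He]. simpl in He.
  pose (t := Rmin d e / 2). pose proof (Rmin_glb_lt _ _ _ hd he) as hm.
  pose proof (Rmin_l d e). pose proof (Rmin_r d e).
  assert (ht : 0 < t < d /\ t < e) by (unfold t; lra).
  destruct (Rdichotomy l 0 h) as [hneg | hpos].
  - assert (hs : Rabs t = t) by (apply Rabs_right; lra).
    specialize (He t ltac:(lra) ltac:(lra)). specialize (H t ltac:(lra)). rewrite Rplus_0_l in He.
    assert (hq : 0 <= (phi t - phi 0) / t).
    { apply Rmult_le_pos; [lra | left; apply Rinv_0_lt_compat; lra]. }
    revert He. unfold Rabs; repeat destruct Rcase_abs; lra.
  - assert (hs : Rabs (- t) = t) by (rewrite Rabs_Ropp; apply Rabs_right; lra).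
    specialize (He (- t) ltac:(lra) ltac:(lra)). specialize (H (- t) ltac:(lra)). rewrite Rplus_0_l in He.
    assert (hq : (phi (- t) - phi 0) / (- t) <= 0).
    { replace ((phi (- t) - phi 0) / - t) with (- ((phi (- t) - phi 0) / t)) by (field; lra).
      assert (0 <= (phi (- t) - phi 0) / t); [| lra].
      apply Rmult_le_pos; [lra | left; apply Rinv_0_lt_compat; lra]. }
    revert He. unfold Rabs; repeat destruct Rcase_abs; lra.
Qed.

Lemma derivable_sumF p (f : Fin.t p -> R -> R) (l : Fin.t p -> R) s :
  (forall k, derivable_pt_lim (f k) s (l k)) ->
  derivable_pt_lim (fun t => sumF p (fun k => f k t)) s (sumF p l).
Proof.
  induction p as [| p IH]; intros h; simpl.
  - apply (derivable_pt_lim_const 0).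
  - apply (derivable_pt_lim_plus (f Fin.F1)); [apply h | apply (IH (fun k => f (Fin.FS k))); auto].
Qed.

Lemma derivable_sqr_shift (f : R -> R) l s c :
  derivable_pt_lim f s l ->
  derivable_pt_lim (fun t => (f t - c) * (f t - c)) s (2 * (f s - c) * l).
Proof.
  intros h.
  assert (h' : derivable_pt_lim (fun t => f t - c) s (l - 0))
    by (apply (derivable_pt_lim_minus f (fct_cte c)); [exact h | apply derivable_pt_lim_const]).
  replace (2 * (f s - c) * l) with ((l - 0) * (f s - c) + (f s - c) * (l - 0)) by ring.
  apply (derivable_pt_lim_mult (fun t => f t - c) (fun t => f t - c)); exact h'.
Qed.

(** * Projection onto the cone and exact penalization *)

Definition prj {m} (q : Y m) : Y m := proj1_sig (constructive_indefinite_description _ (moreau m q)).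
Definition resid {m} (q : Y m) : Y m := ysub q (prj q).

Lemma prj_spec m (q : Y m) : inQ (prj q) /\ inQstar (resid q) /\ ydot (resid q) (prj q) = 0.
Proof.
  unfold resid, prj. destruct (constructive_indefinite_description _ (moreau m q)) as [p [l [h1 [h2 [h3 h4]]]]].
  simpl. assert (E : ysub q p = l).
  { subst q. apply Y_ext; simpl; [ring | vext; ring]. }
  rewrite E. auto.
Qed.

(** Expanding [|q - p|^2] around [prj q] adds [|prj q - p|^2] and [- 2 <resid q, p>], both
    nonnegative; so [prj q] is a nearest point of the cone. *)
Lemma resid_min m (q p : Y m) : inQ p -> ydot (resid q) (resid q) <= ydot (ysub q p) (ysub q p).
Proof.
  intros hp. destruct (prj_spec m q) as [h1 [h2 h3]].
  pose proof (polar_le m _ _ h2 hp) as h4.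
  pose proof (ydot_nonneg m (ysub (prj q) p)) as h5.
  unfold resid in *. revert h3 h4 h5. ydots.
  rewrite (dot_comm m (snd (prj q)) (snd q)), (dot_comm m (snd p) (snd q)), (dot_comm m (snd p) (snd (prj q))).
  intros. nra.
Qed.

Lemma prj_norm m (q : Y m) : ynorm (prj q) <= ynorm q.
Proof.
  apply Rsqr_le_le; [apply ynorm_nonneg |]. rewrite !ynorm_sq.
  destruct (prj_spec m q) as [h1 [h2 h3]]. pose proof (ydot_nonneg m (resid q)) as h5.
  unfold resid in *. revert h3 h5. ydots. rewrite (dot_comm m (snd (prj q)) (snd q)). intros. nra.
Qed.

(** Substitute for continuity of the projection: the projections are bounded and converge along the
    ultrafilter to a point of the cone, which [resid_min] compares with the projection of the
    limit. *)
Lemma yul_prj m (q : nat -> Y m) qb : yul q qb -> exists p, yul (fun k => prj (q k)) p /\ inQ p.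
Proof.
  intros h. destruct (yul_exists m (fun k => prj (q k)) (Rabs (ynorm qb) + 1)) as [p hp].
  - refine (ev_imp _ _ _ (ul_bound _ _ (ul_ynorm m _ _ h))). intros k hk.
    pose proof (prj_norm m (q k)). pose proof (Rle_abs (ynorm (q k))). lra.
  - exists p. split; [exact hp |]. apply (inQ_closed m _ _ hp). apply ev_all. intros k. apply prj_spec.
Qed.

Section Multipliers.
Context {n m : nat} (P : Prob n m) (sigma : R).
Hypothesis hsigma : 0 < sigma.

(** The third clause is the subregularity estimate with both distances unfolded: [p] stands for a
    competitor in the cone, and [eta] allows for an infimum that is only approached. *)
Definition regular_at (x : Vec n) : Prop :=
  (has_grad (pg0 P) x (pDg0 P x) /\ has_jac (pDg0 P) x (pD2g0 P x)) /\
  (forall k, has_grad (fun y => pgr P y k) x (pDgr P k x) /\ has_jac (pDgr P k) x (pD2gr P k x)) /\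
  (forall p eta, inQ p -> 0 < eta ->
     exists z, Gamma P z /\ vnorm (vsub x z) <= sigma * ynorm (ysub (g P x) p) + eta).

Lemma g_yul x (z : nat -> Vec n) : regular_at x -> vul z x -> yul (fun k => g P (z k)) (g P x).
Proof.
  intros [[h1 _] [h2 _]] hz. split.
  - exact (has_grad_ul n _ _ _ _ h1 hz).
  - intros k. exact (has_grad_ul n (fun y => pgr P y k) _ _ _ (proj1 (h2 k)) hz).
Qed.

Lemma has_jac_vul (F : Vec n -> Vec n) x A (z : nat -> Vec n) :
  has_jac F x A -> vul z x -> vul (fun k => F (z k)) (F x).
Proof.
  intros h hz i. exact (has_grad_ul n (fun y => F y i) _ _ _ (has_jac_grad n F x A i h) hz).
Qed.

Lemma Jg_yul x (z d : nat -> Vec n) db :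
  regular_at x -> vul z x -> vul d db -> yul (fun k => Jg P (z k) (d k)) (Jg P x db).
Proof.
  intros [[_ h1] [h2 _]] hz hd. split.
  - apply ul_dot; [exact (has_jac_vul _ _ _ _ h1 hz) | exact hd].
  - intros k. apply ul_dot; [exact (has_jac_vul _ _ _ _ (proj2 (h2 k)) hz) | exact hd].
Qed.

Lemma JgT_vul x (z : nat -> Vec n) (l : nat -> Y m) lb :
  regular_at x -> vul z x -> yul l lb -> vul (fun k => JgT P (z k) (l k)) (JgT P x lb).
Proof.
  intros [[_ h1] [h2 _]] hz [hl1 hl2]. apply vul_add.
  - apply vul_scal; [exact hl1 | exact (has_jac_vul _ _ _ _ h1 hz)].
  - intros i. apply ul_sumF. intros k. apply ul_mult; [apply hl2 |].
    exact (has_jac_vul _ _ _ _ (proj2 (h2 k)) hz i).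
Qed.

Lemma derivable_gap x d p : regular_at x ->
  derivable_pt_lim (fun s => ydot (ysub (g P (vadd x (vscal s d))) p) (ysub (g P (vadd x (vscal s d))) p)) 0
    (2 * ydot (ysub (g P x) p) (Jg P x d)).
Proof.
  intros [[h1 _] [h2 _]].
  assert (E : vadd x (vscal 0 d) = x) by (vext; ring).
  rewrite <- E in h1.
  pose proof (derivable_sqr_shift _ _ _ (fst p) (derivable_line n _ _ _ _ _ h1)) as e1.
  pose proof (derivable_sumF m (fun k s => (pgr P (vadd x (vscal s d)) k - snd p k) * (pgr P (vadd x (vscal s d)) k - snd p k))
    (fun k => 2 * (pgr P x k - snd p k) * dot (pDgr P k x) d) 0) as e2.
  cbv beta in e1. rewrite E in e1.
  replace (2 * ydot (ysub (g P x) p) (Jg P x d))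
    with (2 * (pg0 P x - fst p) * dot (pDg0 P x) d + sumF m (fun k => 2 * (pgr P x k - snd p k) * dot (pDgr P k x) d)).
  - refine (derivable_pt_lim_plus _ _ _ _ _ e1 (e2 _)). intros k.
    pose proof (proj1 (h2 k)) as hk. rewrite <- E in hk.
    pose proof (derivable_sqr_shift _ _ _ (snd p k) (derivable_line n (fun y => pgr P y k) _ _ _ _ hk)) as e3.
    cbv beta in e3. rewrite E in e3. exact e3.
  - unfold ydot. simpl. rewrite Rmult_plus_distr_l. f_equal; [ring |].
    unfold dot at 2. rewrite <- sumF_scal. apply sumF_ext. intros k. unfold vsub. ring.
Qed.

Context (h : Vec n -> R) (Dh : Vec n -> Vec n) (x : Vec n) (r : R).
Hypothesis hr : 0 < r.
Hypothesis hreg : forall z, vnorm (vsub z x) <= r -> regular_at z /\ has_grad h z (Dh z).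
Hypothesis hcont : forall z, vul z x -> vul (fun k => Dh (z k)) (Dh x).
Hypothesis hGx : Gamma P x.
Hypothesis hmin : forall z, vnorm (vsub z x) <= r -> Gamma P z -> h x <= h z.

(** Since [x] is not assumed to be a strict minimizer, the squared distance to [x] is added to force
    the penalty minimizers to converge to [x]. *)
Definition penalty (K : R) (z : Vec n) : R :=
  h z + dot (vsub z x) (vsub z x) + K * ydot (resid (g P z)) (resid (g P z)).

Lemma penalty_min_exists K : 0 <= K ->
  exists z, vnorm (vsub z x) <= r /\ forall y, vnorm (vsub y x) <= r -> penalty K z <= penalty K y.
Proof.
  intros hK. apply (min_exists n (fun z => vnorm (vsub z x) <= r) (penalty K) x (vnorm x + r)).
  - rewrite vnorm_sub_self. lra.
  - intros z hz. pose proof (vnorm_le_add n z x). lra.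
  - intros z zb hz hzb.
    assert (hb : vnorm (vsub zb x) <= r).
    { apply (ul_le_c _ _ _ (ul_vnorm n _ _ (vul_sub n _ _ _ _ hzb (vul_const n x)))). apply ev_all, hz. }
    split; [exact hb |]. intros c hc.
    destruct (hreg zb hb) as [hrz hgz].
    pose proof (g_yul zb z hrz hzb) as hg.
    destruct (yul_prj m _ _ hg) as [p [hp hpQ]].
    pose proof (yul_sub m _ _ _ _ hg hp) as hres.
    apply Rle_trans with (h zb + dot (vsub zb x) (vsub zb x) + K * ydot (ysub (g P zb) p) (ysub (g P zb) p)).
    + unfold penalty. pose proof (resid_min m (g P zb) p hpQ). nra.
    + refine (ul_le_c _ _ _ _ hc). apply ul_plus; [apply ul_plus |].
      * exact (has_grad_ul n _ _ _ _ hgz hzb).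
      * apply ul_dot; apply vul_sub; auto using vul_const.
      * apply ul_scal. exact (ul_ydot m _ _ _ _ hres hres).
Qed.

(** With the projection frozen at [prj (g P z)], the penalty is majorized by a differentiable
    function that agrees with it at [z]. So [z] minimizes the majorant along every line, and no
    derivative of the projection enters. *)
Lemma penalty_stationary K z : 0 <= K -> vnorm (vsub z x) < r ->
  (forall y, vnorm (vsub y x) <= r -> penalty K z <= penalty K y) ->
  vadd (vadd (Dh z) (vscal 2 (vsub z x))) (JgT P z (yscal (2 * K) (resid (g P z)))) = vzero.
Proof.
  intros hK hz hzmin. destruct (hreg z (Rlt_le _ _ hz)) as [hrz hgz].
  apply dot_eq_0_all. intros d. rewrite !dot_add_l, dot_scal_l, dot_JgT.
  assert (E : vadd z (vscal 0 d) = z) by (vext; ring).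
  apply (derivative_at_min (fun s => h (vadd z (vscal s d)) +
    (s * (2 * dot (vsub z x) d) + dot d d * (s * s)) +
    K * ydot (ysub (g P (vadd z (vscal s d))) (prj (g P z))) (ysub (g P (vadd z (vscal s d))) (prj (g P z))))).
  - replace (dot (Dh z) d + 2 * dot (vsub z x) d + ydot (yscal (2 * K) (resid (g P z))) (Jg P z d))
      with (dot (Dh z) d + (2 * dot (vsub z x) d + 2 * dot d d * 0) +
            K * (2 * ydot (resid (g P z)) (Jg P z d))) by (ydots; ring).
    refine (derivable_pt_lim_plus _ _ _ _ _ _ _).
    + refine (derivable_pt_lim_plus _ _ _ _ _ _ (derivable_quadratic _ _ _)).
      apply (derivable_line n h). rewrite E. exact hgz.
    + refine (derivable_pt_lim_scal _ _ _ _ _). exact (derivable_gap z d (prj (g P z)) hrz).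
  - pose proof (vnorm_nonneg n d) as hd.
    exists ((r - vnorm (vsub z x)) / (vnorm d + 1)). split; [apply Rdiv_lt_0_compat; lra |].
    intros s hs.
    assert (hs' : Rabs s * (vnorm d + 1) < r - vnorm (vsub z x)).
    { apply Rmult_lt_compat_r with (r := vnorm d + 1) in hs; [| lra].
      replace ((r - vnorm (vsub z x)) / (vnorm d + 1) * (vnorm d + 1)) with (r - vnorm (vsub z x)) in hs by (field; lra).
      exact hs. }
    specialize (hzmin (vadd z (vscal s d))). unfold penalty in hzmin.
    replace (vsub (vadd z (vscal s d)) x) with (vadd (vsub z x) (vscal s d)) in hzmin by (vext; ring).
    pose proof (vnorm_triang n (vsub z x) (vscal s d)) as ht. rewrite vnorm_scal in ht.
    pose proof (Rabs_pos s).
    specialize (hzmin ltac:(nra)).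
    pose proof (resid_min m (g P (vadd z (vscal s d))) (prj (g P z)) (proj1 (prj_spec m _))) as hmn.
    rewrite E. fold (resid (g P z)).
    replace (dot (vadd (vsub z x) (vscal s d)) (vadd (vsub z x) (vscal s d)))
      with (dot (vsub z x) (vsub z x) + (s * (2 * dot (vsub z x) d) + dot d d * (s * s))) in hzmin.
    + nra.
    + rewrite !dot_add_l, !dot_add_r, !dot_scal_l, !dot_scal_r, (dot_comm n d (vsub z x)). ring.
Qed.

(* Exact penalization: comparing the penalty minimizer with a nearby feasible point
   supplied by subregularity bounds the approximate multipliers. *)
Lemma multiplier_exists : exists lam,
  NQ (g P x) lam /\ vadd (Dh x) (JgT P x lam) = vzero /\ ynorm lam <= 4 * sigma * vnorm (Dh x).
Proof.
  pose (K := fun k : nat => (INR k + 1)).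
  assert (hK : forall k, 0 < K k) by (intros k; unfold K; pose proof (pos_INR k); lra).
  destruct (fun_choice _ _ _ (fun k => penalty_min_exists (K k) (Rlt_le _ _ (hK k)))) as [z hz].
  destruct (vul_exists n z (vnorm x + r)) as [zb hzb].
  { apply ev_all. intros k. pose proof (vnorm_le_add n (z k) x). pose proof (proj1 (hz k)). lra. }
  assert (hb : vnorm (vsub zb x) <= r).
  { apply (ul_le_c _ _ _ (ul_vnorm n _ _ (vul_sub n _ _ _ _ hzb (vul_const n x)))).
    apply ev_all. intros k. apply hz. }
  assert (hx0 : vnorm (vsub x x) <= r) by (rewrite vnorm_sub_self; lra).
  assert (hpx : forall k, penalty (K k) (z k) <= h x).
  { intros k. eapply Rle_trans; [apply (proj2 (hz k) x hx0) |]. unfold penalty.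
    pose proof (resid_min m (g P x) (g P x) hGx) as h1.
    replace (ydot (ysub (g P x) (g P x)) (ysub (g P x) (g P x))) with 0 in h1 by (ydots; ring).
    rewrite vsub_self, dot_zero_l. specialize (hK k). nra. }
  destruct (hreg zb hb) as [hrzb hgzb].
  pose proof (has_grad_ul n _ _ _ _ hgzb hzb) as hhz.
  pose (rho2 := fun k => ydot (resid (g P (z k))) (resid (g P (z k)))).
  assert (hrho : ul rho2 0).
  { apply ul_squeeze with (fun k => (h x - h (z k)) * / K k).
    - apply ev_all. intros k. rewrite Rminus_0_r, Rabs_right by (apply Rle_ge, ydot_nonneg).
      specialize (hpx k). unfold penalty in hpx. fold (rho2 k) in hpx.
      pose proof (dot_nonneg n (vsub (z k) x)). specialize (hK k).
      apply Rmult_le_reg_r with (K k); [exact hK |]. rewrite Rmult_assoc, Rinv_l by lra. lra.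
    - replace 0 with ((h x - h zb) * 0) by ring. apply ul_mult; [| apply ul_invn].
      apply ul_minus; [apply ul_const | exact hhz]. }
  pose proof (g_yul zb z hrzb hzb) as hgz.
  destruct (yul_prj m _ _ hgz) as [p [hp hpQ]].
  assert (hgp : g P zb = p).
  { pose proof (yul_sub m _ _ _ _ hgz hp) as hres.
    pose proof (ul_unique _ _ _ hrho (ul_ydot m _ _ _ _ hres hres)) as h0.
    symmetry in h0. apply ydot_self_0 in h0.
    apply Y_ext.
    - apply (f_equal fst) in h0. simpl in h0. simpl. lra.
    - apply functional_extensionality. intros i.
      apply (f_equal (fun w => snd w i)) in h0. simpl in h0. unfold vsub, vzero in h0. simpl. lra. }
  assert (hzbx : zb = x).
  { apply vnorm_sub_0. assert (hGz : Gamma P zb) by (unfold Gamma; rewrite hgp; exact hpQ).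
    specialize (hmin zb hb hGz).
    assert (h zb + dot (vsub zb x) (vsub zb x) <= h x).
    { refine (ul_le_c (fun k => h (z k) + dot (vsub (z k) x) (vsub (z k) x)) _ _ _ _).
      - apply ul_plus; [exact hhz |]. apply ul_dot; apply vul_sub; auto using vul_const.
      - apply ev_all. intros k. specialize (hpx k). unfold penalty in hpx.
        pose proof (ydot_nonneg m (resid (g P (z k)))). specialize (hK k). nra. }
    rewrite <- vnorm_sq in H. pose proof (vnorm_nonneg n (vsub zb x)). nra. }
  subst zb. clear hb. rewrite <- hgp in hp. clear hpQ hgp p.
  pose (del := fun k => ynorm (resid (g P (z k)))).
  assert (hdel : ul del 0) by (rewrite <- sqrt_0; apply ul_sqrt; [lra | exact hrho]).
  assert (hd0 : forall k, 0 <= del k) by (intros k; apply ynorm_nonneg).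
  assert (H : forall k, exists y, Gamma P y /\ vnorm (vsub y (z k)) <= 2 * sigma * del k).
  { intros k. destruct (prj_spec m (g P (z k))) as [hpr _].
    destruct (Req_dec (del k) 0) as [h0 | h0].
    - exists (z k). rewrite vnorm_sub_self. split; [| rewrite h0; lra].
      unfold Gamma. apply ynorm_0 in h0. unfold resid in h0.
      replace (g P (z k)) with (prj (g P (z k))); [exact hpr |].
      apply Y_ext.
      + apply (f_equal fst) in h0. simpl in h0. simpl. lra.
      + apply functional_extensionality. intros i.
        apply (f_equal (fun w => snd w i)) in h0. simpl in h0. unfold vsub, vzero in h0. simpl. lra.
    (* The slack in the subregularity estimate is taken equal to its main term [sigma * del k],
       which doubles the modulus. *)
    - assert (hdp : 0 < sigma * del k) by (apply Rmult_lt_0_compat; [exact hsigma | specialize (hd0 k); lra]).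
      destruct (proj2 (proj2 (proj1 (hreg (z k) (proj1 (hz k))))) _ _ hpr hdp) as [y [hy1 hy2]].
      exists y. split; [exact hy1 |]. rewrite vnorm_sub_sym.
      fold (resid (g P (z k))) in hy2. fold (del k) in hy2. lra. }
  destruct (fun_choice _ _ _ H) as [y hy]. clear H.
  pose (d := fun k => vsub (y k) (z k)).
  assert (hd : vul d vzero).
  { apply vul_norm0. apply ul_squeeze with (fun k => 2 * sigma * del k).
    - apply ev_all. intros k. rewrite Rminus_0_r, Rabs_right by (apply Rle_ge, vnorm_nonneg).
      replace (vsub (d k) vzero) with (d k) by (vext; ring). apply hy.
    - replace 0 with (2 * sigma * 0) by ring. apply ul_scal, hdel. }
  assert (hyx : vul y x).
  { apply vul_ext with (fun k => vadd (z k) (d k)).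
    - apply ev_all. intros k. unfold d. vext. ring.
    - replace x with (vadd x vzero) by (vext; ring). apply vul_add; assumption. }
  pose proof (vul_ball n z x r hzb hr) as hzr. pose proof (vul_ball n y x r hyx hr) as hyr.
  destruct (ev_choice R 0 (fun k c => 0 < c < 1 /\
      h (y k) - h (z k) = dot (Dh (vadd (z k) (vscal c (d k)))) (d k))) as [c hc].
  { apply (ev_mp _ _ hzr). refine (ev_imp _ _ _ hyr). intros k hk1 hk2.
    destruct (MVT_cor2 (fun t => h (vadd (z k) (vscal t (d k))))
      (fun t => dot (Dh (vadd (z k) (vscal t (d k)))) (d k)) 0 1 Rlt_0_1) as [c [h1 h2]].
    - intros c hc. apply derivable_line. apply hreg.
      replace (vsub (vadd (z k) (vscal c (d k))) x)
        with (vadd (vscal (1 - c) (vsub (z k) x)) (vscal c (vsub (y k) x))) by (unfold d; vext; ring).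
      eapply Rle_trans; [apply vnorm_triang |]. rewrite !vnorm_scal, !Rabs_right by lra. nra.
    - exists c. split; [exact h2 |].
      replace (vadd (z k) (vscal 0 (d k))) with (z k) in h1 by (vext; ring).
      replace (vadd (z k) (vscal 1 (d k))) with (y k) in h1 by (unfold d; vext; ring).
      rewrite h1. ring. }
  pose (xi := fun k => vadd (z k) (vscal (c k) (d k))).
  assert (hxi : vul xi x).
  { apply vul_norm0. apply ul_squeeze with (fun k => vnorm (vsub (z k) x) + vnorm (d k)).
    - refine (ev_imp _ _ _ hc). intros k [hk _].
      rewrite Rminus_0_r, Rabs_right by (apply Rle_ge, vnorm_nonneg).
      pose proof (segment_dist n (z k) (d k) x (c k) 1 ltac:(lra)) as hs.
      rewrite (vnorm_scal n 1), Rabs_R1, Rmult_1_l in hs. exact hs.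
    - replace 0 with (0 + vnorm (@vzero n)) by (rewrite vnorm_vzero; ring).
      apply ul_plus; [apply vul_norm_iff, hzb | apply ul_vnorm, hd]. }
  (* [B k] bounds the rate at which [h] and the squared distance to [x] change between [z k] and the
     feasible point [y k]. *)
  pose (B := fun k => vnorm (Dh (xi k)) + vnorm (vsub (y k) x) + vnorm (vsub (z k) x)).
  assert (hB : ul B (vnorm (Dh x))).
  { replace (vnorm (Dh x)) with (vnorm (Dh x) + 0 + 0) by ring.
    repeat apply ul_plus; [apply ul_vnorm, hcont, hxi | apply vul_norm_iff, hyx | apply vul_norm_iff, hzb]. }
  pose (lam := fun k => yscal (2 * K k) (resid (g P (z k)))).
  assert (hlam : ev (fun k => ynorm (lam k) <= 4 * sigma * B k)).
  { apply (ev_mp _ _ hyr). refine (ev_imp _ _ _ hc). intros k [_ hk] hyk.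
    assert (hn : ynorm (lam k) = 2 * K k * del k).
    { unfold lam, ynorm, del.
      replace (ydot (yscal (2 * K k) (resid (g P (z k)))) (yscal (2 * K k) (resid (g P (z k)))))
        with ((2 * K k) * (2 * K k) * ydot (resid (g P (z k))) (resid (g P (z k)))) by (ydots; ring).
      specialize (hK k). rewrite sqrt_mult_alt by nra. rewrite sqrt_square by lra. reflexivity. }
    rewrite hn.
    assert (hB0 : 0 <= B k).
    { unfold B. pose proof (vnorm_nonneg n (Dh (xi k))). pose proof (vnorm_nonneg n (vsub (y k) x)).
      pose proof (vnorm_nonneg n (vsub (z k) x)). lra. }
    destruct (Req_dec (del k) 0) as [h0 | h0]; [rewrite h0; nra |].
    specialize (hd0 k). specialize (hK k).
    destruct (hy k) as [hGy hdy].
    pose proof (proj2 (hz k) (y k) (Rlt_le _ _ hyk)) as hmn. unfold penalty in hmn.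
    pose proof (resid_min m (g P (y k)) (g P (y k)) hGy) as h1.
    replace (ydot (ysub (g P (y k)) (g P (y k))) (ysub (g P (y k)) (g P (y k)))) with 0 in h1 by (ydots; ring).
    rewrite <- (ynorm_sq m (resid (g P (z k)))) in hmn. fold (del k) in hmn. fold (d k) in hdy.
    assert (h2 : dot (vsub (y k) x) (vsub (y k) x) - dot (vsub (z k) x) (vsub (z k) x)
                 = dot (vsub (y k) x) (d k) + dot (vsub (z k) x) (d k)).
    { unfold d. dots. rewrite (dot_comm n (z k) (y k)), (dot_comm n x (z k)), (dot_comm n x (y k)). ring. }
    pose proof (dot_le n (Dh (xi k)) (d k)) as h3. unfold xi in h3 at 1. rewrite <- hk in h3.
    pose proof (dot_le n (vsub (y k) x) (d k)) as h4.
    pose proof (dot_le n (vsub (z k) x) (d k)) as h5.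
    (* Dividing by [del k] leaves [K k * del k <= 2 * sigma * B k]; as the multiplier has norm
       [2 * K k * del k], the constant 4 results. *)
    assert (h6 : K k * (del k * del k) <= B k * (2 * sigma * del k)).
    { apply Rle_trans with (B k * vnorm (d k)).
      - unfold B. nra.
      - apply Rmult_le_compat_l; assumption. }
    apply Rmult_le_reg_r with (del k); [lra |]. nra. }
  destruct (yul_exists m lam (4 * sigma * (vnorm (Dh x) + 1))) as [lb hlb].
  { apply (ev_mp _ _ hlam). refine (ev_imp _ _ _ (ul_bound _ _ hB)). intros k h1 h2.
    rewrite (Rabs_right (vnorm (Dh x))) in h1 by (apply Rle_ge, vnorm_nonneg).
    pose proof (Rle_abs (B k)). nra. }
  exists lb. split; [| split].
  - apply NQ_iff. split; [exact hGx |]. split.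
    + apply (inQstar_closed m _ _ hlb). apply ev_all. intros k.
      destruct (prj_spec m (g P (z k))) as [_ [h1 _]]. unfold inQstar in *. unfold lam, yscal. cbn [fst snd].
      specialize (hK k). rewrite vnorm_scal, Rabs_right by lra. nra.
    + apply (ul_unique _ _ _ (ul_ydot m _ _ _ _ hlb hp)).
      refine (ul_ext_all _ _ _ _ (ul_const 0)). intros k.
      destruct (prj_spec m (g P (z k))) as [_ [_ h1]]. unfold lam.
      replace (ydot (yscal (2 * K k) (resid (g P (z k)))) (prj (g P (z k))))
        with (2 * K k * ydot (resid (g P (z k))) (prj (g P (z k)))) by (ydots; ring).
      rewrite h1. ring.
  - assert (h1 : vul (fun k => vadd (vadd (Dh (z k)) (vscal 2 (vsub (z k) x))) (JgT P (z k) (lam k)))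
                   (vadd (vadd (Dh x) (vscal 2 (vsub x x))) (JgT P x lb))).
    { apply vul_add; [apply vul_add |].
      - apply hcont, hzb.
      - apply vul_scal; [apply ul_const | apply vul_sub; auto using vul_const].
      - exact (JgT_vul x z lam lb hrzb hzb hlb). }
    replace (vadd (vadd (Dh x) (vscal 2 (vsub x x))) (JgT P x lb)) with (vadd (Dh x) (JgT P x lb)) in h1
      by (vext; ring).
    refine (vul_unique n _ _ _ h1 _). apply vul_ext with (fun _ => vzero); [| apply vul_const].
    refine (ev_imp _ _ _ hzr). intros k hk. symmetry. unfold lam.
    apply penalty_stationary; [left; apply hK | exact hk | apply hz].
  - exact (ul_le _ _ _ _ (ul_ynorm m _ _ hlb) (ul_scal (4 * sigma) _ _ hB) hlam).
Qed.
End Multipliers.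

Lemma has_grad_quadratic n (h : Vec n -> R) x D A c b : has_grad h x D ->
  has_grad (fun z => h z + A * dot (vsub z c) (vsub z c) - dot b z) x
    (vsub (vadd D (vscal (2 * A) (vsub x c))) b).
Proof.
  intros hD e he. destruct (hD (e / 2) ltac:(lra)) as [d [hd H]].
  pose proof (Rabs_pos A) as hA0.
  assert (hq : 0 < e / 2 / (Rabs A + 1)) by (repeat apply Rdiv_lt_0_compat; lra).
  exists (Rmin d (e / 2 / (Rabs A + 1))). split; [apply Rmin_glb_lt; assumption |]. intros y hy.
  pose proof (Rmin_l d (e / 2 / (Rabs A + 1))). pose proof (Rmin_r d (e / 2 / (Rabs A + 1))).
  specialize (H y ltac:(lra)).
  replace (h y + A * dot (vsub y c) (vsub y c) - dot b y - (h x + A * dot (vsub x c) (vsub x c) - dot b x)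
      - dot (vsub (vadd D (vscal (2 * A) (vsub x c))) b) (vsub y x))
    with ((h y - h x - dot D (vsub y x)) + A * dot (vsub y x) (vsub y x)).
  2:{ dots. rewrite (dot_comm n c x), (dot_comm n y x), (dot_comm n c y). ring. }
  eapply Rle_trans; [apply Rabs_triang |].
  rewrite Rabs_mult, (Rabs_right (dot (vsub y x) (vsub y x))) by (apply Rle_ge, dot_nonneg).
  rewrite <- vnorm_sq. pose proof (vnorm_nonneg n (vsub y x)) as hn.
  assert (hs : Rabs A * vnorm (vsub y x) <= e / 2).
  { assert (hlt : vnorm (vsub y x) <= e / 2 / (Rabs A + 1)) by lra.
    apply Rmult_le_compat_l with (r := Rabs A + 1) in hlt; [| lra].
    replace ((Rabs A + 1) * (e / 2 / (Rabs A + 1))) with (e / 2) in hlt by (field; lra). nra. }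
  nra.
Qed.

Lemma has_grad_zero n x : has_grad (fun _ : Vec n => 0) x vzero.
Proof.
  intros e he. exists 1. split; [lra |]. intros y _. rewrite dot_zero_l, !Rminus_0_r, Rabs_R0.
  pose proof (vnorm_nonneg n (vsub y x)). nra.
Qed.

(** * Argmin maps and growth *)

(** Continuous induction: the supremum of the parameters that satisfy the bound satisfies it too, by
    the local estimate to its left, and the estimate to its right would push it further unless it
    equals 1. The radius [eta] may depend on [s]. *)
Lemma segment_lipschitz n (phi : R -> Vec n) M :
  (forall s, 0 <= s <= 1 -> exists eta, 0 < eta /\ forall s', 0 <= s' <= 1 -> Rabs (s' - s) < eta ->
     vnorm (vsub (phi s') (phi s)) <= M * Rabs (s' - s)) ->
  vnorm (vsub (phi 1) (phi 0)) <= M.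
Proof.
  intros h.
  destruct (completeness (fun s => 0 <= s <= 1 /\ vnorm (vsub (phi s) (phi 0)) <= M * s)) as [c [h1 h2]].
  - exists 1. intros s [hs _]. lra.
  - exists 0. rewrite vnorm_sub_self. lra.
  - assert (hc0 : 0 <= c).
    { apply h1. rewrite vnorm_sub_self. lra. }
    assert (hc1 : c <= 1) by (apply h2; intros s [hs _]; lra).
    destruct (h c (conj hc0 hc1)) as [eta [he H]].
    assert (hs : exists s, (0 <= s <= 1 /\ vnorm (vsub (phi s) (phi 0)) <= M * s) /\ c - eta < s <= c).
    { match goal with |- ?G => destruct (classic G) as [Hc | Hc]; [exact Hc | exfalso] end.
      assert (c <= c - eta); [| lra]. apply h2. intros s hs. apply Rnot_lt_le. intros hlt.
      apply Hc. exists s. split; [exact hs |]. specialize (h1 s hs). lra. }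
    destruct hs as [s [[hs01 hsM] hsc]].
    assert (hcM : vnorm (vsub (phi c) (phi 0)) <= M * c).
    { specialize (H s hs01). rewrite Rabs_left1 in H by lra. specialize (H ltac:(lra)).
      pose proof (vnorm_sub_triang n (phi c) (phi s) (phi 0)) as ht.
      rewrite (vnorm_sub_sym n (phi c) (phi s)) in ht. lra. }
    destruct (Req_dec c 1) as [-> | hne]; [rewrite Rmult_1_r in hcM; exact hcM | exfalso].
    pose (c' := c + Rmin (eta / 2) (1 - c)).
    pose proof (Rmin_l (eta / 2) (1 - c)). pose proof (Rmin_r (eta / 2) (1 - c)).
    assert (hm : 0 < Rmin (eta / 2) (1 - c)) by (apply Rmin_glb_lt; lra).
    assert (hc' : 0 <= c' <= 1) by (unfold c'; lra).
    assert (Hc' := H c' hc'). rewrite Rabs_right in Hc' by (unfold c'; lra).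
    specialize (Hc' ltac:(unfold c'; lra)).
    assert (c' <= c); [| unfold c' in *; lra].
    apply h1. split; [exact hc' |].
    pose proof (vnorm_sub_triang n (phi c') (phi c) (phi 0)). lra.
Qed.

Lemma ball_segment n (y e : Vec n) s de : 0 <= s <= 1 -> vnorm y < de -> vnorm (vadd y e) < de ->
  vnorm (vadd y (vscal s e)) < de.
Proof.
  intros hs h1 h2.
  replace (vadd y (vscal s e)) with (vadd (vscal (1 - s) y) (vscal s (vadd y e))) by (vext; ring).
  eapply Rle_lt_trans; [apply vnorm_triang |]. rewrite !vnorm_scal, !Rabs_right by lra.
  destruct (Req_dec s 0) as [-> | hs0]; nra.
Qed.

Lemma lipschitz_of_calm n (T : Vec n -> Vec n) L de :
  (forall y, vnorm y < de -> exists eta, 0 < eta /\ forall y', vnorm y' < de ->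
     vnorm (vsub y' y) < eta -> vnorm (vsub (T y') (T y)) <= L * vnorm (vsub y' y)) ->
  forall y e, vnorm y < de -> vnorm (vadd y e) < de -> vnorm (vsub (T (vadd y e)) (T y)) <= L * vnorm e.
Proof.
  intros Tcalm y e h1 h2.
  pose proof (segment_lipschitz n (fun s => T (vadd y (vscal s e))) (L * vnorm e)) as hseg.
  cbv beta in hseg.
  replace (vadd y (vscal 0 e)) with y in hseg by (vext; ring).
  replace (vadd y (vscal 1 e)) with (vadd y e) in hseg by (vext; ring).
  apply hseg. clear hseg. intros s hs.
  destruct (Tcalm _ (ball_segment n y e s de hs h1 h2)) as [eta [he H]].
  pose proof (vnorm_nonneg n e) as hne.
  exists (eta / (vnorm e + 1)). split; [apply Rdiv_lt_0_compat; lra |]. intros s' hs' hss.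
  assert (E : vsub (vadd y (vscal s' e)) (vadd y (vscal s e)) = vscal (s' - s) e) by (vext; ring).
  specialize (H _ (ball_segment n y e s' de hs' h1 h2)). rewrite E, vnorm_scal in H.
  apply Rmult_lt_compat_r with (r := vnorm e + 1) in hss; [| lra].
  replace (eta / (vnorm e + 1) * (vnorm e + 1)) with eta in hss by (field; lra).
  pose proof (Rabs_pos (s' - s)). specialize (H ltac:(nra)). lra.
Qed.

(* [T] is minus the gradient of the concave value function, so its Lipschitz constant
   bounds the curvature of the value from below; conjugation turns this into growth. *)
Section ArgminGrowth.
Context {n : nat} (S : Vec n -> Prop) (psi : Vec n -> R) (T : Vec n -> Vec n) (mu de : R).
Hypothesis hmu : 0 < mu.
Hypothesis hT : forall y, S (T y) /\ forall z, S z -> psi (T y) - dot y (T y) <= psi z - dot y z.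
Hypothesis Tlip : forall y e, vnorm y < de -> vnorm (vadd y e) < de ->
  vnorm (vsub (T (vadd y e)) (T y)) <= / mu * vnorm e.

Let val (y : Vec n) : R := psi (T y) - dot y (T y).

Lemma value_supergradient y e : val (vadd y e) <= val y - dot e (T y).
Proof.
  pose proof (proj2 (hT (vadd y e)) (T y) (proj1 (hT y))) as h.
  unfold val at 1. eapply Rle_trans; [exact h |]. unfold val. rewrite dot_add_l. lra.
Qed.

(** The supergradient inequalities at the two ends of a step squeeze the difference quotient between
    two values of [T], and the Lipschitz bound closes the gap. *)
Lemma value_derivable y e s : vnorm (vadd y (vscal s e)) < de ->
  derivable_pt_lim (fun s => val (vadd y (vscal s e))) s (- dot e (T (vadd y (vscal s e)))).
Proof.
  intros hs eps heps. pose proof (vnorm_nonneg n e) as hne.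
  assert (him : 0 < / mu) by (apply Rinv_0_lt_compat, hmu).
  pose (d1 := (de - vnorm (vadd y (vscal s e))) / (vnorm e + 1)).
  pose (d2 := eps / (/ mu * (vnorm e * vnorm e) + 1)).
  assert (hden : 0 < / mu * (vnorm e * vnorm e) + 1).
  { assert (0 <= vnorm e * vnorm e) by nra. nra. }
  assert (hd1 : 0 < d1) by (apply Rdiv_lt_0_compat; lra).
  assert (hd2 : 0 < d2) by (apply Rdiv_lt_0_compat; lra).
  exists (mkposreal _ (Rmin_glb_lt _ _ _ hd1 hd2)). simpl. intros t ht htd.
  pose proof (Rmin_l d1 d2). pose proof (Rmin_r d1 d2). pose proof (Rabs_pos_lt t ht) as hta.
  assert (E : vadd y (vscal (s + t) e) = vadd (vadd y (vscal s e)) (vscal t e)) by (vext; ring).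
  rewrite E. set (y0 := vadd y (vscal s e)) in *.
  assert (ht1 : Rabs t * (vnorm e + 1) < de - vnorm y0).
  { assert (hx1 : Rabs t < d1) by lra. unfold d1 in hx1.
    apply Rmult_lt_compat_r with (r := vnorm e + 1) in hx1; [| lra].
    replace ((de - vnorm y0) / (vnorm e + 1) * (vnorm e + 1)) with (de - vnorm y0) in hx1 by (field; lra).
    exact hx1. }
  assert (hy1 : vnorm (vadd y0 (vscal t e)) < de).
  { eapply Rle_lt_trans; [apply vnorm_triang |]. rewrite vnorm_scal. nra. }
  pose proof (value_supergradient y0 (vscal t e)) as u1.
  pose proof (value_supergradient (vadd y0 (vscal t e)) (vscal (- t) e)) as u2.
  replace (vadd (vadd y0 (vscal t e)) (vscal (- t) e)) with y0 in u2 by (vext; ring).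
  rewrite !dot_scal_l in u1, u2.
  pose proof (Tlip y0 (vscal t e) hs hy1) as hL. rewrite vnorm_scal in hL.
  pose proof (dot_abs_le n e (vsub (T (vadd y0 (vscal t e))) (T y0))) as hab. rewrite dot_sub_r in hab.
  set (A1 := dot e (T (vadd y0 (vscal t e)))) in *. set (A0 := dot e (T y0)) in *.
  set (w1 := val (vadd y0 (vscal t e))) in *. set (w0 := val y0) in *.
  replace ((w1 - w0) / t - - A0) with ((w1 - w0 + t * A0) / t) by (field; exact ht).
  unfold Rdiv. rewrite Rabs_mult, Rabs_inv.
  assert (hnum : Rabs (w1 - w0 + t * A0) <= Rabs t * Rabs (A1 - A0)).
  { rewrite <- Rabs_mult. assert (- (t * (A1 - A0)) <= w1 - w0 + t * A0 <= 0) by lra.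
    rewrite (Rabs_left1 (w1 - w0 + t * A0)) by lra. pose proof (Rle_abs (t * (A1 - A0))). lra. }
  apply Rmult_lt_reg_r with (Rabs t); [exact hta |]. rewrite Rmult_assoc, Rinv_l, Rmult_1_r by lra.
  eapply Rle_lt_trans; [exact hnum |]. rewrite Rmult_comm. apply Rmult_lt_compat_r; [exact hta |].
  eapply Rle_lt_trans; [exact hab |].
  apply Rle_lt_trans with (/ mu * (vnorm e * vnorm e) * Rabs t).
  - apply Rle_trans with (vnorm e * (/ mu * (Rabs t * vnorm e))); [| lra].
    apply Rmult_le_compat_l; assumption.
  - assert (hx2 : Rabs t < d2) by lra. unfold d2 in hx2.
    apply Rmult_lt_compat_r with (r := / mu * (vnorm e * vnorm e) + 1) in hx2; [| lra].
    unfold Rdiv in hx2. rewrite (Rmult_assoc eps), Rinv_l, Rmult_1_r in hx2 by lra. lra.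
Qed.

Lemma value_lower_bound y e : vnorm y < de -> vnorm (vadd y e) < de ->
  val y - dot e (T y) - / 2 * / mu * dot e e <= val (vadd y e).
Proof.
  intros h1 h2.
  assert (him : 0 < / mu) by (apply Rinv_0_lt_compat, hmu).
  destruct (MVT_cor2 (fun s => val (vadd y (vscal s e)) + (s * dot e (T y) + / 2 * / mu * dot e e * (s * s)))
    (fun s => - dot e (T (vadd y (vscal s e))) + (dot e (T y) + 2 * (/ 2 * / mu * dot e e) * s)) 0 1 Rlt_0_1)
    as [c [hc1 hc2]].
  - intros c hc. refine (derivable_pt_lim_plus _ _ _ _ _ (value_derivable y e c (ball_segment n y e c de hc h1 h2)) (derivable_quadratic _ _ _)).
  - replace (vadd y (vscal 1 e)) with (vadd y e) in hc1 by (vext; ring).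
    replace (vadd y (vscal 0 e)) with y in hc1 by (vext; ring).
    pose proof (ball_segment n y e c de ltac:(lra) h1 h2) as hc3.
    pose proof (Tlip y (vscal c e) h1 hc3) as hL. rewrite vnorm_scal, Rabs_right in hL by lra.
    pose proof (dot_le n e (vsub (T (vadd y (vscal c e))) (T y))) as hd. rewrite dot_sub_r in hd.
    pose proof (vnorm_nonneg n e) as hne. rewrite <- vnorm_sq in hc1 |- *.
    assert (hbd : vnorm e * vnorm (vsub (T (vadd y (vscal c e))) (T y)) <= vnorm e * (/ mu * (c * vnorm e))).
    { apply Rmult_le_compat_l; assumption. }
    nra.
Qed.

(** Testing [z] as a competitor at [y + e] and bounding the value there from below gives a lower
    bound for [psi z] that is a concave quadratic in [e]. The step [mu * (z - T y)] is its
    maximizer. *)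
Lemma argmin_growth y z : vnorm y < de -> S z -> vnorm (vadd y (vscal mu (vsub z (T y)))) < de ->
  psi (T y) + dot y (vsub z (T y)) + / 2 * mu * dot (vsub z (T y)) (vsub z (T y)) <= psi z.
Proof.
  intros hy hz hze. set (x := T y) in *. set (e := vscal mu (vsub z x)) in *.
  pose proof (value_lower_bound y e hy hze) as hlow. fold x in hlow.
  pose proof (proj2 (hT (vadd y e)) z hz) as hup.
  unfold val in hlow. fold x in hlow. rewrite (dot_add_l n y e z) in hup.
  assert (Ee : / 2 * / mu * dot e e = / 2 * mu * dot (vsub z x) (vsub z x)).
  { unfold e. rewrite dot_scal_l, dot_scal_r. field. lra. }
  assert (Ed : dot e z - dot e x = mu * dot (vsub z x) (vsub z x)).
  { rewrite <- dot_sub_r. unfold e. apply dot_scal_l. }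
  rewrite (dot_sub_r n z x y). lra.
Qed.
End ArgminGrowth.

(** * Infima in the extended reals, and unit directions *)

Lemma ER_inf_spec (S : ER -> Prop) : is_ER_inf S (ER_inf S).
Proof.
  apply (epsilon_spec (inhabits ERpinf) (is_ER_inf S)).
  destruct (classic (exists r, forall x, S x -> ER_le (ERfin r) x)) as [[r hr] | h].
  - destruct (classic (exists a, S (ERfin a))) as [[a ha] | h].
    + destruct (is_glb_exists (fun x => S (ERfin x)) a r ha) as [g [h1 h2]].
      { intros x hx. exact (hr _ hx). }
      exists (ERfin g). split.
      * intros [x | |] hx; simpl; [apply h1, hx | exact I | exact (hr _ hx)].
      * intros [b | |] hb; simpl; [| exact (hb _ ha) | exact I].
        apply h2. intros x hx. exact (hb _ hx).
    + exists ERpinf. split.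
      * intros [x | |] hx; simpl; [apply h; exists x; exact hx | exact I | exact (hr _ hx)].
      * intros [b | |] hb; exact I.
  - exists ERminf. split; [intros; exact I |].
    intros [b | |] hb; [apply h; exists b; exact hb | apply h; exists 0 | exact I].
    intros [x | |] hx; [destruct (hb _ hx) | exact I | destruct (hb _ hx)].
Qed.

Definition dir {n} (d : Vec n) : Vec n := vscal (/ vnorm d) d.

Lemma dir_eq n (d : Vec n) : d = vscal (vnorm d) (dir d).
Proof.
  unfold dir. destruct (Req_dec (vnorm d) 0) as [h | h].
  - apply vnorm_0 in h. subst d. vext. ring.
  - apply functional_extensionality. intros i. unfold vscal. field. exact h.
Qed.

Lemma dir_line n (x y : Vec n) : y = vadd x (vscal (vnorm (vsub y x)) (dir (vsub y x))).
Proof. rewrite <- dir_eq. vext. ring. Qed.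

Lemma vnorm_dir n (d : Vec n) : 0 < vnorm d -> vnorm (dir d) = 1.
Proof.
  intros h. unfold dir. rewrite vnorm_scal, Rabs_inv, Rabs_right by lra. field. lra.
Qed.

Lemma dir_limit n (d : nat -> Vec n) : ev (fun k => 0 < vnorm (d k)) ->
  exists u, vul (fun k => dir (d k)) u /\ sphere u.
Proof.
  intros h.
  assert (h1 : ev (fun k => 1 = vnorm (dir (d k)))).
  { refine (ev_imp _ _ _ h). intros k hk. symmetry. apply vnorm_dir, hk. }
  destruct (vul_exists n (fun k => dir (d k)) 1) as [u hu].
  { refine (ev_imp _ _ _ h1). intros k hk. lra. }
  exists u. split; [exact hu |].
  apply (ul_unique _ _ _ (ul_vnorm n _ _ hu)). apply (ul_ext _ _ _ h1), ul_const.
Qed.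

(** * Scalar expansions *)

Section ScalarExpansion.
Context {n : nat} (h : Vec n -> R) (Dh : Vec n -> Vec n) (D2h : Vec n -> Mat n) (xb : Vec n).
Hypothesis hC : C2_around h Dh D2h xb.
Context (x x' u : nat -> Vec n) (s : nat -> R) (ub : Vec n).
Hypothesis hu : vul u ub.
Hypothesis hs : ul s 0.
Hypothesis hs0 : ev (fun k => 0 < s k).
Hypothesis hx' : forall k, x' k = vadd (x k) (vscal (s k) (u k)).

Lemma scalar_forward : vul x xb ->
  ul (fun k => / (s k * s k) * (h (x' k) - h (x k) - dot (Dh (x k)) (vscal (s k) (u k))))
    (1 / 2 * quad (D2h xb) ub ub).
Proof.
  intros hx. replace (1 / 2) with (/ 2) by field.
  refine (ul_ext_all _ _ _ _ (C2_expansion h Dh D2h xb x u s ub hC hx hu hs hs0)).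
  intros k. rewrite hx', dot_scal_r. unfold Rdiv. ring.
Qed.

Lemma scalar_grad : vul x xb ->
  ul (fun k => / (s k * s k) * dot (vsub (Dh (x' k)) (Dh (x k))) (vscal (s k) (u k)))
    (quad (D2h xb) ub ub).
Proof.
  intros hx. unfold quad. rewrite dot_comm.
  refine (ul_ext _ _ _ _ (ul_dot n _ _ _ _ (C2_grad_expansion h Dh D2h xb hC x u s ub hx hu hs hs0) hu)).
  refine (ev_imp _ _ _ hs0). intros k hk. rewrite hx', dot_scal_l, dot_scal_r. field. lra.
Qed.

(** Expansion based at the far endpoint, obtained as the gradient difference minus the forward
    expansion. *)
Lemma scalar_backward : vul x xb ->
  ul (fun k => / (s k * s k) * (dot (Dh (x' k)) (vscal (s k) (u k)) - (h (x' k) - h (x k))))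
    (1 / 2 * quad (D2h xb) ub ub).
Proof.
  intros hx.
  replace (1 / 2 * quad (D2h xb) ub ub) with (quad (D2h xb) ub ub - 1 / 2 * quad (D2h xb) ub ub) by field.
  refine (ul_ext_all _ _ _ _ (ul_minus _ _ _ _ (scalar_grad hx) (scalar_forward hx))).
  intros k. rewrite dot_sub_l. ring.
Qed.

(** The first-order term may blow up, so it is subtracted as a value of the derivative at [xb];
    afterwards only its membership in the range of the Jacobian matters ([affine_limit]). *)
Lemma scalar_base_second : (forall k, x k = xb) -> h xb = 0 ->
  ul (fun k => / (s k * s k) * h (x' k) - dot (Dh xb) (vscal (/ s k) (u k)))
    (1 / 2 * quad (D2h xb) ub ub).
Proof.
  intros hx h0.
  assert (hxl : vul x xb).
  { refine (vul_ext n _ _ _ _ (vul_const n xb)). apply ev_all. intros k. symmetry. apply hx. }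
  refine (ul_ext _ _ _ _ (scalar_forward hxl)).
  refine (ev_imp _ _ _ hs0). intros k hk. rewrite hx, h0, !dot_scal_r. field. lra.
Qed.

Lemma scalar_base_first : (forall k, x k = xb) -> h xb = 0 ->
  ul (fun k => / s k * h (x' k)) (dot (Dh xb) ub).
Proof.
  intros hx h0.
  replace (dot (Dh xb) ub) with (0 * (1 / 2 * quad (D2h xb) ub ub) + dot (Dh xb) ub) by ring.
  refine (ul_ext _ _ _ _ (ul_plus _ _ _ _ (ul_mult _ _ _ _ hs (scalar_base_second hx h0))
    (ul_dot n _ _ _ _ (vul_const n (Dh xb)) hu))).
  refine (ev_imp _ _ _ hs0). intros k hk. rewrite dot_scal_r. field. lra.
Qed.

Context (t : nat -> R) (v : nat -> Vec n) (vb : Vec n).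
Hypothesis ht : ul t 0.
Hypothesis ht0 : ev (fun k => 0 < t k).
Hypothesis hv : vul v vb.
Hypothesis hx : forall k, x k = vadd xb (vscal (t k) (v k)).

Lemma base_line : vul x xb.
Proof.
  refine (vul_ext n _ _ _ _ (vul_line n (fun _ => xb) v t xb vb (vul_const n xb) hv ht)).
  apply ev_all. intros k. symmetry. apply hx.
Qed.

(** From [xb] to [xb + t v] the gradient changes by about [t * D2h v], which yields a mixed second
    difference at scale [s * t]; the pure second-order term in [s] is smaller by the factor
    [s / t]. *)
Lemma scalar_mixed : ul (fun k => s k / t k) 0 ->
  ul (fun k => / (s k * t k) * (h (x' k) - h (x k)) - dot (Dh xb) (vscal (/ t k) (u k)))
    (quad (D2h xb) vb ub).
Proof.
  intros hst. rewrite (hessian_sym h Dh D2h xb vb ub hC).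
  pose proof base_line as hxl.
  pose proof (ul_mult _ _ _ _ hst (scalar_forward hxl)) as e1.
  pose proof (ul_dot n _ _ _ _ (C2_grad_expansion h Dh D2h xb hC (fun _ => xb) v t vb (vul_const n xb) hv ht ht0) hu) as e2.
  pose proof (ul_plus _ _ _ _ e1 e2) as e3. rewrite Rmult_0_l, Rplus_0_l, dot_comm in e3.
  refine (ul_ext _ _ _ _ e3). apply (ev_mp _ _ ht0). refine (ev_imp _ _ _ hs0). intros k h1 h2.
  cbv beta. rewrite (hx k). dots. field. lra.
Qed.

Lemma scalar_diff : ul (fun k => s k / (t k * t k)) 0 ->
  ul (fun k => / (t k * t k) * (h (x' k) - h (x k))) 0.
Proof.
  intros hst. pose proof base_line as hxl.
  pose proof (ul_dot n _ _ _ _ (C2_grad_ul h Dh D2h xb hC x hxl) hu) as e1.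
  pose proof (ul_mult _ _ _ _ hst (ul_plus _ _ _ _ (ul_mult _ _ _ _ hs (scalar_forward hxl)) e1)) as e2.
  rewrite !Rmult_0_l in e2.
  refine (ul_ext _ _ _ _ e2). apply (ev_mp _ _ ht0). refine (ev_imp _ _ _ hs0). intros k h1 h2.
  rewrite dot_scal_r. field. lra.
Qed.
End ScalarExpansion.

(** * The problem near [xb]: expansions, tangents, limits of multipliers, prox-regularity *)

Section Local.
Context {n m : nat} (P : Prob n m) (xb : Vec n) (sigma : R).
Hypothesis hf : C2_around (pf P) (pDf P) (pD2f P) xb.
Hypothesis hg0 : C2_around (pg0 P) (pDg0 P) (pD2g0 P) xb.
Hypothesis hgr : forall k, C2_around (fun x => pgr P x k) (pDgr P k) (pD2gr P k) xb.
Hypothesis hgx : g P xb = yzero.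
Hypothesis hsigma : 0 < sigma.
Hypothesis hM : MSCQ P xb sigma.

Let xs := vopp (pDf P xb).

Lemma pg0_0 : pg0 P xb = 0.
Proof. exact (f_equal fst hgx). Qed.

Lemma pgr_0 k : pgr P xb k = 0.
Proof. exact (f_equal (fun q => snd q k) hgx). Qed.

Lemma Gamma_xb : Gamma P xb.
Proof. unfold Gamma. rewrite hgx. apply inQ_0. Qed.

Lemma fin_radius p (A : Fin.t p -> Vec n -> Prop) :
  (forall k, exists r, 0 < r /\ forall x, vnorm (vsub x xb) < r -> A k x) ->
  exists r, 0 < r /\ forall x, vnorm (vsub x xb) < r -> forall k, A k x.
Proof.
  induction p as [| p IH]; intros h.
  - exists 1. split; [lra |]. intros x _ k. inversion k.
  - destruct (h Fin.F1) as [r1 [h1 H1]].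
    destruct (IH (fun k => A (Fin.FS k)) (fun k => h (Fin.FS k))) as [r2 [h2 H2]].
    exists (Rmin r1 r2). split; [apply Rmin_glb_lt; assumption |]. intros x hx k.
    pose proof (Rmin_l r1 r2). pose proof (Rmin_r r1 r2).
    apply (Fin.caseS' k (fun k => A k x)); [apply H1; lra | intros j; apply H2; lra].
Qed.

Lemma regular_near : exists r, 0 < r /\ forall x, vnorm (vsub x xb) < r ->
  regular_at P sigma x /\ has_grad (pf P) x (pDf P x) /\ has_jac (pDf P) x (pD2f P x).
Proof.
  destruct hf as [r1 [p1 H1]]. destruct hg0 as [r2 [p2 H2]]. destruct hM as [r3 [p3 H3]].
  destruct (fin_radius m _ hgr) as [r4 [p4 H4]].
  exists (Rmin (Rmin r1 r2) (Rmin r3 r4)). split; [repeat apply Rmin_glb_lt; assumption |].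
  intros x hx.
  pose proof (Rmin_l (Rmin r1 r2) (Rmin r3 r4)). pose proof (Rmin_r (Rmin r1 r2) (Rmin r3 r4)).
  pose proof (Rmin_l r1 r2). pose proof (Rmin_r r1 r2). pose proof (Rmin_l r3 r4). pose proof (Rmin_r r3 r4).
  specialize (H1 x ltac:(lra)). specialize (H2 x ltac:(lra)). specialize (H3 x ltac:(lra)).
  specialize (H4 x ltac:(lra)).
  split; [split; [tauto | split] | tauto].
  - intros k. specialize (H4 k). tauto.
  - intros p eta hp he.
    destruct (distV_approx n x xb (Gamma P) eta Gamma_xb he) as [z [hz1 hz2]].
    exists z. split; [exact hz1 |]. pose proof (distY_le m (g P x) p inQ hp). nra.
Qed.

Lemma regular_xb : regular_at P sigma xb.
Proof.
  destruct regular_near as [r [hr H]]. apply H. rewrite vnorm_sub_self. exact hr.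
Qed.

Section Vector.
Context (x x' u : nat -> Vec n) (s : nat -> R) (ub : Vec n).
Hypothesis hu : vul u ub.
Hypothesis hs : ul s 0.
Hypothesis hs0 : ev (fun k => 0 < s k).
Hypothesis hx' : forall k, x' k = vadd (x k) (vscal (s k) (u k)).

Lemma g_forward : vul x xb ->
  yul (fun k => yscal (/ (s k * s k)) (ysub (ysub (g P (x' k)) (g P (x k))) (Jg P (x k) (vscal (s k) (u k)))))
    (yscal (1 / 2) (Hg P xb ub ub)).
Proof.
  intros hx. split; [exact (scalar_forward _ _ _ _ hg0 x x' u s ub hu hs hs0 hx' hx) |].
  intros k. exact (scalar_forward _ _ _ _ (hgr k) x x' u s ub hu hs hs0 hx' hx).
Qed.

Lemma g_backward : vul x xb ->
  yul (fun k => yscal (/ (s k * s k)) (ysub (Jg P (x' k) (vscal (s k) (u k))) (ysub (g P (x' k)) (g P (x k)))))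
    (yscal (1 / 2) (Hg P xb ub ub)).
Proof.
  intros hx. split; [exact (scalar_backward _ _ _ _ hg0 x x' u s ub hu hs hs0 hx' hx) |].
  intros k. exact (scalar_backward _ _ _ _ (hgr k) x x' u s ub hu hs hs0 hx' hx).
Qed.

Lemma g_base_second : (forall k, x k = xb) ->
  yul (fun k => ysub (yscal (/ (s k * s k)) (g P (x' k))) (Jg P xb (vscal (/ s k) (u k))))
    (yscal (1 / 2) (Hg P xb ub ub)).
Proof.
  intros hx. split; [exact (scalar_base_second _ _ _ _ hg0 x x' u s ub hu hs hs0 hx' hx pg0_0) |].
  intros k. exact (scalar_base_second _ _ _ _ (hgr k) x x' u s ub hu hs hs0 hx' hx (pgr_0 k)).
Qed.

Lemma g_base_first : (forall k, x k = xb) ->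
  yul (fun k => yscal (/ s k) (g P (x' k))) (Jg P xb ub).
Proof.
  intros hx. split; [exact (scalar_base_first _ _ _ _ hg0 x x' u s ub hu hs hs0 hx' hx pg0_0) |].
  intros k. exact (scalar_base_first _ _ _ _ (hgr k) x x' u s ub hu hs hs0 hx' hx (pgr_0 k)).
Qed.

(** Regrouping pairs [l] with the forward expansion of [g] and [l'] with the backward one. Each
    contributes half of a second derivative, so the mean appears although the two multipliers may
    have different limits. *)
Lemma two_point (l l' : nat -> Y m) (l1 l2 : Y m) :
  vul x xb -> yul l l1 -> yul l' l2 ->
  ul (fun k => / (s k * s k) *
       (dot (vsub (vadd (pDf P (x' k)) (JgT P (x' k) (l' k))) (vadd (pDf P (x k)) (JgT P (x k) (l k))))
            (vscal (s k) (u k))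
        - ydot (ysub (l' k) (l k)) (ysub (g P (x' k)) (g P (x k)))))
     (Aval P xb (yscal (1 / 2) (yadd l1 l2)) ub).
Proof.
  intros hx hl hl'.
  pose proof (scalar_grad _ _ _ _ hf x x' u s ub hu hs hs0 hx' hx) as e1.
  pose proof (ul_ydot m _ _ _ _ hl (g_forward hx)) as e2.
  pose proof (ul_ydot m _ _ _ _ hl' (g_backward hx)) as e3.
  rewrite Aval_eq.
  replace (quad (pD2f P xb) ub ub + ydot (yscal (1 / 2) (yadd l1 l2)) (Hg P xb ub ub))
    with (quad (pD2f P xb) ub ub + ydot l1 (yscal (1 / 2) (Hg P xb ub ub))
          + ydot l2 (yscal (1 / 2) (Hg P xb ub ub))) by (ydots; ring).
  refine (ul_ext_all _ _ _ _ (ul_plus _ _ _ _ (ul_plus _ _ _ _ e1 e2) e3)).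
  intros k. cbv beta. rewrite !dot_sub_l, !dot_add_l, !dot_JgT. unfold ydot. simpl.
  rewrite !dot_scal_r. dots. ring.
Qed.

Context (t : nat -> R) (v : nat -> Vec n) (vb : Vec n).
Hypothesis ht : ul t 0.
Hypothesis ht0 : ev (fun k => 0 < t k).
Hypothesis hv : vul v vb.
Hypothesis hx : forall k, x k = vadd xb (vscal (t k) (v k)).

Lemma g_mixed : ul (fun k => s k / t k) 0 ->
  yul (fun k => ysub (yscal (/ (s k * t k)) (ysub (g P (x' k)) (g P (x k)))) (Jg P xb (vscal (/ t k) (u k))))
    (Hg P xb vb ub).
Proof.
  intros hst. split; [exact (scalar_mixed _ _ _ _ hg0 x x' u s ub hu hs hs0 hx' t v vb ht ht0 hv hx hst) |].
  intros k. exact (scalar_mixed _ _ _ _ (hgr k) x x' u s ub hu hs hs0 hx' t v vb ht ht0 hv hx hst).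
Qed.

Lemma g_diff : ul (fun k => s k / (t k * t k)) 0 ->
  yul (fun k => yscal (/ (t k * t k)) (ysub (g P (x' k)) (g P (x k)))) yzero.
Proof.
  intros hst. split; [exact (scalar_diff _ _ _ _ hg0 x x' u s ub hu hs hs0 hx' t v vb ht ht0 hv hx hst) |].
  intros k. exact (scalar_diff _ _ _ _ (hgr k) x x' u s ub hu hs hs0 hx' t v vb ht ht0 hv hx hst).
Qed.
End Vector.

(** At [xb + t d] the constraint value differs from the cone element [t * Jg d] by [o(t)];
    subregularity with slack [t * t] then supplies a feasible point at distance [o(t)]. *)
Lemma tangent_of_linearized d : inQ (Jg P xb d) -> tangent (Gamma P) xb d.
Proof.
  intros hd.
  (* The ultrafilter only provides single good indices, whereas [tangent] asks for an ordinary
     sequence; so a tolerance [e] is fixed first and specialized to [/ (INR k + 1)] later. *)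
  assert (H : forall e, 0 < e -> exists tv : R * Vec n, 0 < fst tv < e /\
     vnorm (vsub (snd tv) d) < e /\ Gamma P (vadd xb (vscal (fst tv) (snd tv)))).
  { intros e he.
    pose (t := fun k => / (INR k + 1)).
    assert (ht0 : forall k, 0 < t k) by (intros k; apply Rinv_0_lt_compat; pose proof (pos_INR k); lra).
    assert (ht : ul t 0) by apply ul_invn.
    pose (x := fun k => vadd xb (vscal (t k) d)).
    pose proof (g_base_first (fun _ => xb) x (fun _ => d) t d (vul_const n d) ht (ev_all _ ht0)
      (fun k => eq_refl) (fun k => eq_refl)) as hg1.
    pose proof (ul_ynorm m _ _ (yul_sub m _ _ _ _ hg1 (yul_const m (Jg P xb d)))) as hn.
    pose proof (ul_plus _ _ _ _ (ul_scal sigma _ _ hn) ht) as hb.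
    replace (sigma * ynorm (ysub (Jg P xb d) (Jg P xb d)) + 0) with 0 in hb.
    2:{ replace (ynorm (ysub (Jg P xb d) (Jg P xb d))) with 0; [ring |]. unfold ynorm.
        rewrite <- sqrt_0. f_equal. ydots. ring. }
    destruct regular_near as [r [hr Hr]].
    assert (hxl : vul x xb) by exact (vul_line n _ _ _ _ _ (vul_const n xb) (vul_const n d) ht).
    assert (Hev : ev (fun k => vnorm (vsub (x k) xb) < r /\ t k < e /\
       sigma * ynorm (ysub (yscal (/ t k) (g P (x k))) (Jg P xb d)) + t k < e)).
    { apply (ev_mp _ _ (vul_ball n x xb r hxl hr)), (ev_mp _ _ (ht e he)).
      refine (ev_imp _ _ _ (hb e he)). intros k h1 h2 h3. rewrite Rminus_0_r in h1, h2.
      apply Rabs_def2 in h1, h2. split; [exact h3 | split; [apply h2 | apply h1]]. }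
    destruct (ev_ex _ Hev) as [k [h1 [h2 h3]]].
    specialize (ht0 k).
    destruct (Hr _ h1) as [[_ [_ Hreg]] _].
    destruct (Hreg (yscal (t k) (Jg P xb d)) (t k * t k)) as [z [hz1 hz2]].
    { apply inQ_scal; [lra | exact hd]. }
    { nra. }
    exists (t k, vscal (/ t k) (vsub z xb)). simpl. split; [split; assumption |]. split.
    - replace (vsub (vscal (/ t k) (vsub z xb)) d) with (vscal (/ t k) (vsub z (x k))).
      + rewrite vnorm_scal, Rabs_inv, Rabs_right by lra. rewrite vnorm_sub_sym.
        eapply Rle_lt_trans; [| exact h3].
        assert (Ey : ynorm (ysub (g P (x k)) (yscal (t k) (Jg P xb d)))
                     = t k * ynorm (ysub (yscal (/ t k) (g P (x k))) (Jg P xb d))).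
        { unfold ynorm. rewrite <- (sqrt_square (t k)) at 3 by lra. rewrite <- sqrt_mult_alt by nra.
          f_equal. ydots. field. lra. }
        rewrite Ey in hz2. apply Rmult_le_reg_l with (t k); [exact ht0 |].
        rewrite <- Rmult_assoc, Rinv_r, Rmult_1_l by lra. nra.
      + apply functional_extensionality. intros i. unfold x, vsub, vscal, vadd. field. lra.
    - replace (vadd xb (vscal (t k) (vscal (/ t k) (vsub z xb)))) with z; [exact hz1 |].
      apply functional_extensionality. intros i. unfold vsub, vscal, vadd. field. lra. }
  assert (H' : forall k : nat, exists tv : R * Vec n, 0 < fst tv < / (INR k + 1) /\
     vnorm (vsub (snd tv) d) < / (INR k + 1) /\ Gamma P (vadd xb (vscal (fst tv) (snd tv)))).
  { intros k. apply H, Rinv_0_lt_compat. pose proof (pos_INR k). lra. }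
  apply fun_choice in H'. destruct H' as [tv htv].
  assert (hN : forall e, 0 < e -> exists N, forall k, (N <= k)%nat -> / (INR k + 1) < e).
  { intros e he. destruct (archimed_cor1 e he) as [N [h1 h2]]. exists N. intros k hk.
    apply le_INR in hk. assert (0 < INR N) by (apply lt_0_INR, h2).
    apply Rle_lt_trans with (/ INR N); [| exact h1]. apply Rinv_le_contravar; lra. }
  exists (fun k => fst (tv k)), (fun k => snd (tv k)). split; [intros k; apply htv |]. split; [| split].
  - intros e he. destruct (hN e he) as [N HN]. exists N. intros k hk. specialize (HN k hk).
    destruct (htv k) as [[a b] _]. unfold Rdist. rewrite Rminus_0_r, Rabs_right; lra.
  - intros e he. destruct (hN e he) as [N HN]. exists N. intros k hk. specialize (HN k hk).
    destruct (htv k) as [_ [a _]]. lra.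
  - intros k. apply htv.
Qed.

(** Graph of the subdifferential of the problem with a multiplier attached. Subregularity allows
    unbounded multiplier sets; the norm bound from [multiplier_exists] makes the selected
    multipliers converge. *)
Definition KKT (x v : Vec n) (lam : Y m) : Prop :=
  Gamma P x /\ NQ (g P x) lam /\ v = vadd (pDf P x) (JgT P x lam) /\
  ynorm lam <= 4 * sigma * vnorm (vsub v (pDf P x)).

(** The norm bound is kept in the limit because it makes the limit multiplier vanish when [xs = 0],
    as [Lambda0] demands. *)
Lemma KKT_limit (x v : nat -> Vec n) (l : nat -> Y m) :
  vul x xb -> vul v vzero -> ev (fun k => KKT (x k) (v k) (l k)) ->
  exists lb, yul l lb /\ inQstar lb /\ JgT P xb lb = xs /\ ynorm lb <= 4 * sigma * vnorm xs.
Proof.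
  intros hx hv hK.
  pose proof (C2_grad_ul _ _ _ _ hf x hx) as hD.
  assert (E : vsub vzero (pDf P xb) = xs) by (unfold xs; vext; ring).
  pose proof (vul_sub n _ _ _ _ hv hD) as hvd. rewrite E in hvd.
  pose proof (ul_scal (4 * sigma) _ _ (ul_vnorm n _ _ hvd)) as hb.
  destruct (yul_exists m l (Rabs (4 * sigma * vnorm xs) + 1)) as [lb hlb].
  { apply (ev_mp _ _ hK). refine (ev_imp _ _ _ (ul_bound _ _ hb)). intros k hk [_ [_ [_ h]]].
    pose proof (Rle_abs (4 * sigma * vnorm (vsub (v k) (pDf P (x k))))). lra. }
  exists lb. split; [exact hlb |]. split; [| split].
  - apply (inQstar_closed m _ _ hlb). refine (ev_imp _ _ _ hK). intros k [_ [h _]].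
    apply NQ_iff in h. tauto.
  - refine (vul_unique n _ _ _ (JgT_vul P sigma xb x l lb regular_xb hx hlb) _).
    refine (vul_ext n _ _ _ _ hvd). refine (ev_imp _ _ _ hK). intros k [_ [_ [-> _]]].
    vext. ring.
  - refine (ul_le _ _ _ _ (ul_ynorm m _ _ hlb) hb _). refine (ev_imp _ _ _ hK). intros k h. apply h.
Qed.

Lemma vul_invn (x : nat -> Vec n) y : (forall k, vnorm (vsub (x k) y) < / (INR k + 1)) -> vul x y.
Proof.
  intros h. apply vul_norm0. apply ul_squeeze with (fun k => / (INR k + 1)); [| apply ul_invn].
  apply ev_all. intros k. rewrite Rminus_0_r, Rabs_right by (apply Rle_ge, vnorm_nonneg).
  left. apply h.
Qed.

Lemma vsub_vzero (x : Vec n) : vsub x vzero = x.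
Proof. vext. ring. Qed.

(** Along a sequence of failures, the second-order quotient of [f] plus that of the multiplier term
    would fall below [- (k + 1)]: the first-order terms cancel against [v], and the multiplier pairs
    nonpositively with the feasible [g P z]. But this quotient converges. *)
Lemma prox_regular : exists C r, 0 < C /\ 0 < r /\ forall x v lam z, KKT x v lam ->
  vnorm (vsub x xb) < r -> vnorm v < r -> vnorm (vsub z xb) < r -> Gamma P z ->
  pf P x + dot v (vsub z x) - C * dot (vsub z x) (vsub z x) <= pf P z.
Proof.
  match goal with |- ?G => destruct (classic G) as [H | H]; [exact H | exfalso] end.
  assert (Hs : forall k : nat, exists a : Vec n * Vec n * Y m * Vec n,
     let '(x, v, l, z) := a in KKT x v l /\ vnorm (vsub x xb) < / (INR k + 1) /\
     vnorm (vsub v vzero) < / (INR k + 1) /\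
     vnorm (vsub z xb) < / (INR k + 1) /\ Gamma P z /\
     pf P z < pf P x + dot v (vsub z x) - (INR k + 1) * dot (vsub z x) (vsub z x)).
  { intros k.
    match goal with |- ?G => destruct (classic G) as [H' | H']; [exact H' | exfalso] end.
    pose proof (pos_INR k). apply H. exists (INR k + 1), (/ (INR k + 1)). split; [lra |].
    split; [apply Rinv_0_lt_compat; lra |].
    intros x v lam z h1 h2 h3 h4 h5. apply Rnot_lt_le. intros h6. apply H'.
    exists (x, v, lam, z). rewrite vsub_vzero. tauto. }
  apply fun_choice in Hs. destruct Hs as [a ha].
  pose (x := fun k => fst (fst (fst (a k)))). pose (v := fun k => snd (fst (fst (a k)))).
  pose (l := fun k => snd (fst (a k))). pose (z := fun k => snd (a k)).
  assert (Ha : forall k, KKT (x k) (v k) (l k) /\ vnorm (vsub (x k) xb) < / (INR k + 1) /\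
     vnorm (vsub (v k) vzero) < / (INR k + 1) /\
     vnorm (vsub (z k) xb) < / (INR k + 1) /\ Gamma P (z k) /\
     pf P (z k) < pf P (x k) + dot (v k) (vsub (z k) (x k)) - (INR k + 1) * dot (vsub (z k) (x k)) (vsub (z k) (x k))).
  { intros k. specialize (ha k). unfold x, v, l, z. destruct (a k) as [[[? ?] ?] ?]. exact ha. }
  clear ha.
  assert (hx : vul x xb) by (apply vul_invn; intros k; apply Ha).
  assert (hz : vul z xb) by (apply vul_invn; intros k; apply Ha).
  assert (hv : vul v vzero) by (apply vul_invn; intros k; apply Ha).
  destruct (KKT_limit x v l hx hv (ev_all _ (fun k => proj1 (Ha k)))) as [lb [hl [_ [_ _]]]].
  pose (s := fun k => vnorm (vsub (z k) (x k))). pose (u := fun k => dir (vsub (z k) (x k))).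
  assert (hs0 : forall k, 0 < s k).
  { intros k. pose proof (vnorm_nonneg n (vsub (z k) (x k))). destruct (Req_dec (s k) 0) as [h0 | h0].
    - apply vnorm_sub_0 in h0. destruct (Ha k) as [_ [_ [_ [_ [_ h]]]]].
      rewrite h0, vsub_self, !dot_zero_r in h. lra.
    - unfold s in *. lra. }
  assert (hs : ul s 0).
  { rewrite <- (vnorm_sub_self n xb). apply ul_vnorm, vul_sub; assumption. }
  destruct (dir_limit n (fun k => vsub (z k) (x k)) (ev_all _ hs0)) as [ub [hu _]].
  assert (hzu : forall k, z k = vadd (x k) (vscal (s k) (u k))) by (intros k; apply dir_line).
  pose proof (scalar_forward _ _ _ _ hf x z u s ub hu hs (ev_all _ hs0) hzu hx) as e1.
  pose proof (ul_ydot m _ _ _ _ hl (g_forward x z u s ub hu hs (ev_all _ hs0) hzu hx)) as e2.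
  pose proof (ul_plus _ _ _ _ e1 e2) as e3.
  set (L := 1 / 2 * quad (pD2f P xb) ub ub + ydot lb (yscal (1 / 2) (Hg P xb ub ub))) in e3.
  destruct (INR_archimed 1 (1 - L) Rlt_0_1) as [N hN].
  assert (L <= L - 1); [| lra].
  apply (ul_le_c _ _ _ e3). refine (ev_imp _ _ _ (ev_ge N)). intros k hk. apply le_INR in hk.
  destruct (Ha k) as [[hG [hNQ [hvk _]]] [_ [_ [_ [hGz hviol]]]]].
  apply NQ_iff in hNQ. destruct hNQ as [_ [hlQ hlg]].
  pose proof (polar_le m _ _ hlQ hGz) as hpol.
  specialize (hs0 k).
  assert (hd : vsub (z k) (x k) = vscal (s k) (u k)) by apply dir_eq.
  assert (hdd : dot (vscal (s k) (u k)) (vscal (s k) (u k)) = s k * s k).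
  { rewrite <- hd. symmetry. apply vnorm_sq. }
  rewrite hd, hvk, dot_add_l, dot_JgT, hdd in hviol.
  apply Rmult_le_reg_l with (s k * s k); [nra |].
  rewrite Rmult_plus_distr_l, <- Rmult_assoc, Rinv_r, Rmult_1_l by nra.
  replace (s k * s k * ydot (l k) (yscal (/ (s k * s k)) (ysub (ysub (g P (z k)) (g P (x k))) (Jg P (x k) (vscal (s k) (u k))))))
    with (ydot (l k) (g P (z k)) - ydot (l k) (g P (x k)) - ydot (l k) (Jg P (x k) (vscal (s k) (u k)))).
  2:{ unfold ydot. cbn [fst snd ysub yscal]. dots. field. nra. }
  rewrite hlg. assert (hk1 : INR k + 1 >= 1 - L) by lra.
  assert (hss : 0 < s k * s k) by nra. nra.
Qed.

(** * Pointwise strong monotonicity of the solution graph *)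

Context (kappa : R).
Hypothesis hkappa : 0 < kappa.
Hypothesis hcrit : forall u, crit P xb (vopp (pDf P xb)) u -> Jg P xb u = yzero.
Hypothesis hA : forall u lam, crit P xb (vopp (pDf P xb)) u -> sphere u ->
  dirmult P xb (vopp (pDf P xb)) u lam -> / kappa < Aval P xb lam u.
Hypothesis hB : forall u lam v w, Zset P xb u lam v w ->
  (qZ P xb v w <> yzero ->
     ER_lt (ERfin (/ kappa))
           (ER_addr (Aval P xb lam u) (ER_divr (rho P xb u lam v) (fst (qZ P xb v w)))))
  /\ (rho P xb u lam v = ERfin 0 -> / kappa < Aval P xb lam u).

(** By closedness of the range [p = Jg w]. The vector [w] is tangent by [tangent_of_linearized] and
    orthogonal to [xs] by adjointness, hence critical, and the Jacobian kills critical directions.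
    Every blow-up is excluded in this way. *)
Lemma nondegenerate l p (z : nat -> Vec n) :
  yul (fun k => Jg P xb (z k)) p -> inQ p -> JgT P xb l = xs -> ydot l p = 0 -> p = yzero.
Proof.
  intros hz hp hl hlp. destruct (Jg_range_closed P xb z p hz) as [w <-].
  apply hcrit. split; [apply tangent_of_linearized, hp |].
  fold xs. rewrite <- hl, dot_JgT. exact hlp.
Qed.

(** The vectors [z k] themselves may diverge; closedness of the range replaces their limit by
    [w]. *)
Lemma affine_limit (q : nat -> Y m) (z : nat -> Vec n) qb eb :
  yul (fun k => ysub (q k) (Jg P xb (z k))) eb -> yul q qb -> exists w, qb = yadd (Jg P xb w) eb.
Proof.
  intros he hq.
  destruct (Jg_range_closed P xb z (ysub qb eb)) as [w hw].
  - refine (yul_ext m _ _ _ _ (yul_sub m _ _ _ _ hq he)). apply ev_all. intros k.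
    apply Y_ext; simpl; [ring | vext; ring].
  - exists w. rewrite hw. apply Y_ext; simpl; [ring | vext; ring].
Qed.

Lemma normalized_limit (q : nat -> Y m) (z : nat -> Vec n) (c : nat -> R) p eb :
  yul (fun k => ysub (q k) (Jg P xb (z k))) eb -> ul c 0 -> yul (fun k => yscal (c k) (q k)) p ->
  yul (fun k => Jg P xb (vscal (c k) (z k))) p.
Proof.
  intros he hc hp.
  pose proof (yul_sub m _ _ _ _ hp (yul_scal m _ _ _ _ hc he)) as h.
  replace (ysub p (yscal 0 eb)) with p in h by (apply Y_ext; simpl; [ring | vext; ring]).
  refine (yul_ext m _ _ _ _ h). apply ev_all. intros k. rewrite Jg_scal.
  apply Y_ext; simpl; [ring | vext; ring].
Qed.

Lemma scaled_values_converge (q l : nat -> Y m) (z : nat -> Vec n) eb lb :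
  yul (fun k => ysub (q k) (Jg P xb (z k))) eb -> ev (fun k => inQ (q k)) ->
  yul l lb -> JgT P xb lb = xs -> ev (fun k => ydot (l k) (q k) = 0) ->
  exists qb w, yul q qb /\ qb = yadd (Jg P xb w) eb /\ inQ qb /\ ydot lb qb = 0.
Proof.
  intros he hq hl hxs hlq.
  destruct (yul_bounded_or_normalized m q) as [[qb hqb] | [c [p [hc [hc0 [hp hpne]]]]]].
  - destruct (affine_limit q z qb eb he hqb) as [w hw]. exists qb, w.
    split; [exact hqb |]. split; [exact hw |]. split; [exact (inQ_closed m _ _ hqb hq) |].
    apply (ul_unique _ _ _ (ul_ydot m _ _ _ _ hl hqb)).
    refine (ul_ext _ _ _ _ (ul_const 0)). refine (ev_imp _ _ _ hlq). auto.
  - exfalso. apply hpne.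
    apply (nondegenerate lb p _ (normalized_limit q z c p eb he hc hp)).
    + apply (inQ_closed m _ _ hp). apply (ev_mp _ _ hc0). refine (ev_imp _ _ _ hq).
      intros k h1 h2. apply inQ_scal; [lra | exact h1].
    + exact hxs.
    + apply (ul_unique _ _ _ (ul_ydot m _ _ _ _ hl hp)).
      refine (ul_ext _ _ _ _ (ul_const 0)). refine (ev_imp _ _ _ hlq). intros k hk.
      replace (ydot (l k) (yscal (c k) (q k))) with (c k * ydot (l k) (q k)) by (ydots; ring).
      rewrite hk. ring.
Qed.

(** The competitor [z] keeps the infimum below [ERpinf], and [lor_psd] bounds it from below. *)
Lemma rho_bounds u lam v z : inQstar lam ->
  ydot lam (yadd (Jg P xb z) (Hg P xb v u)) = 0 ->
  exists r, rho P xb u lam v = ERfin r /\ 0 <= r <= - fst lam * lor (yadd (Jg P xb z) (Hg P xb v u)).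
Proof.
  intros hl hz. unfold rho.
  match goal with |- exists r, ER_inf ?S = _ /\ _ => destruct (ER_inf_spec S) as [h1 h2]; set (I := ER_inf S) in * end.
  assert (h3 : ER_le I (ERfin (- fst lam * lor (yadd (Jg P xb z) (Hg P xb v u))))).
  { apply h1. exists z. split; [exact hz |]. rewrite lor_vnorm. reflexivity. }
  assert (h4 : ER_le (ERfin 0) I).
  { apply h2. intros e [z' [hz' ->]]. rewrite lor_vnorm. simpl. apply lor_psd; assumption. }
  destruct I as [r | |]; simpl in h3, h4; [exists r; auto | destruct h3 | destruct h4].
Qed.

(** For a zero multiplier both the constraint and the objective vanish identically, so the second
    clause of (b) becomes available. *)
Lemma rho_zero u v : rho P xb u yzero v = ERfin 0.
Proof.
  destruct (rho_bounds u yzero v vzero) as [r [-> hr]].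
  - unfold inQstar; simpl. rewrite vnorm_vzero. lra.
  - ydots. ring.
  - simpl in hr. f_equal. lra.
Qed.

(** * Limits along a sequence of violating pairs *)

Section Sequences.
Context (x x' v v' : nat -> Vec n) (l l' : nat -> Y m).
Hypothesis hKK : forall k, KKT (x k) (v k) (l k).
Hypothesis hKK' : forall k, KKT (x' k) (v' k) (l' k).
Hypothesis hx : vul x xb.
Hypothesis hxx : vul x' xb.
Hypothesis hv : vul v vzero.
Hypothesis hv' : vul v' vzero.
Hypothesis hviol : forall k, dot (vsub (v' k) (v k)) (vsub (x' k) (x k)) <
  / kappa * dot (vsub (x' k) (x k)) (vsub (x' k) (x k)).

Let s := fun k => vnorm (vsub (x' k) (x k)).
Let u := fun k => dir (vsub (x' k) (x k)).
Let D1 := fun k => / (s k * s k) * - ydot (l k) (g P (x' k)).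
Let D2 := fun k => / (s k * s k) * - ydot (l' k) (g P (x k)).

Lemma step_pos k : 0 < s k.
Proof.
  pose proof (vnorm_nonneg n (vsub (x' k) (x k))). destruct (Req_dec (s k) 0) as [h0 | h0].
  - apply vnorm_sub_0 in h0. specialize (hviol k). rewrite h0, vsub_self, !dot_zero_r in hviol. lra.
  - unfold s in *. lra.
Qed.

Lemma step_ul : ul s 0.
Proof. rewrite <- (vnorm_sub_self n xb). apply ul_vnorm, vul_sub; assumption. Qed.

Lemma step_line k : x' k = vadd (x k) (vscal (s k) (u k)).
Proof. apply dir_line. Qed.

Lemma inv_step_sq_pos k : 0 < / (s k * s k).
Proof. pose proof (step_pos k). apply Rinv_0_lt_compat. nra. Qed.

Lemma D1_nonneg k : 0 <= D1 k.
Proof.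
  unfold D1. pose proof (inv_step_sq_pos k). destruct (hKK k) as [_ [hN _]]. apply NQ_iff in hN.
  destruct (hKK' k) as [hG _]. pose proof (polar_le m _ _ (proj1 (proj2 hN)) hG). nra.
Qed.

Lemma D2_nonneg k : 0 <= D2 k.
Proof.
  unfold D2. pose proof (inv_step_sq_pos k). destruct (hKK' k) as [_ [hN _]]. apply NQ_iff in hN.
  destruct (hKK k) as [hG _]. pose proof (polar_le m _ _ (proj1 (proj2 hN)) hG). nra.
Qed.

(** By complementarity the violation bounds the two-point quotient plus the nonnegative cross terms
    [D1] and [D2]. As the quotient converges, the cross terms are bounded and have limits. *)
Lemma two_point_limits ub l1 l2 : vul u ub -> yul l l1 -> yul l' l2 ->
  exists d1 d2, ul D1 d1 /\ ul D2 d2 /\ 0 <= d1 /\ 0 <= d2 /\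
    Aval P xb (yscal (1 / 2) (yadd l1 l2)) ub + d1 + d2 <= / kappa.
Proof.
  intros hu hl hl'.
  pose proof (two_point x x' u s ub hu step_ul (ev_all _ step_pos) step_line l l' l1 l2 hx hl hl') as hT.
  set (A := Aval P xb (yscal (1 / 2) (yadd l1 l2)) ub) in *.
  set (T := fun k => / (s k * s k) *
       (dot (vsub (vadd (pDf P (x' k)) (JgT P (x' k) (l' k))) (vadd (pDf P (x k)) (JgT P (x k) (l k))))
            (vscal (s k) (u k))
        - ydot (ysub (l' k) (l k)) (ysub (g P (x' k)) (g P (x k))))) in hT.
  assert (hTD : forall k, T k + D1 k + D2 k <= / kappa).
  { intros k. pose proof (inv_step_sq_pos k) as hi. pose proof (step_pos k) as hp.
    destruct (hKK k) as [_ [hN [hvk _]]]. destruct (hKK' k) as [_ [hN' [hvk' _]]].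
    apply NQ_iff in hN, hN'. specialize (hviol k).
    assert (hd : vsub (x' k) (x k) = vscal (s k) (u k)) by apply dir_eq.
    assert (hdd : dot (vsub (x' k) (x k)) (vsub (x' k) (x k)) = s k * s k) by (symmetry; apply vnorm_sq).
    rewrite hdd, hd, hvk, hvk' in hviol.
    unfold T, D1, D2.
    replace (ydot (ysub (l' k) (l k)) (ysub (g P (x' k)) (g P (x k))))
      with (- ydot (l k) (g P (x' k)) - ydot (l' k) (g P (x k))).
    2:{ destruct hN as [_ [_ e1]]. destruct hN' as [_ [_ e2]]. revert e1 e2. ydots. lra. }
    apply Rmult_le_reg_l with (s k * s k); [nra |].
    rewrite !Rmult_plus_distr_l, <- !Rmult_assoc, !Rinv_r by nra. lra. }
  assert (hbd : ev (fun k => D1 k <= / kappa + Rabs A + 1 /\ D2 k <= / kappa + Rabs A + 1)).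
  { refine (ev_imp _ _ _ (ul_bound _ _ hT)). intros k hk. specialize (hTD k).
    pose proof (D1_nonneg k). pose proof (D2_nonneg k). pose proof (Rle_abs (- T k)).
    rewrite Rabs_Ropp in *. lra. }
  destruct (ul_exists D1 (/ kappa + Rabs A + 1)) as [d1 hd1].
  { refine (ev_imp _ _ _ hbd). intros k hk. pose proof (D1_nonneg k). rewrite Rabs_right; lra. }
  destruct (ul_exists D2 (/ kappa + Rabs A + 1)) as [d2 hd2].
  { refine (ev_imp _ _ _ hbd). intros k hk. pose proof (D2_nonneg k). rewrite Rabs_right; lra. }
  exists d1, d2. split; [exact hd1 |]. split; [exact hd2 |]. split; [| split].
  - apply (ul_ge_c _ _ _ hd1), ev_all, D1_nonneg.
  - apply (ul_ge_c _ _ _ hd2), ev_all, D2_nonneg.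
  - apply (ul_le_c _ _ _ (ul_plus _ _ _ _ (ul_plus _ _ _ _ hT hd1) hd2)), ev_all, hTD.
Qed.

Lemma no_violation_at_base : ev (fun k => x k = xb) -> False.
Proof.
  intros hxe.
  destruct (KKT_limit x v l hx hv (ev_all _ hKK)) as [l1 [hl [hl1Q [hl1x _]]]].
  destruct (KKT_limit x' v' l' hxx hv' (ev_all _ hKK')) as [l2 [hl' [hl2Q [hl2x _]]]].
  destruct (dir_limit n (fun k => vsub (x' k) (x k)) (ev_all _ step_pos)) as [ub [hu hub]].
  change (vul u ub) in hu.
  destruct (two_point_limits ub l1 l2 hu hl hl') as [d1 [d2 [hd1 [_ [_ [hd2 hAd]]]]]].
  (* The expansions at [xb] require the line equation at every index, while [x'] lies on the line
     through [xb] only almost everywhere. *)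
  pose (y := fun k => vadd xb (vscal (s k) (u k))).
  assert (hy : ev (fun k => g P (y k) = g P (x' k))).
  { refine (ev_imp _ _ _ hxe). intros k hk. unfold y. rewrite <- hk, <- step_line. reflexivity. }
  pose proof (g_base_first (fun _ => xb) y u s ub hu step_ul (ev_all _ step_pos)
    (fun k => eq_refl) (fun k => eq_refl)) as g1.
  pose proof (g_base_second (fun _ => xb) y u s ub hu step_ul (ev_all _ step_pos)
    (fun k => eq_refl) (fun k => eq_refl)) as g2.
  assert (hlq : forall k, inQ (g P (x' k)) /\ ydot (l' k) (g P (x' k)) = 0).
  { intros k. destruct (hKK' k) as [hG [hN _]]. apply NQ_iff in hN. tauto. }
  assert (hcr : crit P xb xs ub).
  { assert (hQ : inQ (Jg P xb ub)).
    { apply (inQ_closed m _ _ g1). refine (ev_imp _ _ _ hy). intros k ->.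
      apply inQ_scal; [left; apply Rinv_0_lt_compat, step_pos | apply hlq]. }
    split; [apply tangent_of_linearized, hQ |].
    rewrite <- hl2x, dot_JgT. apply (ul_unique _ _ _ (ul_ydot m _ _ _ _ hl' g1)).
    refine (ul_ext _ _ _ _ (ul_const 0)). refine (ev_imp _ _ _ hy). intros k ->.
    replace (ydot (l' k) (yscal (/ s k) (g P (x' k)))) with (/ s k * ydot (l' k) (g P (x' k))) by (ydots; ring).
    rewrite (proj2 (hlq k)). ring. }
  pose (q := fun k => yscal (/ (s k * s k)) (g P (y k))).
  destruct (scaled_values_converge q l' (fun k => vscal (/ s k) (u k)) _ l2 g2) as [qb [w [hq [hqw [hqQ hlqb]]]]].
  - refine (ev_imp _ _ _ hy). intros k hk. unfold q. rewrite hk.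
    apply inQ_scal; [left; apply inv_step_sq_pos | apply hlq].
  - exact hl'.
  - exact hl2x.
  - refine (ev_imp _ _ _ hy). intros k hk. unfold q. rewrite hk.
    replace (ydot (l' k) (yscal (/ (s k * s k)) (g P (x' k))))
      with (/ (s k * s k) * ydot (l' k) (g P (x' k))) by (ydots; ring).
    rewrite (proj2 (hlq k)). ring.
  (* All multipliers have the same pairing with [Jg w]. Maximizing the second derivative over them
     thus means maximizing the pairing with [qb], which is nonpositive and vanishes at [l2]. *)
  - assert (hpair : forall mu, JgT P xb mu = xs ->
      ydot mu qb = dot xs w + 1 / 2 * ydot mu (Hg P xb ub ub)).
    { intros mu hmu. rewrite <- hmu, dot_JgT, hqw. unfold ydot. cbn [fst snd yadd yscal]. dots. ring. }
    assert (hd1e : d1 = - ydot l1 qb).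
    { apply (ul_unique D1 _ _ hd1).
      refine (ul_ext _ _ _ _ (ul_opp _ _ (ul_ydot m _ _ _ _ hl hq))).
      refine (ev_imp _ _ _ hy). intros k hk. unfold q, D1. rewrite hk. ydots. ring. }
    assert (hQbd : ~ inQbdnz (g P xb)) by (rewrite hgx; intros [_ h]; apply h; reflexivity).
    assert (hcurv : forall mu, quad (madd (HLag P xb mu) (Curv P xb mu)) ub ub = ydot mu (Hg P xb ub ub)).
    { intros mu. rewrite quad_madd, quad_HLag. unfold Curv.
      destruct (excluded_middle_informative (inQbdnz (g P xb))) as [h | h]; [destruct (hQbd h) |].
      rewrite quad_mzero. ring. }
    assert (hdm : dirmult P xb xs ub l2).
    { split.
      - split; [rewrite hgx; left; auto | exact hl2x].
      - intros mu [hmuN hmux]. rewrite !hcurv.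
        pose proof (hpair mu hmux) as e1. pose proof (hpair l2 hl2x) as e2.
        rewrite hgx in hmuN. apply NQ_iff in hmuN.
        pose proof (polar_le m mu qb (proj1 (proj2 hmuN)) hqQ). lra. }
    (* The limit [d1] is half the difference of the second derivatives at [l2] and [l1], so adding
       it to the value at the mean gives the value at [l2]. *)
    specialize (hA ub l2 hcr hub hdm).
    rewrite Aval_eq in hA, hAd.
    replace (ydot (yscal (1 / 2) (yadd l1 l2)) (Hg P xb ub ub))
      with (1 / 2 * ydot l1 (Hg P xb ub ub) + 1 / 2 * ydot l2 (Hg P xb ub ub)) in hAd
      by (unfold ydot; cbn [fst snd yadd yscal]; dots; ring).
    pose proof (hpair l1 hl1x). pose proof (hpair l2 hl2x). lra.
Qed.

Let t := fun k => vnorm (vsub (x k) xb).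
Let w := fun k => dir (vsub (x k) xb).

Lemma no_violation_off_base :
  ev (fun k => 0 < t k) -> ev (fun k => s k < t k * t k * t k) -> False.
Proof.
  intros ht0 hst.
  assert (ht : ul t 0) by (apply vul_norm_iff, hx).
  destruct (KKT_limit x v l hx hv (ev_all _ hKK)) as [l1 [hl [hl1Q [hl1x hl1n]]]].
  destruct (KKT_limit x' v' l' hxx hv' (ev_all _ hKK')) as [l2 [hl' [hl2Q [hl2x hl2n]]]].
  destruct (dir_limit n (fun k => vsub (x' k) (x k)) (ev_all _ step_pos)) as [ub [hu hub]].
  change (vul u ub) in hu.
  destruct (dir_limit n (fun k => vsub (x k) xb) ht0) as [vb [hw hvb]].
  change (vul w vb) in hw.
  assert (hxw : forall k, x k = vadd xb (vscal (t k) (w k))) by (intros k; apply dir_line).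
  destruct (two_point_limits ub l1 l2 hu hl hl') as [d1 [d2 [hd1 [hd2 [hd1p [hd2p hAd]]]]]].
  set (lam := yscal (1 / 2) (yadd l1 l2)) in *.
  assert (hst2 : ul (fun k => s k / (t k * t k)) 0).
  { apply ul_squeeze with t; [| exact ht]. apply (ev_mp _ _ ht0). refine (ev_imp _ _ _ hst). intros k h1 h2.
    pose proof (step_pos k). assert (0 < t k * t k) by nra.
    assert (0 < s k / (t k * t k)) by (apply Rdiv_lt_0_compat; assumption).
    rewrite Rminus_0_r, Rabs_right by lra. apply Rmult_le_reg_r with (t k * t k); [assumption |].
    unfold Rdiv. rewrite Rmult_assoc, Rinv_l by lra. lra. }
  assert (hst1 : ul (fun k => s k / t k) 0).
  { replace 0 with (0 * 0) by ring. refine (ul_ext _ _ _ _ (ul_mult _ _ _ _ ht hst2)).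
    refine (ev_imp _ _ _ ht0). intros k hk. field. lra. }
  assert (hN : forall k, inQ (g P (x k)) /\ NQ (g P (x k)) (l k) /\ ydot (l k) (g P (x k)) = 0).
  { intros k. destruct (hKK k) as [hG [hN _]]. split; [exact hG |]. split; [exact hN |].
    apply NQ_iff in hN. tauto. }
  assert (hN' : forall k, inQ (g P (x' k)) /\ NQ (g P (x' k)) (l' k) /\ ydot (l' k) (g P (x' k)) = 0).
  { intros k. destruct (hKK' k) as [hG [hN' _]]. split; [exact hG |]. split; [exact hN' |].
    apply NQ_iff in hN'. tauto. }
  pose proof (g_base_first (fun _ => xb) x w t vb hw ht ht0 hxw (fun k => eq_refl)) as g1.
  pose proof (g_base_second (fun _ => xb) x w t vb hw ht ht0 hxw (fun k => eq_refl)) as g2.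
  pose proof (g_mixed x x' u s ub hu step_ul (ev_all _ step_pos) step_line t w vb ht ht0 hw hxw hst1) as g3.
  pose proof (g_diff x x' u s ub hu step_ul (ev_all _ step_pos) step_line t w vb ht ht0 hw hxw hst2) as g4.
  assert (hJv : Jg P xb vb = yzero).
  { apply (nondegenerate l1 _ (fun _ => vb) (yul_const m _)).
    - apply (inQ_closed m _ _ g1). refine (ev_imp _ _ _ ht0). intros k hk.
      apply inQ_scal; [left; apply Rinv_0_lt_compat, hk | apply hN].
    - exact hl1x.
    - apply (ul_unique _ _ _ (ul_ydot m _ _ _ _ hl g1)).
      refine (ul_ext_all _ _ _ _ (ul_const 0)). intros k.
      replace (ydot (l k) (yscal (/ t k) (g P (x k)))) with (/ t k * ydot (l k) (g P (x k))) by (ydots; ring).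
      rewrite (proj2 (proj2 (hN k))). ring. }
  pose (q := fun k => yscal (/ (t k * t k)) (g P (x k))).
  assert (hit : ev (fun k => 0 < / (t k * t k))).
  { refine (ev_imp _ _ _ ht0). intros k hk. apply Rinv_0_lt_compat. nra. }
  destruct (scaled_values_converge q l (fun k => vscal (/ t k) (w k)) _ l1 g2) as [qb [wb [hq [hqw [hqQ hl1q]]]]].
  { refine (ev_imp _ _ _ hit). intros k hk. apply inQ_scal; [left; exact hk | apply hN]. }
  { exact hl. }
  { exact hl1x. }
  { apply ev_all. intros k. unfold q.
    replace (ydot (l k) (yscal (/ (t k * t k)) (g P (x k))))
      with (/ (t k * t k) * ydot (l k) (g P (x k))) by (ydots; ring).
    rewrite (proj2 (proj2 (hN k))). ring. }
  (* At scale [t^2] the two constraint values are indistinguishable, so both limit multipliers, and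
     with them the mean, annihilate the same [qb]. *)
  pose (q' := fun k => yscal (/ (t k * t k)) (g P (x' k))).
  assert (hq' : yul q' qb).
  { pose proof (yul_add m _ _ _ _ hq g4) as h.
    replace (yadd qb yzero) with qb in h by (apply Y_ext; simpl; [ring | vext; ring]).
    refine (yul_ext m _ _ _ _ h). apply ev_all. intros k. unfold q, q'.
    apply Y_ext; simpl; [ring | vext; ring]. }
  assert (hl2q : ydot l2 qb = 0).
  { apply (ul_unique _ _ _ (ul_ydot m _ _ _ _ hl' hq')).
    refine (ul_ext_all _ _ _ _ (ul_const 0)). intros k. unfold q'.
    replace (ydot (l' k) (yscal (/ (t k * t k)) (g P (x' k))))
      with (/ (t k * t k) * ydot (l' k) (g P (x' k))) by (ydots; ring).
    rewrite (proj2 (proj2 (hN' k))). ring. }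
  assert (hlamQ : inQstar lam).
  { unfold inQstar, lam in *. cbn [fst snd yadd yscal]. rewrite vnorm_scal, Rabs_right by lra.
    pose proof (vnorm_triang m (snd l1) (snd l2)). lra. }
  assert (hlamp : forall p, ydot lam p = 1 / 2 * (ydot l1 p + ydot l2 p)).
  { intros p. unfold lam, ydot. cbn [fst snd yadd yscal]. dots. ring. }
  assert (hlamx : JgT P xb lam = xs).
  { unfold lam. rewrite JgT_scal, JgT_add, hl1x, hl2x. vext. lra. }
  assert (hqZ : qZ P xb vb wb = qb) by (symmetry; exact hqw).
  assert (hNlam : NQ (qZ P xb vb wb) lam).
  { rewrite hqZ. apply NQ_iff. split; [exact hqQ |]. split; [exact hlamQ |].
    rewrite hlamp, hl1q, hl2q. ring. }
  assert (hLam0 : Lambda0 P xb xs lam).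
  { destruct (classic (xs = vzero)) as [h0 | h0].
    - left. split; [exact h0 |].
      rewrite h0, vnorm_vzero, Rmult_0_r in hl1n, hl2n.
      assert (e1 : l1 = yzero) by (apply ynorm_0; pose proof (ynorm_nonneg m l1); lra).
      assert (e2 : l2 = yzero) by (apply ynorm_0; pose proof (ynorm_nonneg m l2); lra).
      unfold lam. rewrite e1, e2. apply Y_ext; simpl; [ring | vext; ring].
    - right. split; [exact h0 |]. split; [rewrite hgx; left; auto | exact hlamx]. }
  (* The zero multiplier is treated apart, since the curvature inequalities below control [lor] only
     if [fst lam < 0]. *)
  destruct (classic (lam = yzero)) as [hl0 | hl0].
  { assert (hZ : Zset P xb ub lam vb wb).
    { split; [exact hub |]. split; [exact hLam0 |]. split; [exact hvb |].
      split; [rewrite hl0; ydots; ring |]. split; [rewrite hl0; simpl; ring |]. split; assumption. }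
    destruct (hB _ _ _ _ hZ) as [_ h2]. rewrite hl0 in h2 at 1. specialize (h2 (rho_zero ub vb)). lra. }
  assert (hlneg : fst lam < 0).
  { unfold inQstar in hlamQ. pose proof (vnorm_nonneg m (snd lam)).
    destruct (Req_dec (fst lam) 0) as [h0 | h0]; [| lra].
    destruct hl0. apply Y_ext; [exact h0 |]. apply vnorm_0. lra. }
  pose (p := fun k => yscal (/ (s k * t k)) (ysub (g P (x' k)) (g P (x k)))).
  (* The pairing equals [- (s k / t k) * D1 k], a null sequence times a convergent one. *)
  assert (hlp : ul (fun k => ydot (l k) (p k)) 0).
  { replace 0 with (0 * - d1) by ring. refine (ul_ext _ _ _ _ (ul_mult _ _ _ _ hst1 (ul_opp _ _ hd1))).
    refine (ev_imp _ _ _ ht0). intros k hk. pose proof (step_pos k). unfold p, D1.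
    replace (ydot (l k) (yscal (/ (s k * t k)) (ysub (g P (x' k)) (g P (x k)))))
      with (/ (s k * t k) * (ydot (l k) (g P (x' k)) - ydot (l k) (g P (x k)))) by (ydots; ring).
    rewrite (proj2 (proj2 (hN k))). field. lra. }
  assert (hlp' : ul (fun k => ydot (l' k) (p k)) 0).
  { replace 0 with (0 * d2) by ring. refine (ul_ext _ _ _ _ (ul_mult _ _ _ _ hst1 hd2)).
    refine (ev_imp _ _ _ ht0). intros k hk. pose proof (step_pos k). unfold p, D2.
    replace (ydot (l' k) (yscal (/ (s k * t k)) (ysub (g P (x' k)) (g P (x k)))))
      with (/ (s k * t k) * (ydot (l' k) (g P (x' k)) - ydot (l' k) (g P (x k)))) by (ydots; ring).
    rewrite (proj2 (proj2 (hN' k))). field. lra. }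
  (* [NQ_curvature] divided by [(s t)^2]: the weight [s^2] goes into [D1] and the weight [t^2] into
     [q]. *)
  assert (hcv : ev (fun k => - fst (l k) * lor (p k) / 2 <= D1 k * fst (q k))).
  { refine (ev_imp _ _ _ ht0). intros k hk. pose proof (step_pos k).
    pose proof (NQ_curvature m _ _ _ (proj1 (proj2 (hN k))) (proj1 (hN' k))) as h.
    unfold p, q, D1. rewrite lor_yscal. cbn [fst yscal].
    apply Rmult_le_compat_l with (r := / (s k * t k) * / (s k * t k)) in h.
    - replace (/ (s k * s k) * - ydot (l k) (g P (x' k)) * (/ (t k * t k) * fst (g P (x k))))
        with (/ (s k * t k) * / (s k * t k) * (- ydot (l k) (g P (x' k)) * fst (g P (x k)))) by (field; lra).
      lra.
    - assert (0 < / (s k * t k)) by (apply Rinv_0_lt_compat; nra). nra. }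
  assert (hcv' : ev (fun k => - fst (l' k) * lor (p k) / 2 <= D2 k * fst (q' k))).
  { refine (ev_imp _ _ _ ht0). intros k hk. pose proof (step_pos k).
    pose proof (NQ_curvature m _ _ _ (proj1 (proj2 (hN' k))) (proj1 (hN k))) as h.
    replace (lor (ysub (g P (x k)) (g P (x' k)))) with (lor (ysub (g P (x' k)) (g P (x k)))) in h
      by (unfold lor; ydots; ring).
    unfold p, q', D2. rewrite lor_yscal. cbn [fst yscal].
    apply Rmult_le_compat_l with (r := / (s k * t k) * / (s k * t k)) in h.
    - replace (/ (s k * s k) * - ydot (l' k) (g P (x k)) * (/ (t k * t k) * fst (g P (x' k))))
        with (/ (s k * t k) * / (s k * t k) * (- ydot (l' k) (g P (x k)) * fst (g P (x' k)))) by (field; lra).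
      lra.
    - assert (0 < / (s k * t k)) by (apply Rinv_0_lt_compat; nra). nra. }
  assert (hfst : forall a : Y m, - fst lam * lor a = - fst l1 * lor a / 2 + - fst l2 * lor a / 2).
  { intros a. unfold lam. cbn [fst yscal yadd]. field. }
  destruct (yul_bounded_or_normalized m p) as [[pb hp] | [c [ph [hc [hc0 [hp hpne]]]]]].
  2:{ pose proof (normalized_limit p _ c ph _ g3 hc hp) as hJ.
      assert (hl1p : ydot l1 ph = 0).
      { apply (ul_unique _ _ _ (ul_ydot m _ _ _ _ hl hp)).
        replace 0 with (0 * 0) by ring. refine (ul_ext_all _ _ _ _ (ul_mult _ _ _ _ hc hlp)).
        intros k. ydots. ring. }
      assert (hc2 : ul (fun k => c k * c k) 0).
      { replace 0 with (0 * 0) by ring. apply ul_mult; exact hc. }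
      (* After normalization the right-hand sides of the curvature inequalities carry a factor
         [c k * c k] and vanish. Hence [ph] or its opposite lies in the cone, and [nondegenerate]
         excludes both. *)
      assert (hlor : lor ph <= 0).
      { assert (h1 : - fst l1 * lor ph / 2 <= 0 * (d1 * fst qb)).
        { refine (ul_le (fun k => - fst (l k) * lor (yscal (c k) (p k)) / 2)
            (fun k => c k * c k * (D1 k * fst (q k))) _ _ _ _ _).
          - apply ul_mult; [apply ul_mult; [apply ul_opp, hl | apply ul_lor, hp] | apply ul_const].
          - apply ul_mult; [exact hc2 | apply ul_mult; [exact hd1 | apply hq]].
          - refine (ev_imp _ _ _ hcv). intros k hk. rewrite lor_yscal.
            assert (0 <= c k * c k) by nra. nra. }
        assert (h2 : - fst l2 * lor ph / 2 <= 0 * (d2 * fst qb)).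
        { refine (ul_le (fun k => - fst (l' k) * lor (yscal (c k) (p k)) / 2)
            (fun k => c k * c k * (D2 k * fst (q' k))) _ _ _ _ _).
          - apply ul_mult; [apply ul_mult; [apply ul_opp, hl' | apply ul_lor, hp] | apply ul_const].
          - apply ul_mult; [exact hc2 | apply ul_mult; [exact hd2 | apply hq']].
          - refine (ev_imp _ _ _ hcv'). intros k hk. rewrite lor_yscal.
            assert (0 <= c k * c k) by nra. nra. }
        specialize (hfst ph). nra. }
      apply hpne. destruct (lor_npos_cases m ph hlor) as [h | h].
      - exact (nondegenerate l1 ph _ hJ h hl1x hl1p).
      - assert (E : yscal (-1) ph = yzero).
        { apply (nondegenerate l1 _ (fun k => vscal (-1) (vscal (c k) (vscal (/ t k) (u k))))).
          - pose proof (yul_scal m _ _ _ _ (ul_const (-1)) hJ) as hJ'.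
            refine (yul_ext m _ _ _ _ hJ'). apply ev_all. intros k. symmetry. apply Jg_scal.
          - exact h.
          - exact hl1x.
          - replace (ydot l1 (yscal (-1) ph)) with (- ydot l1 ph) by (ydots; ring). lra. }
        apply ydot_self_0. pose proof (f_equal (fun a => ydot a a) E) as E2. revert E2. ydots. lra. }
  destruct (affine_limit p _ pb _ g3 hp) as [z hz].
  assert (hlampb : ydot lam pb = 0).
  { rewrite hlamp, (ul_unique _ _ _ (ul_ydot m _ _ _ _ hl hp) hlp), (ul_unique _ _ _ (ul_ydot m _ _ _ _ hl' hp) hlp').
    ring. }
  (* Since [p] and [p - Jg (u / t)] both converge, [Jg (u / t)] does too, and [t] times it tends to
     zero. *)
  assert (hJu : Jg P xb ub = yzero).
  { apply (yul_unique m (fun k => Jg P xb (u k))).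
    - exact (Jg_yul P sigma xb (fun _ => xb) u ub regular_xb (vul_const n xb) hu).
    - pose proof (yul_scal m _ _ _ _ ht (yul_sub m _ _ _ _ hp g3)) as h.
      match type of h with yul _ (yscal 0 ?a) => replace (yscal 0 a) with (@yzero m) in h
        by (apply Y_ext; simpl; [ring | vext; ring]) end.
      refine (yul_ext m _ _ _ _ h). refine (ev_imp _ _ _ ht0). intros k hk. rewrite Jg_scal.
      fold (p k). generalize (p k) (Jg P xb (u k)). intros a b.
      apply Y_ext; simpl; [field; lra |].
      apply functional_extensionality. intros i. unfold vscal, vsub. field. lra. }
  assert (hZ : Zset P xb ub lam vb wb).
  { split; [exact hub |]. split; [exact hLam0 |]. split; [exact hvb |].
    rewrite hJu. split; [ydots; ring |]. split; [simpl; rewrite vnorm_vzero; ring |]. split; assumption. }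
  (* The two limiting curvature inequalities add up to one for the mean multiplier. As [pb] is an
     admissible value in the definition of [rho], this gives [rho <= (d1 + d2) * fst qb]. *)
  assert (hcurv : - fst lam * lor pb <= (d1 + d2) * fst qb).
  { assert (h1 : - fst l1 * lor pb / 2 <= d1 * fst qb).
    { refine (ul_le _ _ _ _ _ _ hcv).
      - apply ul_mult; [apply ul_mult; [apply ul_opp, hl | apply ul_lor, hp] | apply ul_const].
      - apply ul_mult; [exact hd1 | apply hq]. }
    assert (h2 : - fst l2 * lor pb / 2 <= d2 * fst qb).
    { refine (ul_le _ _ _ _ _ _ hcv').
      - apply ul_mult; [apply ul_mult; [apply ul_opp, hl' | apply ul_lor, hp] | apply ul_const].
      - apply ul_mult; [exact hd2 | apply hq']. }
    rewrite hfst. lra. }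
  destruct (rho_bounds ub lam vb z hlamQ) as [r [hr [hr0 hr1]]].
  { rewrite <- hz. exact hlampb. }
  rewrite <- hz in hr1.
  destruct (hB _ _ _ _ hZ) as [hB1 hB2]. rewrite hr in hB1, hB2. rewrite hqZ in hB1.
  assert (hq0 : 0 <= fst qb) by (apply inQ_iff in hqQ; tauto).
  destruct (classic (qb = yzero)) as [hqb0 | hqb0].
  - rewrite hqb0 in hcurv. cbn [fst yzero] in hcurv.
    assert (r = 0) by lra. subst r. specialize (hB2 eq_refl). lra.
  - specialize (hB1 hqb0). destruct hB1 as [hle hne]. simpl in hle, hne.
    assert (hqp : 0 < fst qb).
    { destruct (Req_dec (fst qb) 0) as [h0 | h0]; [| lra]. destruct hqb0.
      unfold inQ in hqQ. pose proof (vnorm_nonneg m (snd qb)).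
      apply Y_ext; [exact h0 |]. apply vnorm_0. lra. }
    assert (hrq : r / fst qb <= d1 + d2).
    { apply Rmult_le_reg_r with (fst qb); [exact hqp |]. unfold Rdiv.
      rewrite Rmult_assoc, Rinv_l by lra. lra. }
    apply hne. f_equal. lra.
Qed.
End Sequences.

(* Off [xb] the neighbours are taken within the cube of the distance to [xb], so that
   first differences become negligible against the second-order scaling at [xb]. *)
Lemma pointwise_strong_monotone : exists r, 0 < r /\ forall x v lam, KKT x v lam ->
  vnorm (vsub x xb) < r -> vnorm v < r ->
  exists eta, 0 < eta /\ forall x' v' lam', KKT x' v' lam' ->
    vnorm (vsub x' x) < eta -> vnorm (vsub v' v) < eta ->
    / kappa * dot (vsub x' x) (vsub x' x) <= dot (vsub v' v) (vsub x' x).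
Proof.
  match goal with |- ?G => destruct (classic G) as [H | H]; [exact H | exfalso] end.
  assert (Hs : forall k : nat, exists a : (Vec n * Vec n * Y m) * (Vec n * Vec n * Y m),
     let '((x, v, l), (x', v', l')) := a in KKT x v l /\ KKT x' v' l' /\
     vnorm (vsub x xb) < / (INR k + 1) /\ vnorm (vsub v vzero) < / (INR k + 1) /\
     vnorm (vsub x' x) < / (INR k + 1) /\ vnorm (vsub v' v) < / (INR k + 1) /\
     (0 < vnorm (vsub x xb) ->
       vnorm (vsub x' x) < vnorm (vsub x xb) * vnorm (vsub x xb) * vnorm (vsub x xb)) /\
     dot (vsub v' v) (vsub x' x) < / kappa * dot (vsub x' x) (vsub x' x)).
  { intros k.
    match goal with |- ?G => destruct (classic G) as [H' | H']; [exact H' | exfalso] end.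
    assert (hk : 0 < / (INR k + 1)) by (apply Rinv_0_lt_compat; pose proof (pos_INR k); lra).
    apply H. exists (/ (INR k + 1)). split; [exact hk |].
    intros x v lam h1 h2 h3. set (t := vnorm (vsub x xb)) in *.
    assert (heta : exists eta, 0 < eta /\ eta <= / (INR k + 1) /\ (0 < t -> eta <= t * t * t)).
    { destruct (Rlt_dec 0 t) as [ht | ht].
      - exists (Rmin (/ (INR k + 1)) (t * t * t)).
        split; [apply Rmin_glb_lt; [exact hk | repeat apply Rmult_lt_0_compat; exact ht] |].
        split; [apply Rmin_l | intros _; apply Rmin_r].
      - exists (/ (INR k + 1)). split; [exact hk |]. split; [lra | intros h; lra]. }
    destruct heta as [eta [he1 [he2 he3]]]. exists eta. split; [exact he1 |].
    intros x' v' lam' h4 h5 h6. apply Rnot_lt_le. intros h7. apply H'.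
    exists ((x, v, lam), (x', v', lam')). rewrite vsub_vzero. fold t.
    repeat split; try tauto; try apply h1; try apply h4; try lra. }
  apply fun_choice in Hs. destruct Hs as [a ha].
  pose (x := fun k => fst (fst (fst (a k)))). pose (v := fun k => snd (fst (fst (a k)))).
  pose (l := fun k => snd (fst (a k))).
  pose (x' := fun k => fst (fst (snd (a k)))). pose (v' := fun k => snd (fst (snd (a k)))).
  pose (l' := fun k => snd (snd (a k))).
  assert (Ha : forall k, KKT (x k) (v k) (l k) /\ KKT (x' k) (v' k) (l' k) /\
     vnorm (vsub (x k) xb) < / (INR k + 1) /\ vnorm (vsub (v k) vzero) < / (INR k + 1) /\
     vnorm (vsub (x' k) (x k)) < / (INR k + 1) /\ vnorm (vsub (v' k) (v k)) < / (INR k + 1) /\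
     (0 < vnorm (vsub (x k) xb) -> vnorm (vsub (x' k) (x k)) <
        vnorm (vsub (x k) xb) * vnorm (vsub (x k) xb) * vnorm (vsub (x k) xb)) /\
     dot (vsub (v' k) (v k)) (vsub (x' k) (x k)) < / kappa * dot (vsub (x' k) (x k)) (vsub (x' k) (x k))).
  { intros k. specialize (ha k). unfold x, v, l, x', v', l'.
    destruct (a k) as [[[? ?] ?] [[? ?] ?]]. exact ha. }
  clear ha.
  assert (hnear : forall (y y' : nat -> Vec n) yb, vul y yb ->
    (forall k, vnorm (vsub (y' k) (y k)) < / (INR k + 1)) -> vul y' yb).
  { intros y y' yb hy h.
    assert (hd : vul (fun k => vsub (y' k) (y k)) vzero).
    { apply vul_invn. intros k. rewrite vsub_vzero. apply h. }
    pose proof (vul_add n _ _ _ _ hy hd) as h2.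
    replace (vadd yb vzero) with yb in h2 by (vext; ring).
    refine (vul_ext n _ _ _ _ h2). apply ev_all. intros k. vext. ring. }
  assert (hx : vul x xb) by (apply vul_invn; intros k; apply Ha).
  assert (hv : vul v vzero) by (apply vul_invn; intros k; apply Ha).
  assert (hx' : vul x' xb) by (apply (hnear x); [exact hx | intros k; apply Ha]).
  assert (hv' : vul v' vzero) by (apply (hnear v); [exact hv | intros k; apply Ha]).
  destruct (ev_em (fun k => x k = xb)) as [h | h].
  - apply (no_violation_at_base x x' v v' l l'); try assumption; intros k; apply Ha.
  - assert (ht : ev (fun k => 0 < vnorm (vsub (x k) xb))).
    { refine (ev_imp _ _ _ h). intros k hk. pose proof (vnorm_nonneg n (vsub (x k) xb)).
      destruct (Req_dec (vnorm (vsub (x k) xb)) 0) as [h0 | h0]; [| lra].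
      destruct hk. apply vnorm_sub_0, h0. }
    apply (no_violation_off_base x x' v v' l l'); try assumption; try (intros k; apply Ha).
    refine (ev_imp _ _ _ ht). intros k hk. apply Ha, hk.
Qed.

(** * Existence of multipliers for local minimizers *)

Lemma multiplier_quadratic (h : Vec n -> R) Dh A c b x r :
  0 < r -> (forall z, vnorm (vsub z x) <= r -> regular_at P sigma z /\ has_grad h z (Dh z)) ->
  (forall z, vul z x -> vul (fun k => Dh (z k)) (Dh x)) -> Gamma P x ->
  (forall z, vnorm (vsub z x) <= r -> Gamma P z ->
     h x + A * dot (vsub x c) (vsub x c) - dot b x <= h z + A * dot (vsub z c) (vsub z c) - dot b z) ->
  exists lam, NQ (g P x) lam /\
    vsub b (vscal (2 * A) (vsub x c)) = vadd (Dh x) (JgT P x lam) /\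
    ynorm lam <= 4 * sigma * vnorm (vsub (vsub b (vscal (2 * A) (vsub x c))) (Dh x)).
Proof.
  intros hr hreg hcont hG hmin.
  destruct (multiplier_exists P sigma hsigma (fun z => h z + A * dot (vsub z c) (vsub z c) - dot b z)
    (fun z => vsub (vadd (Dh z) (vscal (2 * A) (vsub z c))) b) x r hr) as [lam [h1 [h2 h3]]].
  - intros z hz. destruct (hreg z hz) as [a1 a2]. split; [exact a1 | apply has_grad_quadratic, a2].
  - intros z hz. apply vul_sub; [| apply vul_const]. apply vul_add; [apply hcont, hz |].
    apply vul_scal; [apply ul_const |]. apply vul_sub; [exact hz | apply vul_const].
  - exact hG.
  - exact hmin.
  - exists lam. split; [exact h1 |]. split.
    + apply functional_extensionality. intros i. apply (f_equal (fun a => a i)) in h2. revert h2.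
      unfold vadd, vsub, vscal, vzero. lra.
    + replace (vsub (vsub b (vscal (2 * A) (vsub x c))) (Dh x))
        with (vopp (vsub (vadd (Dh x) (vscal (2 * A) (vsub x c))) b)) by (vext; ring).
      rewrite vnorm_opp. exact h3.
Qed.

Lemma min_on_ball (F : Vec n -> R) c r y0 :
  (forall z, vnorm (vsub z c) <= r -> regular_at P sigma z /\ exists D, has_grad F z D) ->
  vnorm (vsub y0 c) <= r -> Gamma P y0 ->
  exists x, (vnorm (vsub x c) <= r /\ Gamma P x) /\
    forall y, vnorm (vsub y c) <= r /\ Gamma P y -> F x <= F y.
Proof.
  intros hreg h0 hG0.
  apply (min_exists n (fun z => vnorm (vsub z c) <= r /\ Gamma P z) F y0 (vnorm c + r)).
  - split; assumption.
  - intros z [hz _]. pose proof (vnorm_le_add n z c). lra.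
  - intros z zb hz hzb.
    assert (hb : vnorm (vsub zb c) <= r).
    { apply (ul_le_c _ _ _ (ul_vnorm n _ _ (vul_sub n _ _ _ _ hzb (vul_const n c)))).
      apply ev_all, hz. }
    destruct (hreg zb hb) as [a1 [D a2]]. split; [split; [exact hb |] |].
    + apply (inQ_closed m _ _ (g_yul P sigma zb z a1 hzb)). apply ev_all. intros k. apply hz.
    + intros e he. exact (ul_le_c _ _ _ (has_grad_ul n _ _ _ _ a2 hzb) he).
Qed.

(* A regular normal is approximated by the gradient condition at the minimizer of
   [- <xs, z> + A |z - x|^2], which lies within [eps / A] of [x]. *)
Lemma frechet_multiplier x ys eps r :
  frechet_normal (Gamma P) x ys -> 0 < eps -> 0 < r ->
  (forall z, vnorm (vsub z x) <= r -> regular_at P sigma z) ->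
  exists (z e : Vec n) lam, vnorm (vsub z x) <= eps /\ vnorm e <= 2 * eps /\ Gamma P z /\ NQ (g P z) lam /\
    vsub ys e = JgT P z lam /\ ynorm lam <= 4 * sigma * vnorm (vsub ys e).
Proof.
  intros [hG hF] he hr hreg. destruct (hF eps he) as [d [hd H]].
  pose (q := Rmin (Rmin (d / 2) eps) r).
  assert (hq : 0 < q /\ q < d /\ q <= eps /\ q <= r).
  { unfold q. pose proof (Rmin_l (Rmin (d / 2) eps) r). pose proof (Rmin_r (Rmin (d / 2) eps) r).
    pose proof (Rmin_l (d / 2) eps). pose proof (Rmin_r (d / 2) eps).
    repeat split; try lra. repeat apply Rmin_glb_lt; lra. }
  destruct hq as [hq0 [hq1 [hq2 hq3]]].
  (* With this [A], the estimate [A * |z - x| <= eps] places the minimizer within [q / 2] of [x], so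
     the ball constraint is inactive. *)
  pose (A := 2 * eps / q).
  assert (hA0 : 0 < A) by (apply Rdiv_lt_0_compat; lra).
  destruct (min_on_ball (fun z => 0 + A * dot (vsub z x) (vsub z x) - dot ys z) x q x) as [z [[hz1 hz2] hz3]].
  { intros z hz. split; [apply hreg; lra |].
    exists (vsub (vadd vzero (vscal (2 * A) (vsub z x))) ys). apply has_grad_quadratic, has_grad_zero. }
  { rewrite vnorm_sub_self. lra. }
  { exact hG. }
  pose proof (vnorm_nonneg n (vsub z x)) as hn.
  assert (hzn : A * vnorm (vsub z x) <= eps).
  { assert (h1 := hz3 x). rewrite vnorm_sub_self, vsub_self, dot_zero_l in h1.
    specialize (h1 (conj (Rlt_le _ _ hq0) hG)).
    specialize (H z hz2 ltac:(lra)). rewrite dot_sub_r in H. rewrite <- vnorm_sq in h1.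
    destruct (Req_dec (vnorm (vsub z x)) 0) as [h0 | h0]; [rewrite h0; lra |].
    apply Rmult_le_reg_r with (vnorm (vsub z x)); [lra |]. nra. }
  assert (hz4 : vnorm (vsub z x) <= q / 2).
  { apply Rmult_le_reg_l with A; [exact hA0 |].
    replace (A * (q / 2)) with eps by (unfold A; field; lra). exact hzn. }
  destruct (multiplier_quadratic (fun _ => 0) (fun _ => vzero) A x ys z (q / 2)) as [lam [h1 [h2 h3]]].
  - lra.
  - intros y hy. pose proof (vnorm_sub_triang n y z x). split; [apply hreg; lra | apply has_grad_zero].
  - intros y _. apply vul_const.
  - exact hz2.
  - intros y hy hGy. apply hz3. split; [| exact hGy]. pose proof (vnorm_sub_triang n y z x). lra.
  - exists z, (vscal (2 * A) (vsub z x)), lam. split; [lra |]. split.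
    { rewrite vnorm_scal, Rabs_right by lra. lra. }
    split; [exact hz2 |]. split; [exact h1 |]. rewrite vsub_vzero in h3. split; [| exact h3].
    rewrite h2. vext. ring.
Qed.

(** A limiting normal is approached by regular normals at nearby points. Each has a multiplier of
    bounded norm up to a small error; the error enters [v], which still tends to zero, and
    [KKT_limit] returns to [xb]. *)
Lemma stationary_KKT : stationary P xb -> exists lam, KKT xb vzero lam.
Proof.
  intros [_ [xk [yk [hF [hxk hyk]]]]]. apply vconv_vul in hxk, hyk.
  destruct regular_near as [r [hr Hr]].
  assert (hev : ev (fun k => exists a : Vec n * Vec n * Y m, let '(z, e, lam) := a in
     vnorm (vsub z (xk k)) <= / (INR k + 1) /\ vnorm e <= 2 * / (INR k + 1) /\ Gamma P z /\ NQ (g P z) lam /\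
     vsub (yk k) e = JgT P z lam /\ ynorm lam <= 4 * sigma * vnorm (vsub (yk k) e))).
  { refine (ev_imp _ _ _ (vul_ball n xk xb (r / 2) hxk ltac:(lra))). intros k hk.
    destruct (frechet_multiplier (xk k) (yk k) (/ (INR k + 1)) (r / 4) (hF k)) as [z [e [lam h]]].
    - apply Rinv_0_lt_compat. pose proof (pos_INR k). lra.
    - lra.
    - intros z hz. apply Hr. pose proof (vnorm_sub_triang n z (xk k) xb). lra.
    - exists (z, e, lam). exact h. }
  apply (ev_choice _ (vzero, vzero, yzero)) in hev. destruct hev as [a ha].
  pose (z := fun k => fst (fst (a k))). pose (e := fun k => snd (fst (a k))). pose (l := fun k => snd (a k)).
  assert (Ha : ev (fun k => vnorm (vsub (z k) (xk k)) <= / (INR k + 1) /\ vnorm (e k) <= 2 * / (INR k + 1) /\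
     Gamma P (z k) /\ NQ (g P (z k)) (l k) /\
     vsub (yk k) (e k) = JgT P (z k) (l k) /\ ynorm (l k) <= 4 * sigma * vnorm (vsub (yk k) (e k)))).
  { refine (ev_imp _ _ _ ha). intros k. unfold z, e, l. destruct (a k) as [[? ?] ?]. auto. }
  clear ha.
  assert (hsm : forall (y : nat -> Vec n), ev (fun k => vnorm (y k) <= 2 * / (INR k + 1)) -> vul y vzero).
  { intros y hy. apply vul_norm0. apply ul_squeeze with (fun k => 2 * / (INR k + 1)).
    - refine (ev_imp _ _ _ hy). intros k hk.
      rewrite Rminus_0_r, vsub_vzero, Rabs_right by (apply Rle_ge, vnorm_nonneg). exact hk.
    - replace 0 with (2 * 0) by ring. apply ul_scal, ul_invn. }
  assert (he : vul e vzero) by (apply hsm; refine (ev_imp _ _ _ Ha); tauto).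
  assert (hz : vul z xb).
  { assert (hd : vul (fun k => vsub (z k) (xk k)) vzero).
    { apply hsm. refine (ev_imp _ _ _ Ha). intros k [h _].
      pose proof (vnorm_nonneg n (vsub (z k) (xk k))). lra. }
    pose proof (vul_add n _ _ _ _ hxk hd) as h.
    replace (vadd xb vzero) with xb in h by (vext; ring).
    refine (vul_ext n _ _ _ _ h). apply ev_all. intros k. vext. ring. }
  pose (v := fun k => vadd (pDf P (z k)) (vsub (yk k) (e k))).
  assert (hv : vul v vzero).
  { pose proof (vul_add n _ _ _ _ (C2_grad_ul _ _ _ _ hf z hz) (vul_sub n _ _ _ _ hyk he)) as h.
    replace (vadd (pDf P xb) (vsub (vopp (pDf P xb)) vzero)) with (@vzero n) in h by (vext; ring). exact h. }
  destruct (KKT_limit z v l hz hv) as [lb [_ [h1 [h2 h3]]]].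
  - refine (ev_imp _ _ _ Ha). intros k [_ [_ [a3 [a4 [a5 a6]]]]]. split; [exact a3 |]. split; [exact a4 |].
    unfold v. split; [rewrite a5; reflexivity |].
    replace (vsub (vadd (pDf P (z k)) (vsub (yk k) (e k))) (pDf P (z k))) with (vsub (yk k) (e k))
      by (vext; ring). exact a6.
  - exists lb. split; [exact Gamma_xb |]. split; [rewrite hgx; left; auto |]. split.
    + rewrite h2. unfold xs. vext. ring.
    + replace (vsub vzero (pDf P xb)) with xs by (unfold xs; vext; ring). exact h3.
Qed.

(** * From pointwise to uniform estimates *)

Hypothesis hstat : stationary P xb.

Lemma tilt_stable_of_conditions : tilt_stable P xb kappa.
Proof.
  destruct (stationary_KKT hstat) as [lam0 hK0].
  destruct regular_near as [r0 [hr0 Hr0]].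
  destruct prox_regular as [C0 [r1 [hC0 [hr1 Hpr]]]].
  destruct pointwise_strong_monotone as [r2 [hr2 Hsm]].
  (* The surplus 1 over the prox-regularity constant yields [|x - xb| <= |y|] in [Tnear] and the
     monotonicity constant 2 in [Tmono]. *)
  pose (C := C0 + 1).
  pose (gm := Rmin r0 (Rmin r1 r2) / 2).
  assert (hgm : 0 < gm /\ gm < r0 /\ gm < r1 /\ gm < r2).
  { pose proof (Rmin_l r0 (Rmin r1 r2)). pose proof (Rmin_r r0 (Rmin r1 r2)).
    pose proof (Rmin_l r1 r2). pose proof (Rmin_r r1 r2).
    assert (0 < Rmin r0 (Rmin r1 r2)) by (repeat apply Rmin_glb_lt; assumption). unfold gm. lra. }
  destruct hgm as [hg [hgr0 [hgr1 hgr2]]].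
  pose (F := fun y z => pf P z + C * dot (vsub z xb) (vsub z xb) - dot y z).
  pose (T := fun y x => (vnorm (vsub x xb) <= gm /\ Gamma P x) /\
     forall z, vnorm (vsub z xb) <= gm /\ Gamma P z -> F y x <= F y z).
  (* Chosen so that [|y| < de] gives [|V y x| <= (1 + 2 C) |y| < gm]. *)
  pose (de := gm / (1 + 2 * C)).
  assert (hC : 1 < C) by (unfold C; lra).
  assert (hde : 0 < de) by (apply Rdiv_lt_0_compat; lra).
  assert (hdeg : de * (1 + 2 * C) = gm) by (unfold de; field; lra).
  assert (hdeg' : de < gm) by nra.
  assert (Tex : forall y, exists x, T y x).
  { intros y. apply (min_on_ball (F y) xb gm xb).
    - intros z hz. destruct (Hr0 z ltac:(lra)) as [a1 [a2 _]]. split; [exact a1 |].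
      eexists. apply has_grad_quadratic, a2.
    - rewrite vnorm_sub_self. lra.
    - exact Gamma_xb. }
  (* Used with [A = C] for the regularized problem and with [A = 0] for the tilted one. *)
  assert (KKTmin : forall A b x, vnorm (vsub x xb) < gm -> Gamma P x ->
     (exists q, 0 < q /\ forall z, vnorm (vsub z x) <= q -> vnorm (vsub z xb) <= gm -> Gamma P z ->
       pf P x + A * dot (vsub x xb) (vsub x xb) - dot b x <= pf P z + A * dot (vsub z xb) (vsub z xb) - dot b z) ->
     exists lam, KKT x (vsub b (vscal (2 * A) (vsub x xb))) lam).
  { intros A b x hx hG [q0 [hq0 hmin]].
    pose (q := Rmin q0 (gm - vnorm (vsub x xb))).
    pose proof (Rmin_l q0 (gm - vnorm (vsub x xb))). pose proof (Rmin_r q0 (gm - vnorm (vsub x xb))).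
    destruct (multiplier_quadratic (pf P) (pDf P) A xb b x q) as [lam [h1 [h2 h3]]].
    - apply Rmin_glb_lt; lra.
    - intros z hz. pose proof (vnorm_sub_triang n z x xb).
      destruct (Hr0 z ltac:(unfold q in *; lra)) as [a1 [a2 _]]. auto.
    - intros z hz. destruct (Hr0 x ltac:(lra)) as [_ [_ a3]]. exact (has_jac_vul _ _ _ _ a3 hz).
    - exact hG.
    - intros z hz hGz. apply hmin; [unfold q in *; lra | | exact hGz].
      pose proof (vnorm_sub_triang n z x xb). unfold q in *; lra.
    - exists lam. split; [exact hG |]. split; [exact h1 |]. split; assumption. }
  assert (hxb0 : vnorm (vsub xb xb) < r1) by (rewrite vnorm_sub_self; lra).
  assert (Tnear : forall y x, T y x -> vnorm (vsub x xb) <= vnorm y).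
  { intros y x [[h1 h2] h3].
    specialize (Hpr xb vzero lam0 x hK0 hxb0 ltac:(rewrite vnorm_vzero; lra) ltac:(lra) h2).
    specialize (h3 xb). rewrite vnorm_sub_self in h3. specialize (h3 (conj (Rlt_le _ _ hg) Gamma_xb)).
    unfold F in h3. rewrite vsub_self, !dot_zero_l in h3. rewrite dot_zero_l in Hpr.
    pose proof (dot_le n y (vsub x xb)) as hd. rewrite dot_sub_r in hd.
    rewrite <- vnorm_sq in h3, Hpr. pose proof (vnorm_nonneg n (vsub x xb)). pose proof (vnorm_nonneg n y).
    unfold C in h3.
    destruct (Req_dec (vnorm (vsub x xb)) 0) as [h0 | h0]; [lra |].
    apply Rmult_le_reg_r with (vnorm (vsub x xb)); [lra |]. nra. }
  (* The subgradient of the original problem at [x] that is left when the gradient of the added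
     quadratic is taken off [y]. *)
  pose (V := fun y x => vsub y (vscal (2 * C) (vsub x xb))).
  assert (TKKT : forall y x, vnorm y < de -> T y x -> exists lam, KKT x (V y x) lam).
  { intros y x hy hT. pose proof (Tnear y x hT). destruct hT as [[h1 h2] h3].
    apply KKTmin; [lra | exact h2 |]. exists 1. split; [lra |]. intros z _ hz hGz. apply h3. auto. }
  assert (Vsmall : forall y x, vnorm y < de -> vnorm (vsub x xb) <= vnorm y -> vnorm (V y x) < gm).
  { intros y x hy hx. unfold V.
    replace (vsub y (vscal (2 * C) (vsub x xb))) with (vadd y (vscal (- (2 * C)) (vsub x xb))) by (vext; ring).
    eapply Rle_lt_trans; [apply vnorm_triang |]. rewrite vnorm_scal, Rabs_Ropp, Rabs_right by lra. nra. }
  assert (VD : forall y x y' x', dot (vsub (V y' x') (V y x)) (vsub x' x)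
     = dot (vsub y' y) (vsub x' x) - 2 * C * dot (vsub x' x) (vsub x' x)).
  { intros y x y' x'. unfold V. dots. ring. }
  assert (Tmono : forall y x y' x', vnorm y < de -> vnorm y' < de -> T y x -> T y' x' ->
     2 * dot (vsub x' x) (vsub x' x) <= dot (vsub y' y) (vsub x' x)).
  { intros y x y' x' hy hy' hT hT'.
    pose proof (Tnear _ _ hT) as n1. pose proof (Tnear _ _ hT') as n2.
    destruct (TKKT y x hy hT) as [l1 k1]. destruct (TKKT y' x' hy' hT') as [l2 k2].
    pose proof (Hpr _ _ _ x' k1 ltac:(lra) ltac:(pose proof (Vsmall y x hy n1); lra) ltac:(lra) (proj2 (proj1 hT'))) as e1.
    pose proof (Hpr _ _ _ x k2 ltac:(lra) ltac:(pose proof (Vsmall y' x' hy' n2); lra) ltac:(lra) (proj2 (proj1 hT))) as e2.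
    pose proof (VD y x y' x') as e3. rewrite dot_sub_l in e3.
    replace (vsub x x') with (vopp (vsub x' x)) in e2 by (vext; ring).
    rewrite !dot_opp_r, dot_opp_l in e2. unfold C in *. lra. }
  assert (Tlip1 : forall y x y' x', vnorm y < de -> vnorm y' < de -> T y x -> T y' x' ->
     2 * vnorm (vsub x' x) <= vnorm (vsub y' y)).
  { intros y x y' x' hy hy' hT hT'. pose proof (Tmono y x y' x' hy hy' hT hT') as h.
    pose proof (dot_le n (vsub y' y) (vsub x' x)) as hd. rewrite <- vnorm_sq in h.
    pose proof (vnorm_nonneg n (vsub x' x)). pose proof (vnorm_nonneg n (vsub y' y)).
    destruct (Req_dec (vnorm (vsub x' x)) 0) as [h0 | h0]; [lra |].
    apply Rmult_le_reg_r with (vnorm (vsub x' x)); [lra |]. nra. }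
  pose (mu := 2 * C + / kappa).
  assert (hki : 0 < / kappa) by (apply Rinv_0_lt_compat, hkappa).
  assert (hmu : 0 < mu) by (unfold mu; lra).
  assert (Tcalm : forall y x, vnorm y < de -> T y x -> exists eta, 0 < eta /\ forall y' x',
     vnorm y' < de -> T y' x' -> vnorm (vsub y' y) < eta -> vnorm (vsub x' x) <= / mu * vnorm (vsub y' y)).
  { intros y x hy hT. pose proof (Tnear _ _ hT) as n1. destruct (TKKT y x hy hT) as [l1 k1].
    destruct (Hsm _ _ _ k1 ltac:(lra) ltac:(pose proof (Vsmall y x hy n1); lra)) as [eta [he H]].
    (* By [Tlip1], [V] moves by at most [|y' - y| + 2 C |x' - x| <= (1 + C) |y' - y|]. *)
    exists (eta / (1 + C)). split; [apply Rdiv_lt_0_compat; lra |].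
    intros y' x' hy' hT' hyy. destruct (TKKT y' x' hy' hT') as [l2 k2].
    pose proof (Tlip1 y x y' x' hy hy' hT hT') as hl.
    pose proof (vnorm_nonneg n (vsub x' x)) as hn. pose proof (vnorm_nonneg n (vsub y' y)) as hn'.
    assert (hyy' : vnorm (vsub y' y) * (1 + C) < eta).
    { apply Rmult_lt_compat_r with (r := 1 + C) in hyy; [| lra].
      replace (eta / (1 + C) * (1 + C)) with eta in hyy by (field; lra). exact hyy. }
    assert (hVV : vnorm (vsub (V y' x') (V y x)) < eta).
    { replace (vsub (V y' x') (V y x)) with (vadd (vsub y' y) (vscal (- (2 * C)) (vsub x' x)))
        by (unfold V; vext; ring).
      eapply Rle_lt_trans; [apply vnorm_triang |]. rewrite vnorm_scal, Rabs_Ropp, Rabs_right by lra. nra. }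
    specialize (H _ _ _ k2 ltac:(nra) hVV). rewrite VD in H.
    pose proof (dot_le n (vsub y' y) (vsub x' x)) as hd. rewrite <- vnorm_sq in H.
    apply Rmult_le_reg_l with mu; [exact hmu |]. rewrite <- Rmult_assoc, Rinv_r, Rmult_1_l by lra.
    destruct (Req_dec (vnorm (vsub x' x)) 0) as [h0 | h0]; [rewrite h0; lra |].
    apply Rmult_le_reg_r with (vnorm (vsub x' x)); [lra |]. unfold mu. nra. }
  destruct (fun_choice _ _ _ Tex) as [Tf hTf].
  assert (Tlip : forall y e : Vec n, vnorm y < de -> vnorm (vadd y e) < de ->
     vnorm (vsub (Tf (vadd y e)) (Tf y)) <= / mu * vnorm e).
  { apply lipschitz_of_calm. intros y hy. destruct (Tcalm y (Tf y) hy (hTf y)) as [eta [he H]].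
    exists eta. split; [exact he |]. intros y' hy' hyy. apply H; auto. }
  (* Keeps the argument [y + mu (z - x)] of [argmin_growth] inside the ball of radius [de]. *)
  pose (d2 := de / (1 + 2 * mu)).
  assert (hd2 : 0 < d2) by (apply Rdiv_lt_0_compat; lra).
  assert (hd2e : d2 * (1 + 2 * mu) = de) by (unfold d2; field; lra).
  assert (hd2d : d2 < de) by nra.
  (* Taking away the added quadratic lowers the growth coefficient from [mu / 2] to [mu / 2 - C],
     that is, half of [/ kappa]. *)
  assert (Hgrow : forall y x z, vnorm y < d2 -> T y x -> vnorm (vsub z xb) < d2 -> Gamma P z ->
     pf P x + dot (V y x) (vsub z x) + / 2 * / kappa * dot (vsub z x) (vsub z x) <= pf P z).
  { intros y x z hy hT hz hGz.
    assert (hyd : vnorm y < de) by lra.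
    assert (Ex : x = Tf y).
    { pose proof (Tlip1 y (Tf y) y x hyd hyd (hTf y) hT) as h. rewrite vnorm_sub_self in h.
      apply vnorm_sub_0. pose proof (vnorm_nonneg n (vsub x (Tf y))). lra. }
    pose proof (Tnear _ _ hT) as hxn.
    pose (e := vscal mu (vsub z x)).
    assert (hze : vnorm (vadd y e) < de).
    { eapply Rle_lt_trans; [apply vnorm_triang |]. unfold e. rewrite vnorm_scal, Rabs_right by lra.
      pose proof (vnorm_sub_triang n z xb x). rewrite (vnorm_sub_sym n xb x) in *. nra. }
    assert (E : dot (vsub z xb) (vsub z xb) = dot (vsub x xb) (vsub x xb) + 2 * dot (vsub x xb) (vsub z x)
       + dot (vsub z x) (vsub z x)).
    { dots. rewrite (dot_comm n xb x), (dot_comm n z x), (dot_comm n xb z). ring. }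
    unfold e in hze. rewrite Ex in hze. assert (hzg : vnorm (vsub z xb) <= gm) by lra.
    pose proof (argmin_growth (fun z => vnorm (vsub z xb) <= gm /\ Gamma P z)
      (fun z => pf P z + C * dot (vsub z xb) (vsub z xb)) Tf mu de hmu hTf Tlip y z hyd
      (conj hzg hGz) hze) as hgrow.
    rewrite <- Ex in hgrow. cbv beta in hgrow. rewrite E in hgrow.
    unfold V. rewrite dot_sub_l, dot_scal_l. unfold mu in hgrow. lra. }
  assert (hT0 : T vzero xb).
  { pose proof (Tnear _ _ (hTf vzero)) as h. rewrite vnorm_vzero in h.
    assert (E : Tf vzero = xb) by (apply vnorm_sub_0; pose proof (vnorm_nonneg n (vsub (Tf vzero) xb)); lra).
    pose proof (hTf vzero) as h2. rewrite E in h2. exact h2. }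
  assert (Hgrow0 : forall z, vnorm (vsub z xb) < d2 -> Gamma P z ->
     pf P xb + / 2 * / kappa * dot (vsub z xb) (vsub z xb) <= pf P z).
  { intros z hz hGz. pose proof (Hgrow vzero xb z ltac:(rewrite vnorm_vzero; lra) hT0 hz hGz) as h.
    replace (V vzero xb) with (@vzero n) in h by (unfold V; vext; ring). rewrite dot_zero_l in h. lra. }
  pose (gam := d2 / 2).
  (* Three demands: minimizers of the tilted problem are interior to the [gam]-ball, [v] is small
     enough for prox-regularity, and [v + 2 C (x - xb)] stays below [d2]. *)
  pose (rr := Rmin (gam / (4 * kappa)) (Rmin gm (d2 / (1 + 4 * C * kappa)))).
  assert (hgam : 0 < gam /\ gam < d2) by (unfold gam; lra).
  assert (hCk : 0 < C * kappa) by nra.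
  assert (hrr : 0 < rr).
  { unfold rr. repeat apply Rmin_glb_lt; [apply Rdiv_lt_0_compat; lra | exact hg | apply Rdiv_lt_0_compat; lra]. }
  assert (hrr1 : rr * (4 * kappa) <= gam).
  { apply Rle_trans with (gam / (4 * kappa) * (4 * kappa)).
    - apply Rmult_le_compat_r; [lra | apply Rmin_l].
    - right. field. lra. }
  assert (hrr2 : rr <= gm) by (eapply Rle_trans; [apply Rmin_r | apply Rmin_l]).
  assert (hrr3 : rr * (1 + 4 * C * kappa) <= d2).
  { apply Rle_trans with (d2 / (1 + 4 * C * kappa) * (1 + 4 * C * kappa)).
    - apply Rmult_le_compat_r; [lra |]. eapply Rle_trans; [apply Rmin_r | apply Rmin_r].
    - right. field. lra. }
  assert (Mgrow : forall v x, vnorm v < rr -> Mgam P xb gam v x -> forall z, vnorm (vsub z xb) <= gam -> Gamma P z ->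
     pf P x + dot v (vsub z x) + / 2 * / kappa * dot (vsub z x) (vsub z x) <= pf P z).
  { intros v x hv [hx1 [hx2 hx3]] z hz hGz.
    assert (hxn : vnorm (vsub x xb) <= 2 * kappa * vnorm v).
    { specialize (hx3 xb). rewrite vnorm_sub_self in hx3. specialize (hx3 ltac:(lra) Gamma_xb).
      pose proof (Hgrow0 x ltac:(lra) hx2) as h0. pose proof (dot_le n v (vsub x xb)) as hd.
      rewrite dot_sub_r in hd. rewrite <- vnorm_sq in h0.
      pose proof (vnorm_nonneg n (vsub x xb)). pose proof (vnorm_nonneg n v).
      assert (hq : / kappa * (vnorm (vsub x xb) * vnorm (vsub x xb)) <= 2 * (vnorm v * vnorm (vsub x xb))) by lra.
      apply Rmult_le_compat_l with (r := kappa) in hq; [| lra].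
      rewrite <- Rmult_assoc, Rinv_r, Rmult_1_l in hq by lra.
      destruct (Req_dec (vnorm (vsub x xb)) 0) as [hz0 | hz0]; [nra |].
      apply Rmult_le_reg_r with (vnorm (vsub x xb)); [lra |]. nra. }
    pose proof (vnorm_nonneg n v) as hv0.
    assert (hxg : vnorm (vsub x xb) < gam) by nra.
    destruct (KKTmin 0 v x ltac:(lra) hx2) as [lam hKx].
    { exists (gam - vnorm (vsub x xb)). split; [lra |]. intros y hy _ hGy.
      pose proof (vnorm_sub_triang n y x xb). specialize (hx3 y ltac:(lra) hGy). lra. }
    replace (vsub v (vscal (2 * 0) (vsub x xb))) with v in hKx by (vext; ring).
    pose (y := vadd v (vscal (2 * C) (vsub x xb))).
    assert (hVy : V y x = v) by (unfold V, y; vext; ring).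
    assert (hy : vnorm y < d2).
    { eapply Rle_lt_trans; [apply vnorm_triang |]. rewrite vnorm_scal, Rabs_right by lra. nra. }
    (* Prox-regularity at the subgradient [v] makes the local minimizer [x] the global one of the
       regularized problem at [y], because [C0 < C]. *)
    assert (hTy : T y x).
    { split; [split; [lra | exact hx2] |]. intros z' [hz1 hz2].
      pose proof (Hpr x v lam z' hKx ltac:(lra) ltac:(lra) ltac:(lra) hz2) as h.
      unfold F, y. rewrite !dot_add_l, !dot_scal_l.
      assert (E : dot (vsub z' xb) (vsub z' xb) = dot (vsub x xb) (vsub x xb) + 2 * dot (vsub x xb) (vsub z' x)
         + dot (vsub z' x) (vsub z' x)).
      { dots. rewrite (dot_comm n xb x), (dot_comm n z' x), (dot_comm n xb z'). ring. }
      rewrite E. rewrite (dot_sub_r n z' x v) in h. rewrite (dot_sub_r n z' x (vsub x xb)).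
      pose proof (dot_nonneg n (vsub z' x)). unfold C. lra. }
    pose proof (Hgrow y x z hy hTy ltac:(lra) hGz) as h. rewrite hVy in h. exact h. }
  (* Adding the growth inequalities with the roles exchanged cancels the function values and doubles
     the coefficient, so the Lipschitz constant is exactly [kappa]. *)
  assert (Mlip : forall v1 v2 x1 x2, vnorm v1 < rr -> vnorm v2 < rr ->
     Mgam P xb gam v1 x1 -> Mgam P xb gam v2 x2 -> vnorm (vsub x1 x2) <= kappa * vnorm (vsub v1 v2)).
  { intros v1 v2 x1 x2 h1 h2 M1 M2.
    pose proof (Mgrow v1 x1 h1 M1 x2 (proj1 M2) (proj1 (proj2 M2))) as e1.
    pose proof (Mgrow v2 x2 h2 M2 x1 (proj1 M1) (proj1 (proj2 M1))) as e2.
    replace (vsub x2 x1) with (vopp (vsub x1 x2)) in e1 by (vext; ring).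
    rewrite !dot_opp_r, dot_opp_l in e1.
    pose proof (dot_le n (vsub v1 v2) (vsub x1 x2)) as hd. rewrite dot_sub_l in hd.
    rewrite <- !vnorm_sq in e1, e2.
    pose proof (vnorm_nonneg n (vsub x1 x2)). pose proof (vnorm_nonneg n (vsub v1 v2)).
    assert (hq : / kappa * (vnorm (vsub x1 x2) * vnorm (vsub x1 x2)) <= vnorm (vsub v1 v2) * vnorm (vsub x1 x2)) by lra.
    apply Rmult_le_compat_l with (r := kappa) in hq; [| lra].
    rewrite <- Rmult_assoc, Rinv_r, Rmult_1_l in hq by lra.
    destruct (Req_dec (vnorm (vsub x1 x2)) 0) as [hz0 | hz0]; [nra |].
    apply Rmult_le_reg_r with (vnorm (vsub x1 x2)); [lra |]. nra. }
  assert (Muniq : forall v x1 x2, vnorm v < rr -> Mgam P xb gam v x1 -> Mgam P xb gam v x2 -> x1 = x2).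
  { intros v x1 x2 hv M1 M2. pose proof (Mlip v v x1 x2 hv hv M1 M2) as h.
    rewrite vnorm_sub_self, Rmult_0_r in h. apply vnorm_sub_0. pose proof (vnorm_nonneg n (vsub x1 x2)). lra. }
  assert (Mxb : Mgam P xb gam vzero xb).
  { split; [rewrite vnorm_sub_self; lra |]. split; [exact Gamma_xb |]. intros y hy hGy.
    pose proof (Hgrow0 y ltac:(lra) hGy). rewrite !dot_zero_l.
    pose proof (dot_nonneg n (vsub y xb)). nra. }
  exists gam. split; [lra |]. split.
  - exists rr. split; [exact hrr |]. split; [| exact Mlip].
    intros v hv.
    destruct (min_on_ball (fun z => pf P z + 0 * dot (vsub z xb) (vsub z xb) - dot v z) xb gam xb) as [x [[hx1 hx2] hx3]].
    + intros z hz. destruct (Hr0 z ltac:(lra)) as [a1 [a2 _]]. split; [exact a1 |].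
      eexists. apply has_grad_quadratic, a2.
    + rewrite vnorm_sub_self. lra.
    + exact Gamma_xb.
    + assert (Mx : Mgam P xb gam v x).
      { split; [exact hx1 |]. split; [exact hx2 |]. intros y hy hGy. specialize (hx3 y (conj hy hGy)). lra. }
      exists x. split; [exact Mx |]. intros x2 M2. exact (Muniq v x x2 hv Mx M2).
  - intros x. split; [| intros ->; exact Mxb]. intros Mx.
    apply (Muniq vzero x xb); [rewrite vnorm_vzero; exact hrr | exact Mx | exact Mxb].
Qed.
End Local.

(** * Extended reals and the exact bound of tilt stability *)

Lemma ER_le_trans a b c : ER_le a b -> ER_le b c -> ER_le a c.
Proof. destruct a, b, c; simpl; try tauto; lra. Qed.

Lemma ER_lt_fin_of_le a b e : a < b -> ER_le (ERfin b) e -> ER_lt (ERfin a) e.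
Proof.
  intros h hb. destruct e as [r | |]; simpl in hb; split; simpl; try discriminate; try tauto; try lra.
  intros E. injection E. lra.
Qed.

Lemma ER_min_le_l a b : ER_le (ER_min a b) a.
Proof. apply (proj1 (ER_inf_spec _)). left. reflexivity. Qed.

Lemma ER_min_le_r a b : ER_le (ER_min a b) b.
Proof. apply (proj1 (ER_inf_spec _)). right. reflexivity. Qed.

Lemma ER_min_glb c a b : ER_le c a -> ER_le c b -> ER_le c (ER_min a b).
Proof. intros ha hb. apply (proj2 (ER_inf_spec _)). intros x [-> | ->]; assumption. Qed.

Lemma tilt_le_of_stable n m (P : Prob n m) xb kappa :
  0 < kappa -> tilt_stable P xb kappa -> ER_le (tilt P xb) (ERfin kappa).
Proof.
  intros hk [gam [hg [[r [hr hl]] _]]].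
  apply ER_le_trans with (lipM P xb gam).
  - apply (proj1 (ER_inf_spec _)). exists gam. auto.
  - apply (proj1 (ER_inf_spec _)). exists kappa, r. split; [lra | auto].
Qed.

Theorem theorem4p5 (n m : nat) (P : Prob n m) (xb : Vec n) (sigma kappa : R) :
  (1 <= n)%nat -> (1 <= m)%nat ->
  C2_around (pf P) (pDf P) (pD2f P) xb ->
  C2_around (pg0 P) (pDg0 P) (pD2g0 P) xb ->
  (forall k, C2_around (fun x => pgr P x k) (pDgr P k) (pD2gr P k) xb) ->
  Gamma P xb -> g P xb = yzero ->
  stationary P xb ->
  0 < sigma -> MSCQ P xb sigma ->
  (forall u, crit P xb (vopp (pDf P xb)) u -> Jg P xb u = yzero) ->
  0 < kappa ->
  (forall u lam, crit P xb (vopp (pDf P xb)) u -> sphere u ->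
     dirmult P xb (vopp (pDf P xb)) u lam -> / kappa < Aval P xb lam u) ->
  (forall u lam v w, Zset P xb u lam v w ->
     (qZ P xb v w <> yzero ->
        ER_lt (ERfin (/ kappa))
              (ER_addr (Aval P xb lam u) (ER_divr (rho P xb u lam v) (fst (qZ P xb v w)))))
     /\ (rho P xb u lam v = ERfin 0 -> / kappa < Aval P xb lam u)) ->
  tilt_stable P xb kappa /\
  ER_le (tilt P xb) (ER_inv (ER_min (ER_min (chi1 P xb) (chi2 P xb)) (chi3 P xb))).
Proof.
  intros _ _ hf hg0 hgr _ hgx hstat hsigma hM hcrit hkappa hA hB.
  split.
  { apply (tilt_stable_of_conditions P xb sigma); assumption. }
  set (mu := ER_min (ER_min (chi1 P xb) (chi2 P xb)) (chi3 P xb)).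
  assert (h1 : ER_le mu (chi1 P xb)) by exact (ER_le_trans _ _ _ (ER_min_le_l _ _) (ER_min_le_l _ _)).
  assert (h2 : ER_le mu (chi2 P xb)) by exact (ER_le_trans _ _ _ (ER_min_le_l _ _) (ER_min_le_r _ _)).
  assert (h3 : ER_le mu (chi3 P xb)) by exact (ER_min_le_r _ _).
  assert (hlow : ER_le (ERfin (/ kappa)) mu).
  { repeat apply ER_min_glb; apply (proj2 (ER_inf_spec _)).
    - intros e [u [lam [a1 [a2 [a3 ->]]]]]. simpl. left. apply hA; assumption.
    - intros e [u [lam [[v [w [a1 a2]]] ->]]]. simpl. left. apply (hB _ _ _ _ a1), a2.
    - intros e [u [lam [v [w [a1 [a2 ->]]]]]]. apply (hB _ _ _ _ a1), a2. }
  (* The stability part is applied again with another modulus: conditions (a) and (b) hold for every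
     [k'] with [/ k'] strictly below the three infima. *)
  assert (hstep : forall k', 0 < k' -> (forall e, ER_le mu e -> ER_lt (ERfin (/ k')) e) ->
    ER_le (tilt P xb) (ERfin k')).
  { intros k' hk' hlt. apply tilt_le_of_stable; [exact hk' |].
    apply (tilt_stable_of_conditions P xb sigma); try assumption.
    - intros u lam a1 a2 a3.
      assert (H : ER_lt (ERfin (/ k')) (ERfin (Aval P xb lam u))).
      { apply hlt. apply (ER_le_trans _ _ _ h1), (proj1 (ER_inf_spec _)). exists u, lam. auto. }
      destruct H as [H H']. simpl in H. destruct (Rle_lt_or_eq_dec _ _ H) as [h | h]; [exact h |].
      destruct H'. rewrite h. reflexivity.
    - intros u lam v w hZ. split.
      + intros hq. apply hlt. apply (ER_le_trans _ _ _ h3), (proj1 (ER_inf_spec _)).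
        exists u, lam, v, w. auto.
      + intros hr.
        assert (H : ER_lt (ERfin (/ k')) (ERfin (Aval P xb lam u))).
        { apply hlt. apply (ER_le_trans _ _ _ h2), (proj1 (ER_inf_spec _)). exists u, lam.
          split; [exists v, w; auto | reflexivity]. }
        destruct H as [H H']. simpl in H. destruct (Rle_lt_or_eq_dec _ _ H) as [h | h]; [exact h |].
        destruct H'. rewrite h. reflexivity. }
  (* At the reciprocal of the infimum itself the inequalities in (a) and (b) may fail to be strict,
     so the bound is approached from larger moduli. *)
  assert (hlim : forall b, (forall k', b < k' -> ER_le (tilt P xb) (ERfin k')) -> ER_le (tilt P xb) (ERfin b)).
  { intros b hb. pose proof (hb (b + 1) ltac:(lra)) as hb1.
    destruct (tilt P xb) as [r | |]; [| destruct hb1 | exact I].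
    simpl. apply le_epsilon. intros e he. apply (hb (b + e)). lra. }
  pose proof (Rinv_0_lt_compat _ hkappa) as hki.
  destruct mu as [r | |]; simpl in hlow; simpl; [| | destruct hlow].
  - assert (hr : 0 < r) by lra. pose proof (Rinv_0_lt_compat _ hr) as hri.
    apply hlim. intros k' hk'. apply hstep; [lra |]. intros e he.
    apply (ER_lt_fin_of_le _ r); [| exact he]. rewrite <- (Rinv_inv r).
    apply Rinv_lt_contravar; [nra | exact hk'].
  (* The minimum is [ERpinf]: every positive modulus is admissible, and the exact bound is at most
     0. *)
  - apply hlim. intros k' hk'. apply hstep; [exact hk' |]. intros e he.
    apply (ER_lt_fin_of_le _ (/ k' + 1)); [lra |]. destruct e; [destruct he | exact I | destruct he].
Qed.
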